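(* Suppose Assumptions A and B (stated in the context) hold. Let $\theta_1\in(3/4,5/6]$, $\theta_2=2\theta_1-3/2$ and $\theta_3=\theta_1-1/2$. For any $T\in\mathbb{N}_+$, let $\boldsymbol{x}_T=(x_1,\dots,x_T)$ be the sequence generated by Algorithm 1 (described in the context) with, for all $i\in[n]$ and $t\in\mathbb{N}_+$, $$\alpha_{i,t}=\frac{r_i^2}{4mp_i^2F_{g_i}^2t^{\theta_1}},\quad \beta_{i,t}=\frac{2}{t^{\theta_2}},\quad \gamma_{i,t}=\frac{1}{t^{1-\theta_2}},\quad \xi_{i,t}=\frac{1}{(t+1)^{\theta_3}},\quad \delta_{i,t}=\frac{r_i}{(t+1)^{\theta_3}}.$$ Then $$\mathbf{E}[\mathrm{Reg}(\boldsymbol{x}_T,\check{\boldsymbol{x}}^*_T)]\le C_1T^{\theta_1},\qquad \mathbf{E}\Big[\Big\|\Big[\sum_{t=1}^Tg_t(x_t)\Big]_+\Big\|\Big]\le\sqrt{C_2}\,T^{7/4-\theta_1},$$ where $\check{\boldsymbol{x}}^*_T=(\check x^*_T,\dots,\check x^*_T)$ with $\check x^*_T$ a minimizer of $\sum_{t=1}^Tf_t(x)$ over $x\in\mathbb{X}$ subject to $g_t(x)\le\mathbf{0}_m$ for all $t\in[T]$, and $$C_1=\sum_{i=1}^n\Big(\frac{mF_gG_{g_i}(2r_i+R_i)}{1-\theta_3+\theta_2}+\frac{G_{f_i}(2r_i+R_i)}{1-\theta_3}+\frac{8mp_i^2F_{g_i}^2R_i^2}{r_i^2}+\frac{F_{f_i}^2}{4mF_{g_i}^2(1-\theta_1+2\theta_3)}+\frac{16mp_i^2F_{g_i}^2R_i^2}{r_i^2}\Big)+\frac{C_0}{\theta_2},$$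 $$C_2=C_{2,1}\Big(2\sum_{i=1}^nF_{f_i}+C_1\Big),\qquad C_{2,1}=2n\Big(1+\max_{i\in[n]}\Big\{\frac{F_{f_i}^2}{F_{g_i}^2(1-\theta_1+2\theta_3)}\Big\}+\frac{1}{1-\theta_2}\Big),$$ $$F_g=\max_{i\in[n]}F_{g_i},\quad C_0=\frac{6mn^2F_g^2\tau}{1-\lambda}+2mnF_g^2,\quad \tau=\Big(1-\frac{w}{2n^2}\Big)^{-2},\quad \lambda=\Big(1-\frac{w}{2n^2}\Big)^{1/\iota}.$$
   Context: Notation. $[n]=\{1,\dots,n\}$; $\mathbb{N}_+$ is the set of positive integers; $\|\cdot\|$ is the Euclidean norm; $\mathbb{B}^p,\mathbb{S}^p$ are the unit ball and unit sphere of $\mathbb{R}^p$; $\mathcal{P}_{\mathbb{K}}$ is Euclidean projection on $\mathbb{K}$; $[\cdot]_+=\mathcal{P}_{\mathbb{R}^m_+}$; vector inequalities are componentwise; $(1-\xi)\mathbb{K}=\{(1-\xi)x:x\in\mathbb{K}\}$. Problem. There are $n$ learners and an adversary. Learner $i$ has a decision set $\mathbb{X}_i\subseteq\mathbb{R}^{p_i}$; $\mathbb{X}=\mathbb{X}_1\times\cdots\times\mathbb{X}_n$. At the beginning of each round $t$ the adversary chooses $f_{i,t}:\mathbb{X}_i\to\mathbb{R}$ and $g_{i,t}:\mathbb{X}_i\to\mathbb{R}^m$, $i\in[n]$, possibly depending on the past decisions $x_1,\dots,x_{t-1}$ but not on the current decision; then learners choose $x_{i,t}\in\mathbb{X}_i$.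 Write $x_t=(x_{1,t},\dots,x_{n,t})$, $f_t(x_t)=\sum_{i=1}^nf_{i,t}(x_{i,t})$, $g_t(x_t)=\sum_{i=1}^ng_{i,t}(x_{i,t})$. For sequences $\boldsymbol{x}_T=(x_1,\dots,x_T)$, $\boldsymbol{y}_T=(y_1,\dots,y_T)$ with $y_t=(y_{1,t},\dots,y_{n,t})$, $\mathrm{Reg}(\boldsymbol{x}_T,\boldsymbol{y}_T)=\sum_{t=1}^Tf_t(x_t)-\sum_{t=1}^Tf_t(y_t)$. Let $\mathcal{X}_T=\{(x_1,\dots,x_T):x_t\in\mathbb{X},\ g_t(x_t)\le\mathbf{0}_m,\ t\in[T]\}$ and $\check{\mathcal{X}}_T=\{(x,\dots,x):x\in\mathbb{X},\ g_t(x)\le\mathbf{0}_m,\ t\in[T]\}\subseteq\mathcal{X}_T$; both are assumed nonempty for every $T\in\mathbb{N}_+$. Graph. $\mathcal{G}_t=(\mathcal{V},\mathcal{E}_t)$ is a time-varying directed graph on $\mathcal{V}=[n]$; the mixing matrix $W_t\in\mathbb{R}^{n\times n}$ satisfies $[W_t]_{ij}>0$ if $(j,i)\in\mathcal{E}_t$ or $i=j$, and $[W_t]_{ij}=0$ otherwise. Assumption A. For every $t\in\mathbb{N}_+$: (a) there is a constant $w\in(0,1)$ (independent of $t$) with $[W_t]_{ij}\ge w$ whenever $[W_t]_{ij}>0$; (b) $W_t$ is doubly stochastic; (c) there is an integer $\iota>0$ (independent of $t$) such that $(\mathcal{V},\cup_{l=0}^{\iota-1}\mathcal{E}_{t+l})$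 is strongly connected. Assumption B. For each $i\in[n]$: (a) $\mathbb{X}_i$ is convex and closed and $r_i\mathbb{B}^{p_i}\subseteq\mathbb{X}_i\subseteq R_i\mathbb{B}^{p_i}$ for some $r_i,R_i>0$; (b) $f_{i,t}$ and all components $[g_{i,t}]_j$, $j\in[m]$, are convex with $|f_{i,t}(x)|\le F_{f_i}$ and $|[g_{i,t}(x)]_j|\le F_{g_i}$ for all $t$, $j$, $x\in\mathbb{X}_i$, where $F_{f_i},F_{g_i}>0$ are constants; (c) $f_{i,t},g_{i,t}$ are differentiable with $\|\nabla f_{i,t}(x)\|\le G_{f_i}$ and $\|\nabla[g_{i,t}(x)]_j\|\le G_{g_i}$ for all $t$, $j$, $x\in\mathbb{X}_i$, where $G_{f_i},G_{g_i}>0$ are constants. Algorithm 1 (one-point bandit feedback), with sequences $\alpha_{i,t},\beta_{i,t},\gamma_{i,t},\xi_{i,t},\delta_{i,t}$. The vectors $u_{i,t}$, $i\in[n]$, $t\ge1$, are drawn independently and uniformly from $\mathbb{S}^{p_i}$. Initialize $z_{i,1}\in(1-\xi_{i,1})\mathbb{X}_i$, $x_{i,1}=z_{i,1}+\delta_{i,1}u_{i,1}$, $q_{i,1}=\mathbf{0}_m$. For $t\ge2$ and each $i\in[n]$: $\tilde q_{i,t}=\sum_{j=1}^n[W_{t-1}]_{ij}q_{j,t-1}$; $z_{i,t}=\mathcal{P}_{(1-\xi_{i,t})\mathbb{X}_i}(z_{i,t-1}-\alpha_{i,t}a_{i,t})$; $x_{i,t}=z_{i,t}+\delta_{i,t}u_{i,t}$;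 $q_{i,t}=[(1-\beta_{i,t}\gamma_{i,t})\tilde q_{i,t}+\gamma_{i,t}g_{i,t-1}(x_{i,t-1})]_+$; where $a_{i,t}=\hat\nabla_1f_{i,t-1}(z_{i,t-1})+(\hat\nabla_1g_{i,t-1}(z_{i,t-1}))^\top\tilde q_{i,t}$, $\hat\nabla_1f_{i,t}(z_{i,t})=\frac{p_i}{\delta_{i,t}}f_{i,t}(z_{i,t}+\delta_{i,t}u_{i,t})u_{i,t}$ and $\hat\nabla_1g_{i,t}(z_{i,t})=\frac{p_i}{\delta_{i,t}}g_{i,t}(z_{i,t}+\delta_{i,t}u_{i,t})u_{i,t}^\top\in\mathbb{R}^{m\times p_i}$. Expectations $\mathbf{E}$ are over the random vectors $u_{i,t}$. *)

(* Defs.v *)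
From HB Require Import structures.
From mathcomp Require Import all_boot all_order all_algebra.
From mathcomp Require Import all_classical all_reals all_analysis.

Set Implicit Arguments.
Unset Strict Implicit.
Unset Printing Implicit Defensive.

Import Order.TTheory GRing.Theory Num.Theory.
Import numFieldNormedType.Exports.

Local Open Scope classical_set_scope.
Local Open Scope ring_scope.

(* Rounds are numbered from 1; values at round 0 are never used. *)

Section Euclidean.
Context {R : realType} {k : nat}.
Implicit Types (K : set 'cV[R]_k) (x y v : 'cV[R]_k).

(* The library norm on matrices is the sup norm; it induces the same topology,
   so [open], [closed] and [nbhs] need no adaptation. *)
Definition dot x y : R := \sum_(i < k) x i 0 * y i 0.
Definition enorm x : R := Num.sqrt (dot x x).

Definition eball (r : R) : set 'cV[R]_k := [set x | enorm x <= r].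

(* The point of K nearest to y; meaningful when it exists and is unique, as for
   K nonempty, closed and convex. *)
Definition eproj K y : 'cV[R]_k :=
  xget 0 [set z | K z /\ forall w, K w -> enorm (y - z) <= enorm (y - w)].

Definition pos_part y : 'cV[R]_k := eproj [set z | forall j, 0 <= z j 0] y.

(* (1 - xi) K *)
Definition shrink (xi : R) K : set 'cV[R]_k := [set (1 - xi) *: x | x in K].

(* v is the gradient at x of f : K -> R. Only the values of f on K matter; v is
   unique as soon as K is convex with nonempty interior. *)
Definition is_gradient K (f : 'cV[R]_k -> R) x v : Prop :=
  forall e : R, 0 < e ->
    \forall y \near within K (nbhs x),
      `|f y - f x - dot v (y - x)| <= e * enorm (y - x).

Definition borel : set (set 'cV[R]_k) := <<s @open 'cV[R]_k >>.

End Euclidean.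

Section Game.
Context {R : realType} {n m : nat} (p : 'I_n -> nat).

Definition decision := forall i : 'I_n, 'cV[R]_(p i).
Definition play := forall i : 'I_n, nat -> 'cV[R]_(p i).

Definition losses := forall i : 'I_n, nat -> 'cV[R]_(p i) -> R.
Definition constraints := forall i : 'I_n, nat -> 'cV[R]_(p i) -> 'cV[R]_m.

Definition at_round (h : play) (t : nat) : decision := fun i => h i t.
Definition constant_play (y : decision) : play := fun i _ => y i.

Definition total_loss (f : losses) (t : nat) (y : decision) : R :=
  \sum_(i < n) f i t (y i).
Definition total_constraint (g : constraints) (t : nat) (y : decision)
  : 'cV[R]_m := \sum_(i < n) g i t (y i).

Definition Reg (f : losses) (T : nat) (x y : play) : R :=
  \sum_(1 <= t < T.+1) total_loss f t (at_round x t)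
  - \sum_(1 <= t < T.+1) total_loss f t (at_round y t).

Definition feasible (X : forall i, set 'cV[R]_(p i)) (g : constraints)
    (T : nat) : set play :=
  [set y | forall t, (1 <= t <= T)%N ->
    (forall i, X i (y i t)) /\
    (forall j, total_constraint g t (at_round y t) j 0 <= 0)].

Definition static_feasible (X : forall i, set 'cV[R]_(p i)) (g : constraints)
    (T : nat) : set decision :=
  [set y | feasible X g T (constant_play y)].

Definition static_optimum (X : forall i, set 'cV[R]_(p i)) (f : losses)
    (g : constraints) (T : nat) (y : decision) : Prop :=
  static_feasible X g T y /\
  forall y', static_feasible X g T y' ->
    \sum_(1 <= t < T.+1) total_loss f t y
    <= \sum_(1 <= t < T.+1) total_loss f t y'.

(* The sigma-algebra on plays generated by the decisions of rounds 1, ..., t-1.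
   Measurability with respect to it expresses that a quantity is a Borel
   function of (x_1, ..., x_{t-1}). *)
Definition past (t : nat) : set (set play) :=
  <<s [set C | exists i s B,
        [/\ (1 <= s < t)%N, borel B & C = [set h : play | B (h i s)]]] >>.

Definition depends_on_past (t : nat) (F : play -> R) : Prop :=
  forall B : set R, measurable B -> past t (F @^-1` B).

(* An adversary maps the play to the functions it reveals; those of round t are
   determined by the decisions made strictly before round t. *)
Definition adversary (X : forall i, set 'cV[R]_(p i))
    (f : play -> losses) (g : play -> constraints) : Prop :=
  forall (i : 'I_n) (t : nat) (y : 'cV[R]_(p i)), (1 <= t)%N -> X i y ->
    depends_on_past t (fun h => f h i t y) /\
    forall j, depends_on_past t (fun h => g h i t y j 0).

Record assumption_sets (X : forall i, set 'cV[R]_(p i)) (r Rad : 'I_n -> R)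
  : Prop := {
  set_convex : forall i, convex_set (X i);
  set_closed : forall i, closed (X i);
  set_radii : forall i, 0 < r i /\ 0 < Rad i;
  set_inner_ball : forall i, eball (r i) `<=` X i;
  set_outer_ball : forall i, X i `<=` eball (Rad i) }.

Record assumption_functions (X : forall i, set 'cV[R]_(p i))
    (f : losses) (g : constraints) (Ff Fg Gf Gg : 'I_n -> R) : Prop := {
  fun_consts : forall i, [/\ 0 < Ff i, 0 < Fg i, 0 < Gf i & 0 < Gg i];
  loss_convex : forall i t, (1 <= t)%N -> convex_function (X i) (f i t);
  constraint_convex : forall i t j, (1 <= t)%N ->
    convex_function (X i) (fun x => g i t x j 0);
  loss_bound : forall i t x, (1 <= t)%N -> X i x -> `|f i t x| <= Ff i;
  constraint_bound : forall i t j x, (1 <= t)%N -> X i x ->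
    `|g i t x j 0| <= Fg i;
  loss_gradient : forall i t x, (1 <= t)%N -> X i x ->
    exists v, is_gradient (X i) (f i t) x v /\ enorm v <= Gf i;
  constraint_gradient : forall i t j x, (1 <= t)%N -> X i x ->
    exists v, is_gradient (X i) (fun y => g i t y j 0) x v /\ enorm v <= Gg i }.

Section Algorithm.
Unset Implicit Arguments.
Variables (X : forall i, set 'cV[R]_(p i)) (W : nat -> 'M[R]_n).
Variables (alpha beta gamma xi delta : 'I_n -> nat -> R).
Variables (f : losses) (g : constraints).
Variables (u z x : play) (q : 'I_n -> nat -> 'cV[R]_m).

Definition est_grad_f (i : 'I_n) (t : nat) : 'cV[R]_(p i) :=
  ((p i)%:R / delta i t * f i t (z i t + delta i t *: u i t)) *: u i t.

Definition est_grad_g (i : 'I_n) (t : nat) : 'M[R]_(m, p i) :=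
  ((p i)%:R / delta i t) *: (g i t (z i t + delta i t *: u i t) *m (u i t)^T).

Definition qtilde (i : 'I_n) (t : nat) : 'cV[R]_m :=
  \sum_(j < n) W t.-1 i j *: q j t.-1.

Definition direction (i : 'I_n) (t : nat) : 'cV[R]_(p i) :=
  est_grad_f i t.-1 + (est_grad_g i t.-1)^T *m qtilde i t.

Record algorithm1 : Prop := {
  z_init : forall i, shrink (xi i 1%N) (X i) (z i 1%N);
  q_init : forall i, q i 1%N = 0;
  z_step : forall i t, (2 <= t)%N ->
    z i t = eproj (shrink (xi i t) (X i))
                  (z i t.-1 - alpha i t *: direction i t);
  x_step : forall i t, (1 <= t)%N -> x i t = z i t + delta i t *: u i t;
  q_step : forall i t, (2 <= t)%N ->
    q i t = pos_part ((1 - beta i t * gamma i t) *: qtilde i t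
                      + gamma i t *: g i t.-1 (x i t.-1)) }.

End Algorithm.
Set Implicit Arguments.

End Game.

Section Network.
Context {R : realType} {n : nat}.

(* E t j i means that (j, i) is an edge of the graph at round t *)
Definition mixing (E : nat -> rel 'I_n) (W : nat -> 'M[R]_n) : Prop :=
  forall t i j, (1 <= t)%N ->
    (E t j i || (i == j) -> 0 < W t i j) /\
    (~~ (E t j i || (i == j)) -> W t i j = 0).

Definition doubly_stochastic (A : 'M[R]_n) : Prop :=
  [/\ forall i j, 0 <= A i j,
      forall i, \sum_j A i j = 1
    & forall j, \sum_i A i j = 1].

Definition strongly_connected (e : rel 'I_n) : Prop :=
  forall i j, connect e i j.

Record assumption_network (E : nat -> rel 'I_n) (W : nat -> 'M[R]_n)
    (w : R) (iota : nat) : Prop := {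
  weight_range : 0 < w < 1;
  weight_bound : forall t i j, (1 <= t)%N -> 0 < W t i j -> w <= W t i j;
  weight_stochastic : forall t, (1 <= t)%N -> doubly_stochastic (W t);
  window_pos : (0 < iota)%N;
  window_connected : forall t, (1 <= t)%N ->
    strongly_connected [rel i j | [exists l : 'I_iota, E (t + l)%N i j]] }.

End Network.

Section Randomness.
Context {d : measure_display} {Omega : measurableType d} {R : realType}.
Variable P : probability Omega R.

(* The uniform distribution on the unit sphere is the unique Borel probability
   on it that is invariant under all orthogonal maps. *)
Definition uniform_on_sphere {k : nat} (U : Omega -> 'cV[R]_k) : Prop :=
  [/\ forall B, borel B -> measurable (U @^-1` B),
      forall omega, enorm (U omega) = 1
    & forall (Q : 'M[R]_k) B, Q *m Q^T = 1%:M -> borel B ->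
        P [set omega | B (Q *m U omega)] = P (U @^-1` B)].

(* mutual independence of (u_{i,t}) for i in [n] and t >= 1: product rule over
   all finite subfamilies *)
Definition independent {n : nat} {p : 'I_n -> nat}
    (u : Omega -> @play R n p) : Prop :=
  forall (J : seq ('I_n * nat)) (B : forall i, nat -> set 'cV[R]_(p i)),
    uniq J -> (forall k, k \in J -> (1 <= k.2)%N) ->
    (forall i t, borel (B i t)) ->
    P [set omega | forall k, k \in J -> B k.1 k.2 (u omega k.1 k.2)]
    = (\prod_(k <- J) P [set omega | B k.1 k.2 (u omega k.1 k.2)])%E.

End Randomness.

Section Constants.
Context {R : realType} (n m : nat) (p : 'I_n -> nat).
Variables (r Rad Ff Fg Gf Gg : 'I_n -> R) (w : R) (iota : nat).
Variables (theta1 theta2 theta3 : R).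

Definition tau : R := (1 - w / (2 * n%:R ^+ 2)) ^- 2.
Definition lambda : R := (1 - w / (2 * n%:R ^+ 2)) `^ (iota%:R^-1).

(* all entries are positive, so the default value 0 is harmless *)
Definition Fgmax : R := \big[Num.max/0]_(i < n) Fg i.

Definition C0 : R :=
  6 * m%:R * n%:R ^+ 2 * Fgmax ^+ 2 * tau / (1 - lambda)
  + 2 * m%:R * n%:R * Fgmax ^+ 2.

Definition C1 : R :=
  \sum_(i < n)
    (m%:R * Fgmax * Gg i * (2 * r i + Rad i) / (1 - theta3 + theta2)
     + Gf i * (2 * r i + Rad i) / (1 - theta3)
     + 8 * m%:R * (p i)%:R ^+ 2 * Fg i ^+ 2 * Rad i ^+ 2 / r i ^+ 2
     + Ff i ^+ 2 / (4 * m%:R * Fg i ^+ 2 * (1 - theta1 + 2 * theta3))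
     + 16 * m%:R * (p i)%:R ^+ 2 * Fg i ^+ 2 * Rad i ^+ 2 / r i ^+ 2)
  + C0 / theta2.

Definition C21 : R :=
  2 * n%:R *
  (1 + \big[Num.max/0]_(i < n)
         (Ff i ^+ 2 / (Fg i ^+ 2 * (1 - theta1 + 2 * theta3)))
   + (1 - theta2)^-1).

Definition C2 : R := C21 * (2 * \sum_(i < n) Ff i + C1).

End Constants.

(* Main.v *)
Require Import Defs.
From HB Require Import structures.
From mathcomp Require Import all_boot all_order all_algebra.
From mathcomp Require Import all_classical all_reals all_analysis.
From mathcomp Require Import measurable_realfun zify ring lra.

(** The proof is a primal-dual regret analysis on each sample path, followed by
    a single expectation at the end.

    Fix the perturbations. For one learner, the estimates of the loss and of the
    constraints combine into an estimate [a_t] of the slope of the Lagrangian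
    [f_t + <g_t, s_t>], where [s_t] is the mixed dual variable ([directionE]).
    Let [v_t] be the average of [a_t] over the perturbation of round [t] alone.
    By [smoothed_slope], [v_t] satisfies the subgradient inequality of the
    Lagrangian up to the width of the perturbation. The reason is
    symmetry: the uniform law on the sphere is invariant under sign change and
    reflections, and over the orbit of a point under the reflection
    along [z - y] the inequality only compares slopes of a convex function along
    two parallel chords ([reflection_average]).

    The noise [a_t - v_t] has mean zero given the past. However, the adversary
    may react to the play, so the comparator depends on all the perturbations
    and the products of the noise with the comparator need not be centred. They
    are bounded together by the norm of a weighted sum of noise vectors. The
    square of this norm is at most the sum of the [|a_t|^2], up to terms that
    are linear in each noise vector with coefficients known before its round
    ([sqr_norm_noise_sum], [noise_against_comparator]). The first constant has
    room for this: descent takes 44/3 of the available multiple 24 of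
    [m p^2 Fg^2 Rad^2 / r^2], and the comparator takes the other 28/3.

    For the dual variables, the squared norms telescope ([dual_sum]). The
    comparator satisfies the constraints only in total, so the local terms cost
    the disagreement between the learners. Over a window in which the graph is
    connected the dispersion of a vector contracts by [1 - w / (2 n^2)], because
    every cut of the sorted values is crossed and its first crossing dissipates
    the squared gap ([window_contraction]). Hence the disagreement is at most a
    constant times the sum of the perturbations of the averaging
    ([sum_disagreement]).

    Added up, these estimates give [pathwise_regret]: the regret plus a
    nonnegative potential of the dual variables is at most [C1 T^theta1] plus
    noise terms with predictable coefficients. The same potential, multiplied by
    any [rho > 0], bounds the violation up to a term of order [1 / rho]
    ([violation_le_potential]), since the dual variables accumulate the
    constraint values.

    It remains to take expectations. What is computed before round [t] is a
    Borel function of the earlier perturbations ([adaptedP]); the revealed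
    functions are Lipschitz in the decision, so they can be evaluated at a
    random decision without losing measurability. The perturbation of round [t]
    is independent of these, so the noise terms have mean zero
    ([noise_centred]). The comparator may fail to be measurable, but the bounds
    hold pointwise and the integral is monotone ([integral_le_dominated]). For the
    violation, the bound in expectation is optimised over [rho]. *)

Set Implicit Arguments.
Unset Strict Implicit.
Unset Printing Implicit Defensive.

Import Order.TTheory GRing.Theory Num.Theory.
Import numFieldNormedType.Exports.

Local Open Scope classical_set_scope.
Local Open Scope ring_scope.

(** * The Euclidean inner product and norm *)

Section EuclideanAlgebra.
Context {R : realType} {k : nat}.
Implicit Types (x y z v : 'cV[R]_k) (a b : R).

Lemma dotC x y : dot x y = dot y x.
Proof. by apply: eq_bigr => i _; rewrite mulrC. Qed.

Lemma dotDl x y z : dot (x + y) z = dot x z + dot y z.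
Proof. by rewrite -big_split; apply: eq_bigr => i _; rewrite mxE mulrDl. Qed.

Lemma dotZl a x y : dot (a *: x) y = a * dot x y.
Proof. by rewrite /dot big_distrr; apply: eq_bigr => i _; rewrite mxE -mulrA. Qed.

Lemma dotNl x y : dot (- x) y = - dot x y.
Proof. by rewrite -scaleN1r dotZl mulN1r. Qed.

Lemma dot0l x : dot 0 x = 0.
Proof. by apply: big1 => i _; rewrite mxE mul0r. Qed.

Lemma dotBl x y z : dot (x - y) z = dot x z - dot y z.
Proof. by rewrite dotDl dotNl. Qed.

Lemma dotDr x y z : dot z (x + y) = dot z x + dot z y.
Proof. by rewrite dotC dotDl !(dotC z). Qed.

Lemma dotZr a x y : dot y (a *: x) = a * dot y x.
Proof. by rewrite dotC dotZl dotC. Qed.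

Lemma dotNr x y : dot y (- x) = - dot y x.
Proof. by rewrite dotC dotNl dotC. Qed.

Lemma dot0r x : dot x 0 = 0.
Proof. by rewrite dotC dot0l. Qed.

Lemma dotBr x y z : dot z (x - y) = dot z x - dot z y.
Proof. by rewrite dotDr dotNr. Qed.

Definition dotE := (dotDl, dotDr, dotZl, dotZr, dotNl, dotNr, dot0l, dot0r).

Lemma dot_sumr I (s : seq I) (P : pred I) (F : I -> 'cV[R]_k) x :
  dot x (\sum_(i <- s | P i) F i) = \sum_(i <- s | P i) dot x (F i).
Proof.
by apply: (big_morph (dot x)) => [u v|]; rewrite ?dotDr ?dot0r.
Qed.

Lemma dot_suml I (s : seq I) (P : pred I) (F : I -> 'cV[R]_k) x :
  dot (\sum_(i <- s | P i) F i) x = \sum_(i <- s | P i) dot (F i) x.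
Proof. by rewrite dotC dot_sumr; apply: eq_bigr => i _; rewrite dotC. Qed.

Lemma dot_ge0 x : 0 <= dot x x.
Proof. by apply: sumr_ge0 => i _; rewrite -expr2 sqr_ge0. Qed.

Lemma dot_eq0 x : dot x x = 0 -> x = 0.
Proof.
move=> /eqP; rewrite psumr_eq0; last by move=> i _; rewrite -expr2 sqr_ge0.
move=> /allP h; apply/matrixP => i j; rewrite ord1 mxE.
by have := h i (mem_index_enum _); rewrite mulf_eq0 orbb => /eqP.
Qed.

Lemma sqr_enorm x : enorm x ^+ 2 = dot x x.
Proof. by rewrite sqr_sqrtr ?dot_ge0. Qed.

Lemma enorm_ge0 x : 0 <= enorm x.
Proof. exact: sqrtr_ge0. Qed.

Lemma enorm0 : enorm (0 : 'cV[R]_k) = 0.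
Proof. by rewrite /enorm dot0l sqrtr0. Qed.

Lemma enorm_eq0 x : enorm x = 0 -> x = 0.
Proof. by move=> h; apply: dot_eq0; rewrite -sqr_enorm h expr0n. Qed.

Lemma enormZ a x : enorm (a *: x) = `|a| * enorm x.
Proof. by rewrite /enorm dotZl dotZr mulrA -expr2 sqrtrM ?sqr_ge0 ?sqrtr_sqr. Qed.

Lemma enormN x : enorm (- x) = enorm x.
Proof. by rewrite /enorm dotNl dotNr opprK. Qed.

Lemma enormC x y : enorm (x - y) = enorm (y - x).
Proof. by rewrite -enormN opprB. Qed.

Lemma enorm_le x a : 0 <= a -> (enorm x <= a) = (dot x x <= a ^+ 2).
Proof.
by move=> a0; rewrite -sqr_enorm ler_pXn2r ?nnegrE ?enorm_ge0.
Qed.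

Lemma enorm_le2 x y : (enorm x <= enorm y) = (dot x x <= dot y y).
Proof. by rewrite enorm_le ?enorm_ge0 // sqr_enorm. Qed.

Lemma dot_le_enorm x y : dot x y <= enorm x * enorm y.
Proof.
have [x0|x0] := eqVneq (enorm x) 0.
  by rewrite (enorm_eq0 x0) dot0l enorm0 mul0r.
have [y0|y0] := eqVneq (enorm y) 0.
  by rewrite (enorm_eq0 y0) dot0r enorm0 mulr0.
have xp : 0 < enorm x by rewrite lt0r x0 enorm_ge0.
have yp : 0 < enorm y by rewrite lt0r y0 enorm_ge0.
have := dot_ge0 (enorm y *: x - enorm x *: y).
rewrite !dotE -!sqr_enorm (dotC y x) => h.
have {}h : 0 <= (2 * (enorm x * enorm y)) * (enorm x * enorm y - dot x y).
  by move: h; congr (_ <= _); ring.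
by move: h; rewrite pmulr_rge0 ?subr_ge0 // !mulr_gt0.
Qed.

Lemma normr_dot x y : `|dot x y| <= enorm x * enorm y.
Proof.
rewrite ler_norml dot_le_enorm andbT lerNl -dotNl -(enormN x).
exact: dot_le_enorm.
Qed.

Lemma enormD x y : enorm (x + y) <= enorm x + enorm y.
Proof.
rewrite enorm_le ?addr_ge0 ?enorm_ge0 // !dotE -!sqr_enorm (dotC y x).
have := dot_le_enorm x y; nra.
Qed.

Lemma enormB x y : enorm (x - y) <= enorm x + enorm y.
Proof. by rewrite -(enormN y) enormD. Qed.

Lemma enorm_coord x (j : 'I_k) : `|x j 0| <= enorm x.
Proof.
rewrite -ler_sqr ?nnegrE ?enorm_ge0 // sqr_enorm real_normK ?num_real //.
rewrite /dot (bigD1 j) //= expr2 lerDl sumr_ge0 // => i _.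
by rewrite -expr2 sqr_ge0.
Qed.

Lemma enorm_sum I (s : seq I) (P : pred I) (F : I -> 'cV[R]_k) :
  enorm (\sum_(i <- s | P i) F i) <= \sum_(i <- s | P i) enorm (F i).
Proof.
elim/big_rec2: _ => [|i u v _ h]; first by rewrite enorm0.
by apply: le_trans (enormD _ _) _; rewrite lerD2l.
Qed.

Lemma enorm_le_coord x a : 0 <= a -> (forall j, `|x j 0| <= a) ->
  dot x x <= k%:R * a ^+ 2.
Proof.
move=> a0 h; rewrite mulr_natl -[X in _ *+ X]card_ord -sumr_const.
apply: ler_sum => i _; rewrite -expr2 -(real_normK (num_real _)).
by rewrite ler_pXn2r ?nnegrE.
Qed.

Lemma enorm_sup x : enorm x <= k%:R * `|x|.
Proof.
have h j : `|x j 0| <= `|x|.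
  by rewrite /Num.norm/= mx_normE; apply: (le_bigmax _ (fun ij => `|x ij.1 ij.2|%:nng) (j, 0)).
rewrite enorm_le ?mulr_ge0 // (le_trans (enorm_le_coord _ h)) //.
rewrite exprMn ler_wpM2r ?sqr_ge0 // expr2 -natrM ler_nat.
by case: (k) => // ?; rewrite leq_pmulr.
Qed.

Lemma sup_enorm x : `|x| <= enorm x.
Proof.
rewrite /Num.norm/= mx_normrE; apply/bigmax_leP; split; first exact: enorm_ge0.
by move=> -[i j] _ /=; rewrite (ord1 j) enorm_coord.
Qed.

End EuclideanAlgebra.

(** * Projection onto convex sets *)

Section Projection.
Context {R : realType} {k : nat}.
Implicit Types (x y z v w : 'cV[R]_k) (K : set 'cV[R]_k) (a : R).

Lemma near_dist_le (V : normedModType R) (x : V) a : 0 < a ->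
  \forall y \near x, `|x - y| <= a.
Proof.
move=> a0; have /cvgrPdist_le := @cvg_id _ (nbhs x); exact.
Qed.

Lemma subl_continuous (V : normedModType R) (b : V) : continuous (fun c => b - c).
Proof. by move=> x; apply: cvgB; [exact: cvg_cst | exact: cvg_id]. Qed.

Lemma scaler_continuous (V : normedModType R) a :
  continuous (fun c : V => a *: c).
Proof. by move=> x; apply: cvgZl_tmp; exact: cvg_id. Qed.

Lemma enorm_continuous : continuous (@enorm R k).
Proof.
move=> x; apply/(@cvgrPdist_le _ _ _ (nbhs x) (nbhs_filter x)) => e e0.
have k1 : 0 < k.+1%:R :> R by rewrite ltr0n.
have d0 : 0 < e / k.+1%:R by rewrite divr_gt0.
near=> y.
have h (u v : 'cV[R]_k) : enorm u - enorm v <= k%:R * `|u - v|.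
  by rewrite (le_trans _ (enorm_sup _)) // lerBlDr -{1}(subrK v u) enormD.
have {}h : `|enorm x - enorm y| <= k%:R * `|x - y|.
  by rewrite ler_norml h andbT lerNl opprB distrC h.
apply: (le_trans h).
have xy : `|x - y| <= e / k.+1%:R.
  by near: y; exact: (near_dist_le x).
apply: (@le_trans _ _ (k.+1%:R * `|x - y|)); first by rewrite ler_wpM2r // ler_nat.
by rewrite mulrC -ler_pdivlMr.
Unshelve. all: by end_near.
Qed.

Lemma normr_trmx (p q : nat) (x : 'M[R]_(p, q)) : `|x^T| = `|x|.
Proof.
have le (p' q' : nat) (y : 'M[R]_(p', q')) : `|y^T| <= `|y|.
  rewrite /Num.norm /= !mx_normrE; apply/bigmax_leP; split; rewrite ?bigmax_ge_id //.
  move=> [i j] _ /=; rewrite mxE.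
  exact: (le_bigmax 0 (fun ij : 'I_p' * 'I_q' => `|y ij.1 ij.2|) (j, i)).
by apply/le_anti; rewrite le -{1}[x]trmxK le.
Qed.

(** Heine-Borel, carried from row vectors by transposition. *)
Lemma bounded_closed_compact_cV K a :
  closed K -> K `<=` eball a -> compact K.
Proof.
move=> cK Ka.
have tc (p q : nat) : continuous (@trmx R p q).
  move=> x; apply/(@cvgrPdist_le _ _ _ (nbhs x) (nbhs_filter x)) => e e0; near=> y.
  by rewrite -linearB /= normr_trmx; near: y; exact: (near_dist_le x).
have -> : K = trmx @` [set x : 'rV[R]_k | K x^T].
  by apply/seteqP; split=> [x Kx|x [y Ky <-] //]; exists x^T; rewrite /= trmxK.
apply: continuous_compact; first exact/continuous_subspaceT/tc.
apply: bounded_closed_compact.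
  exists a; split; rewrite ?num_real // => M aM x /= /Ka h.
  by rewrite -normr_trmx (le_trans (sup_enorm _)) // (le_trans h) // ltW.
exact: closed_comp (fun _ _ => @tc _ _ _) cK.
Unshelve. all: by end_near.
Qed.

Lemma convex_setE K x y a : convex_set K -> K x -> K y -> 0 <= a <= 1 ->
  K (a *: x + (1 - a) *: y).
Proof.
move=> cK Kx Ky /andP[a0 a1].
have h : Itv.spec (@Itv.num_sem R) (Itv.Real `[0%Z, 1%Z]) a.
  by rewrite /Itv.spec/= /Itv.num_sem/= num_real in_itv/= a0.
have := cK x y (Itv.mk h); rewrite !inE; exact.
Qed.

Lemma convex_functionE K (f : 'cV[R]_k -> R) x y a : convex_function K f ->
  K x -> K y -> 0 <= a <= 1 ->
  f (a *: x + (1 - a) *: y) <= a * f x + (1 - a) * f y.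
Proof.
move=> cf Kx Ky /andP[a0 a1].
have h : Itv.spec (@Itv.num_sem R) (Itv.Real `[0%Z, 1%Z]) a.
  by rewrite /Itv.spec/= /Itv.num_sem/= num_real in_itv/= a0.
by have := cf (Itv.mk h) x y; rewrite !inE; apply.
Qed.

Lemma convex_functionI K (f : 'cV[R]_k -> R) :
  (forall x y a, K x -> K y -> 0 <= a <= 1 ->
     f (a *: x + (1 - a) *: y) <= a * f x + (1 - a) * f y) ->
  convex_function K f.
Proof.
move=> h l x y /set_mem Kx /set_mem Ky; apply: h => //.
by apply/andP; split; [exact: ge0 | exact: le1].
Qed.

Lemma eproj_min K y a : closed K -> K !=set0 -> K `<=` eball a ->
  K (eproj K y) /\ forall w, K w -> enorm (y - eproj K y) <= enorm (y - w).
Proof.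
move=> cK K0 Ka.
have [|c cK' cmin] := @compact_EVT_min _ R (fun w => enorm (y - w)) K K0
  (bounded_closed_compact_cV cK Ka).
  apply: continuous_subspaceT => x; apply: continuous_comp; last exact: enorm_continuous.
  exact: subl_continuous.
rewrite /eproj; case: xgetP => [z -> //|] /(_ c)[]; split; first exact/set_mem.
by move=> w Kw; apply: cmin; rewrite inE.
Qed.

(** First-order optimality: moving from the nearest point towards [w] cannot
    decrease the distance, so the derivative of the squared distance in that
    direction is nonnegative. *)
Lemma eproj_variational K y w a : convex_set K -> closed K -> K `<=` eball a ->
  K w -> dot (y - eproj K y) (w - eproj K y) <= 0.
Proof.
move=> vK cK Ka Kw; have [] := eproj_min y cK (ex_intro _ w Kw) Ka.
set z := eproj K y => Kz zmin; set D := dot _ _.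
set S := dot (w - z) (w - z).
have key s : 0 <= s <= 1 -> 2 * s * D <= s ^+ 2 * S.
  move=> s01; have := zmin _ (convex_setE vK Kw Kz s01).
  have -> : y - (s *: w + (1 - s) *: z) = (y - z) - s *: (w - z).
    by rewrite scalerBl scale1r scalerBr !opprD !opprK !addrA; congr (_ + _);
      rewrite -!addrA; congr (_ + _); rewrite addrC.
  rewrite enorm_le2 [dot (_ - _ *: _) _]dotBl.
  rewrite [dot (y - z) (_ - _ *: _)]dotBr [dot (_ *: _) (_ - _ *: _)]dotBr.
  rewrite !(dotZl, dotZr) [dot (w - z) (y - z)]dotC -/D -/S; nra.
rewrite leNgt; apply/negP => D0.
have S0 : 0 <= S by exact: dot_ge0.
have DS : 0 < D + S by lra.
have [t t0 tE] : exists2 t, 0 < t <= 1 & t * (D + S) = D.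
  exists (D / (D + S)); last by rewrite divfK // gt_eqF.
  by rewrite divr_gt0 //= ler_pdivrMr // mul1r lerDl.
move: t0 => /andP[t0 t1]; have := key t; rewrite ltW //= => /(_ t1).
rewrite expr2 -[2 * t]mulrC -!mulrA ler_pM2l // => h.
have : t * S <= D by nra.
lra.
Qed.

(** The variational inequality gives [|y - z|^2 + |w - z|^2 <= |y - w|^2], so no
    other point of [K] is as near. *)
Lemma eproj_unique K y z : K z ->
  (forall w, K w -> dot (y - z) (w - z) <= 0) -> eproj K y = z.
Proof.
move=> Kz zv.
have h w : K w -> dot (y - z) (y - z) + dot (w - z) (w - z) <= dot (y - w) (y - w).
  move=> Kw; have := zv _ Kw; have -> : y - w = (y - z) - (w - z).
    by rewrite opprB addrA subrK.
  rewrite !(dotBl _ _ (y - z - (w - z))) !(dotBr _ _ (y - z)) !(dotBr _ _ (w - z)).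
  rewrite -!(dotBr _ _ (y - z)) -!(dotBr _ _ (w - z)) -!dotBl.
  rewrite [dot (y - z - (w - z)) _]dotBr !(dotBl (y - z)) (dotC (w - z) (y - z)); lra.
have P w : (K w /\ forall v, K v -> enorm (y - w) <= enorm (y - v)) -> w = z.
  move=> [Kw wm]; have := wm _ Kz; rewrite enorm_le2 => h1.
  have h2 := h _ Kw; apply/subr0_eq/dot_eq0/eqP; rewrite eq_le dot_ge0 andbT; lra.
rewrite /eproj; case: xgetP => [w _ /P //|/(_ z)[]]; split=> // w /h hw.
rewrite enorm_le2.
by apply: le_trans hw; rewrite lerDl dot_ge0.
Qed.

Lemma pos_partE y j : pos_part y j 0 = Num.max 0 (y j 0).
Proof.
suff -> : pos_part y = \col_j Num.max 0 (y j 0) by rewrite mxE.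
apply: eproj_unique => [i /=|w Kw]; first by rewrite mxE le_max lexx.
apply: sumr_le0 => i _; rewrite !mxE.
have := Kw i; case: (leP 0 (y i 0)) => h wi; first by rewrite subrr mul0r.
by rewrite !subr0; apply: mulr_le0_ge0 => //; apply: ltW.
Qed.

Lemma eproj_nearer K y w a : convex_set K -> closed K -> K `<=` eball a ->
  K w -> dot (eproj K y - w) (eproj K y - w) <= dot (y - w) (y - w).
Proof.
move=> vK cK Ka Kw; have := eproj_variational y vK cK Ka Kw.
set z := eproj K y => h.
have -> : y - w = (y - z) - (w - z) by rewrite opprB addrA subrK.
have := dot_ge0 (y - z); rewrite -[z - w]opprB !(dotNl, dotNr) opprK.
rewrite !(dotBl (y - z)) !(dotBr (y - z)) (dotC (w - z)); lra.
Qed.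

(** Adding the variational inequalities of the two projections, each tested at
    the other point, shows that the projection is monotone. *)
Lemma eproj_nonexpansive K y y' a : convex_set K -> closed K -> K !=set0 ->
  K `<=` eball a -> enorm (eproj K y - eproj K y') <= enorm (y - y').
Proof.
move=> vK cK K0 Ka.
have [Kz _] := eproj_min y cK K0 Ka; have [Kz' _] := eproj_min y' cK K0 Ka.
have h1 := eproj_variational y vK cK Ka Kz'.
have h2 := eproj_variational y' vK cK Ka Kz.
move: h1 h2; set z := eproj K y; set z' := eproj K y' => h1 h2.
have [->|z0] := eqVneq (enorm (z - z')) 0; first exact: enorm_ge0.
have zp : 0 < enorm (z - z') by rewrite lt0r z0 enorm_ge0.
rewrite -(ler_pM2r zp) -expr2 sqr_enorm (le_trans _ (dot_le_enorm _ _)) //.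
move: h1 h2; rewrite !dotE !(dotC z' z) !(dotC y z) !(dotC y z') !(dotC y' z) !(dotC y' z'); lra.
Qed.

Lemma shrinkP xi K x : 0 <= xi < 1 -> convex_set K -> K 0 -> shrink xi K x -> K x.
Proof.
move=> /andP[x0 x1] vK K0 [v Kv <-].
have := convex_setE vK Kv K0 (a := 1 - xi); rewrite scaler0 addr0; apply.
by apply/andP; split; lra.
Qed.

Lemma shrink_bounded xi K a : 0 <= xi < 1 -> convex_set K -> K 0 -> K `<=` eball a ->
  shrink xi K `<=` eball a.
Proof. by move=> x01 vK K0 Ka x /(shrinkP x01 vK K0) /Ka. Qed.

Lemma shrink_convex xi K : convex_set K -> convex_set (shrink xi K).
Proof.
move=> vK _ _ l /set_mem [x Kx <-] /set_mem [y Ky <-]; apply/mem_set.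
have := vK x y l; rewrite !inE => /(_ Kx Ky) h.
eexists; first exact: h.
by rewrite /conv /= scalerDr !scalerA; congr (_ *: _ + _ *: _); rewrite mulrC.
Qed.

Lemma shrink_closed xi K : xi < 1 -> closed K -> closed (shrink xi K).
Proof.
move=> x1 cK; have x0 : 1 - xi != 0 by rewrite subr_eq0 eq_sym lt_eqF.
have -> : shrink xi K = (fun x => (1 - xi)^-1 *: x) @^-1` K.
  apply/seteqP; split=> [_ [v Kv <-]|v Kv] /=; first by rewrite scalerA mulVf // scale1r.
  by exists ((1 - xi)^-1 *: v) => //; rewrite scalerA mulfV // scale1r.
by apply: closed_comp => // x _; exact: scaler_continuous.
Qed.

End Projection.

(** * Convex functions and reflections *)

Section ConvexAnalysis.
Context {R : realType} {k : nat}.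
Implicit Types (x y z v w u : 'cV[R]_k) (K : set 'cV[R]_k) (a c G : R).
Implicit Types (f phi : 'cV[R]_k -> R).

Definition lipschitz_on K G f :=
  forall x y, K x -> K y -> f x - f y <= G * enorm (x - y).

Lemma le_of_eps a c G : 0 <= G -> (forall e, 0 < e -> a <= c + e * G) -> a <= c.
Proof.
move=> G0 h; apply/ler_addgt0Pr => e e0.
have G1 : 0 < G + 1 by lra.
apply: le_trans (h (e / (G + 1)) _) _; first by rewrite divr_gt0.
by rewrite lerD2l -mulrA ler_piMr ?(ltW e0) // mulrC ler_pdivrMr // mul1r lerDl.
Qed.

(** On the segment from [x] to [y] the gradient determines the increment of [f]
    to first order, and convexity bounds it by a proportion of [f y - f x]. *)
Lemma gradient_subgradient K f x y v : convex_set K -> convex_function K f ->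
  K x -> K y -> is_gradient K f x v -> dot v (y - x) <= f y - f x.
Proof.
move=> vK cf Kx Ky grad; apply: (@le_of_eps _ _ (enorm (y - x))); first exact: enorm_ge0.
move=> e e0; have := grad e e0; rewrite /within => /nbhs_normP [d /= d0 h].
set s := d / (d + `|y - x|).
have dp : 0 < d + `|y - x| by rewrite ltr_pwDl.
have s0 : 0 < s by rewrite divr_gt0.
have s1 : s <= 1 by rewrite /s ler_pdivrMr // mul1r lerDl.
have pE : s *: y + (1 - s) *: x = x + s *: (y - x).
  by rewrite scalerBl scale1r scalerBr addrCA.
have s01 : 0 <= s <= 1 by rewrite (ltW s0).
have Kp := convex_setE vK Ky Kx s01; have fp := convex_functionE cf Ky Kx s01.
rewrite pE in Kp fp.
have hb : ball_ Num.norm x d (x + s *: (y - x)).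
  have E : x - (x + s *: (y - x)) = - (s *: (y - x)).
    by rewrite opprD addrA subrr sub0r.
  suff : `|x - (x + s *: (y - x))| < d by [].
  rewrite E normrN normrZ (gtr0_norm s0).
  by rewrite /s mulrAC ltr_pdivrMr // mulrDr ltr_pwDl // mulr_gt0.
have pxE : x + s *: (y - x) - x = s *: (y - x) by rewrite addrAC subrr add0r.
have := h _ hb Kp; rewrite /= pxE dotZr enormZ (gtr0_norm s0).
rewrite ler_norml => /andP[h1 _]; rewrite -(ler_pM2l s0); nra.
Qed.

(** The gradient is relative to [K] and nothing is said outside [K], so the
    subgradient inequality at one endpoint takes the place of a mean value. *)
Lemma gradient_lipschitz K f G : convex_set K -> convex_function K f ->
  (forall x, K x -> exists v, is_gradient K f x v /\ enorm v <= G) ->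
  lipschitz_on K G f.
Proof.
move=> vK cf grad x y Kx Ky; have [v [vg vG]] := grad _ Kx.
have := gradient_subgradient vK cf Kx Ky vg.
have := dot_le_enorm v (x - y); rewrite -[y - x]opprB dotNr => h1 h2.
have : enorm v * enorm (x - y) <= G * enorm (x - y) by rewrite ler_wpM2r ?enorm_ge0.
lra.
Qed.

Lemma convex_slope K phi x v c : convex_set K -> convex_function K phi ->
  0 <= c -> K (x - v) -> K (x + c *: v) ->
  c * (phi x - phi (x - v)) <= phi (x + c *: v) - phi x.
Proof.
move=> vK cphi c0 K1 K2; have c1 : 0 < 1 + c by lra.
have s01 : 0 <= c / (1 + c) <= 1.
  by rewrite divr_ge0 ?(ltW c1) //= ler_pdivrMr // mul1r lerDr.
have := convex_functionE cphi K1 K2 s01.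
have -> : (c / (1 + c)) *: (x - v) + (1 - c / (1 + c)) *: (x + c *: v) = x.
  by apply/matrixP => i j; rewrite !mxE; field; rewrite gt_eqF.
have -> : 1 - c / (1 + c) = (1 + c)^-1 by field; rewrite gt_eqF.
rewrite -(ler_pM2l c1).
have -> : (1 + c) * (c / (1 + c) * phi (x - v) + (1 + c)^-1 * phi (x + c *: v))
   = c * phi (x - v) + phi (x + c *: v) by field; rewrite gt_eqF.
lra.
Qed.

(** Slopes of a convex function increase along a line, so the increment over a
    chord in the direction [v] dominates the increments over the translates by
    [- v] of its subdivision points. *)
Lemma convex_chord K phi x v c N : convex_set K -> convex_function K phi ->
  0 <= c ->
  (forall j, (j <= N)%N -> K (x + (j%:R * c) *: v)) ->
  (forall j, (j < N)%N -> K (x + (j%:R * c) *: v - v)) ->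
  c * \sum_(j < N) (phi (x + (j%:R * c) *: v) - phi (x + (j%:R * c) *: v - v))
  <= phi (x + (N%:R * c) *: v) - phi x.
Proof.
move=> vK cphi c0; elim: N => [|N IH] K1 K2.
  by rewrite big_ord0 mulr0 mul0r scale0r addr0 subrr.
rewrite big_ord_recr /= mulrDr.
have := convex_slope vK cphi c0 (K2 _ (ltnSn N)).
have E : x + (N%:R * c) *: v + c *: v = x + (N.+1%:R * c) *: v.
  by rewrite -addrA -scalerDl -natr1 mulrDl mul1r.
rewrite E => /(_ (K1 _ (leqnn _))) h.
have := IH (fun j jN => K1 j (leqW jN)) (fun j jN => K2 j (ltnW jN)); lra.
Qed.

Definition reflect_along v u := u - (2 * dot u v / dot v v) *: v.

Lemma reflect_dot v u : dot v v != 0 -> dot (reflect_along v u) v = - dot u v.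
Proof. by move=> v0; rewrite /reflect_along dotBl dotZl; field. Qed.

Lemma reflect_norm v u : enorm (reflect_along v u) = enorm u.
Proof.
have [v0|v0] := eqVneq (dot v v) 0.
  by rewrite /reflect_along (dot_eq0 v0) scaler0 subr0.
congr (Num.sqrt _); rewrite {1}/reflect_along dotBl dotZl (dotC v) reflect_dot //.
by rewrite /reflect_along dotBr dotZr; field.
Qed.

(** Reflecting [u] in the hyperplane orthogonal to [v = z - y] and in the origin
    gives four points, joined by two chords parallel to [v]. Subdivide each
    chord into [N] steps and apply [convex_chord]. The subdivision points of one
    chord are, up to one step, the antipodes of those of the other, so by
    convexity their values average to at least [phi z], while the translated
    points lie within [delta] of [y]. The one-step defect vanishes as [N] grows. *)
Lemma reflection_average K phi G delta z y u :
  convex_set K -> convex_function K phi -> 0 <= G -> lipschitz_on K G phi ->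
  0 <= delta ->
  (forall b, enorm b <= 1 -> K (z + delta *: b)) ->
  (forall b, enorm b <= 1 -> K (y + delta *: b)) ->
  dot (z - y) (z - y) != 0 -> enorm u <= 1 ->
  let u' := reflect_along (z - y) u in
  4 * dot u (z - y) ^+ 2 * delta * (phi z - phi y - G * delta)
  <= (phi (z + delta *: u) - phi (z + delta *: u')
      + phi (z - delta *: u') - phi (z - delta *: u))
     * dot u (z - y) * dot (z - y) (z - y).
Proof.
move=> vK cphi G0 lphi d0 Kz Ky; set v := z - y => v0 u1 /=.
wlog H0 : u u1 / 0 <= dot u v.
  move=> wl; have [/wl->//|/ltW H0] := leP 0 (dot u v).
  have := wl (- u); rewrite enormN dotNl oppr_ge0 => /(_ u1 H0).
  have -> : reflect_along v (- u) = - reflect_along v u.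
    by rewrite /reflect_along dotNl mulrN mulNr scaleNr opprK opprB addrC.
  by rewrite !scalerN !opprK sqrrN; lra.
set u' := reflect_along v u; set H := dot u v; set V := dot v v.
have u'1 : enorm u' <= 1 by rewrite reflect_norm.
have V0 : 0 < V by rewrite lt0r v0 dot_ge0.
have uE : u = u' + (2 * H / V) *: v by rewrite /u' /reflect_along subrK.
have Kzy : z - v = y by rewrite /v opprB addrCA subrr addr0.
clearbody u'.
(* points of the two chords, as points of the ball *)
have ball s : 0 <= s <= 1 ->
    enorm (u' + (s * (2 * H / V)) *: v) <= 1 /\
    enorm (- u + (s * (2 * H / V)) *: v) <= 1.
  move=> s01.
  have cvx (b b' : 'cV[R]_k) : enorm b <= 1 -> enorm b' <= 1 ->
      enorm (s *: b + (1 - s) *: b') <= 1.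
    move=> b1 b'1; apply: le_trans (enormD _ _) _; rewrite !enormZ.
    by case/andP: s01 => s0 s1; rewrite !ger0_norm ?subr_ge0 //; nra.
  split.
    have -> : u' + (s * (2 * H / V)) *: v = s *: u + (1 - s) *: u'.
      by rewrite {1}uE; apply/matrixP => i j; rewrite !mxE; ring.
    exact: cvx.
  have -> : - u + (s * (2 * H / V)) *: v = s *: (- u') + (1 - s) *: (- u).
    by rewrite {1 2}uE; apply/matrixP => i j; rewrite !mxE; ring.
  by apply: cvx; rewrite enormN.
have step N : (0 < N)%N ->
    (2 * H * delta / V) * (2 * (phi z - phi y - G * delta)
       - G * ((2 * H * delta / V) / N%:R * enorm v))
    <= phi (z + delta *: u) - phi (z + delta *: u')
       + phi (z - delta *: u') - phi (z - delta *: u).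
  move=> N0; have Np : 0 < N%:R :> R by rewrite ltr0n.
  set c := (2 * H * delta / V) / N%:R.
  have c0 : 0 <= c.
    by rewrite /c; do 2![apply: divr_ge0; last exact: ltW]; rewrite !mulr_ge0.
  have NcE : N%:R * c = 2 * H * delta / V by rewrite /c mulrC divfK // gt_eqF.
  have jc j : (j <= N)%N -> exists s, 0 <= s <= 1 /\ j%:R * c = delta * (s * (2 * H / V)).
    move=> jN; exists (j%:R / N%:R); split.
      by rewrite divr_ge0 //= ler_pdivrMr // mul1r ler_nat.
    by rewrite /c; field; rewrite !gt_eqF.
  have inK x b j : (forall b, enorm b <= 1 -> K (x + delta *: b)) ->
      b = u' \/ b = - u -> (j <= N)%N -> K (x + delta *: b + (j%:R * c) *: v).
    move=> Kx bE /jc [s [s01 ->]]; rewrite -scalerA -addrA -scalerDr; apply: Kx.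
    by have [] := ball _ s01; case: bE => ->.
  have toy x j : z + delta *: x + (j%:R * c) *: v - v
               = y + delta *: x + (j%:R * c) *: v.
    by rewrite -Kzy -!addrA; congr (_ + _); rewrite addrA [RHS]addrC.
  have lo b : b = u' \/ b = - u ->
    c * \sum_(j < N) (phi (z + delta *: b + (j%:R * c) *: v) - phi y - G * delta)
    <= phi (z + delta *: b + (N%:R * c) *: v) - phi (z + delta *: b).
    move=> bE; apply: le_trans (convex_chord (N := N) vK cphi c0 _ _).
    - rewrite ler_wpM2l // ler_sum // => j _; rewrite toy.
      have Kj : K (y + delta *: b + (j%:R * c) *: v) by apply: inK => //; apply: ltnW.
      have Ky0 : K y by have := Ky 0; rewrite enorm0 scaler0 addr0; apply.
      have := lphi _ _ Kj Ky0.
      have [s [s01 jE]] := jc j (ltnW (ltn_ord j)).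
      rewrite jE -scalerA -addrA -scalerDr addrAC subrr add0r enormZ ger0_norm //.
      have : enorm (b + (s * (2 * H / V)) *: v) <= 1.
        by have [] := ball _ s01; case: bE => ->.
      move=> b1; have : delta * enorm (b + (s * (2 * H / V)) *: v) <= delta.
        by rewrite ler_piMr.
      move=> h1 h2; have := ler_wpM2l G0 h1; lra.
    - by move=> j jN; apply: inK.
    - by move=> j jN; rewrite toy; apply: inK => //; apply: ltnW.
  have lo1 := lo _ (or_introl erefl); have lo2 := lo _ (or_intror erefl).
  have E1 : z + delta *: u' + (N%:R * c) *: v = z + delta *: u.
    rewrite NcE uE; apply/matrixP => i j; rewrite !mxE; ring.
  have E2 : z + delta *: - u + (N%:R * c) *: v = z - delta *: u'.
    rewrite NcE uE; apply/matrixP => i j; rewrite !mxE; ring.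
  rewrite E1 in lo1; rewrite E2 scalerN in lo2.
  have {lo2}lo2 : c * \sum_(j < N)
      (phi (z - delta *: u + ((N.-1 - j)%:R * c) *: v) - phi y - G * delta)
      <= phi (z - delta *: u') - phi (z - delta *: u).
    move: lo2; rewrite (reindex_inj rev_ord_inj) /=.
    suff jE (j : 'I_N) : (N - j.+1 = N.-1 - j)%N by under eq_bigr do rewrite jE.
    by rewrite -{1}(prednK N0) subSS.
  apply: le_trans (_ : _ <= c * \sum_(j < N)
     (2 * (phi z - phi y - G * delta) - G * (c * enorm v))) _; last first.
    rewrite -[X in _ <= X]addrA; apply: le_trans (lerD lo1 lo2).
    rewrite -mulrDr ler_wpM2l // -big_split ler_sum //= => j _.
    have jN := ltn_ord j.
    have j'N : (N.-1 - j <= N)%N by rewrite (leq_trans (leq_subr _ _)) ?leq_pred.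
    have K1 := inK _ _ _ Kz (or_introl erefl) (ltnW jN).
    have K2 := inK _ _ _ Kz (or_intror erefl) j'N; rewrite scalerN in K2.
    have h01 : 0 <= (2^-1 : R) <= 1 by lra.
    have := convex_functionE cphi K1 K2 h01; have := convex_setE vK K1 K2 h01.
    have -> : 2^-1 *: (z + delta *: u' + (j%:R * c) *: v)
       + (1 - 2^-1) *: (z - delta *: u + ((N.-1 - j)%:R * c) *: v)
       = z - (c / 2) *: v.
      have -> : (N.-1 - j)%:R = N%:R - 1 - j%:R :> R.
        have jN' : (j <= N.-1)%N by rewrite -ltnS prednK.
        by rewrite natrB // -subn1 natrB.
      have -> : delta *: u = delta *: u' + (N%:R * c) *: v.
        by rewrite uE NcE; apply/matrixP => i l; rewrite !mxE; ring.
      by apply/matrixP => i l; rewrite !mxE; field.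
    move=> Km fm; have Kz0 : K z by have := Kz 0; rewrite enorm0 scaler0 addr0; apply.
    have := lphi _ _ Kz0 Km; rewrite opprB addrCA subrr addr0 enormZ ger0_norm.
      by move=> h; nra.
    by rewrite divr_ge0.
  by rewrite sumr_const card_ord -[_ *+ N]mulr_natl [leRHS]mulrA [c * N%:R]mulrC NcE.
rewrite -ler_pdivrMr //.
set S := phi (z + delta *: u) - _ + _ - _ in step *.
have {}step : (2 * H * delta / V) * (2 * (phi z - phi y - G * delta)) <= S.
  set Q := 2 * H * delta / V in step *.
  have Q0 : 0 <= Q by rewrite /Q divr_ge0 ?(ltW V0) // !mulr_ge0.
  have X0 : 0 <= Q * (G * (Q * enorm v)).
    by rewrite (mulr_ge0 Q0) // (mulr_ge0 G0) // (mulr_ge0 Q0) // enorm_ge0.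
  apply: (@le_of_eps _ _ (Q * (G * (Q * enorm v)))).
    exact: X0.
  move=> e e0; set N := Num.bound e^-1.
  have hN : e^-1 < N%:R by rewrite archi_boundP // invr_ge0 ltW.
  have Np : 0 < N%:R :> R by apply: lt_trans hN; rewrite invr_gt0.
  have := step N; rewrite -(ltr0n R) => /(_ Np).
  have : N%:R^-1 <= e by rewrite -[e]invrK lef_pV2 ?posrE ?invr_gt0 // ltW.
  move=> /(ler_wpM2r X0) h1 h2; move: h2.
  set A := 2 * _.
  have -> : Q * (A - G * (Q / N%:R * enorm v)) = Q * A - N%:R^-1 * (Q * (G * (Q * enorm v))) by ring.
  lra.
apply: le_trans (ler_wpM2r H0 step); rewrite le_eqVlt; apply/orP; left; apply/eqP.
by rewrite -/H; field; rewrite gt_eqF.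
Qed.

End ConvexAnalysis.

(** * Sums and differences of real powers *)

Section RealPowers.
Context {R : realType}.
Implicit Types (x y b c : R) (t T : nat).

(** Weighted arithmetic-geometric mean of [x] and [1], from the tangent
    inequality of the exponential at the logarithm of the right-hand side. *)
Lemma powR_bernoulli x b : 0 < x -> 0 <= b <= 1 -> x `^ b <= 1 + b * (x - 1).
Proof.
move=> x0 /andP[b0 b1]; set L := ln x.
have xE : x = expR L by rewrite lnK // posrE.
have pE : x `^ b = expR (b * L) by rewrite /powR gt_eqF.
have p0 : 0 < x `^ b by rewrite powR_gt0.
have h1 : x `^ b * (1 + (1 - b) * L) <= x.
  have E : x = x `^ b * expR ((1 - b) * L).
    by rewrite pE -expRD -mulrDl addrC subrK mul1r.
  by rewrite [leRHS]E ler_pM2l // expR_ge1Dx.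
have h2 : x `^ b * (1 - b * L) <= 1.
  have E : 1 = x `^ b * expR (- (b * L)) by rewrite pE -expRD subrr expR0.
  by rewrite [leRHS]E ler_pM2l // expR_ge1Dx.
nra.
Qed.

Lemma powR_tangent x y b : 0 < x -> 0 < y -> 0 <= b <= 1 ->
  y `^ b <= x `^ b + b * x `^ (b - 1) * (y - x).
Proof.
move=> x0 y0 b01; have x1 : x != 0 by rewrite gt_eqF.
have := powR_bernoulli (divr_gt0 y0 x0) b01.
have p0 : 0 < x `^ b by rewrite powR_gt0.
rewrite -(ler_pM2l p0) -(powRM _ (ltW x0) (ltW (divr_gt0 y0 x0))).
have -> : x * (y / x) = y by rewrite mulrC divfK.
move=> /le_trans; apply; rewrite powRB ?x1 ?implybT // powRr1 ?(ltW x0) //.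
by rewrite le_eqVlt; apply/orP; left; apply/eqP; field.
Qed.

Lemma powR_succ_le x b : 0 < x -> 0 <= b <= 1 ->
  (x + 1) `^ b <= x `^ b + b * x `^ (b - 1).
Proof.
move=> x0 b01; have := @powR_tangent x (x + 1) b x0.
by rewrite addr_gt0 // addrAC subrr add0r mulr1; apply.
Qed.

Lemma powR_succ_ge x b : 0 < x -> 0 <= b <= 1 ->
  x `^ b + b * (x + 1) `^ (b - 1) <= (x + 1) `^ b.
Proof.
move=> x0 b01; have := @powR_tangent (x + 1) x b.
by rewrite addr_gt0 // => /(_ isT x0 b01); rewrite opprD addrA subrr; lra.
Qed.

Lemma powR_decr_le x c : 0 < x -> 0 <= c <= 1 ->
  x `^ (- c) - (x + 1) `^ (- c) <= c * x `^ (- c - 1).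
Proof.
move=> x0 c01; have x1 : 0 < x + 1 by lra.
have := powR_succ_le x0 c01.
have xc : 0 < x `^ c by rewrite powR_gt0.
have x1c : 0 < (x + 1) `^ c by rewrite powR_gt0.
rewrite !powRB ?(gt_eqF x0) ?implybT // !powRN !powRr1 ?(ltW x0) //.
set a := x `^ c in xc *; set d := (x + 1) `^ c in x1c * => h.
have c0 : 0 <= c by case/andP: c01.
have ad : a <= d by rewrite /a /d ge0_ler_powR // ?nnegrE; lra.
have -> : a^-1 - d^-1 = (d - a) / (a * d) by field; rewrite !gt_eqF.
rewrite ler_pdivrMr ?mulr_gt0 //.
apply: (@le_trans _ _ (c * (a / x))); first by lra.
have -> : c * (a^-1 / x) * (a * d) = c * (d / x) by field; rewrite !gt_eqF.
by rewrite ler_wpM2l // ler_pM2r // invr_gt0.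
Qed.

(** Each term is at most an increment of [t `^ b / b], which telescopes. *)
Lemma sum_powR_lt T b : (1 <= T)%N -> 0 < b <= 1 ->
  \sum_(1 <= t < T) t.+1%:R `^ (b - 1) <= (T%:R `^ b - 1) / b.
Proof.
move=> T1 /andP[b0 b1]; elim: T T1 => // T IH _.
have [->|T0] := eqVneq T 0%N; first by rewrite big_nil powR1 subrr mul0r.
have T1 : (0 < T)%N by rewrite lt0n.
rewrite big_nat_recr //=; apply: le_trans (lerD (IH T1) (lexx _)) _.
have := @powR_succ_ge T%:R b; rewrite ltr0n T1 (ltW b0) b1 => /(_ isT isT).
rewrite natr1 => h.
rewrite -(ler_pM2r b0) mulrDl !divfK ?gt_eqF //; lra.
Qed.

Lemma powR_natS_le T b : (1 <= T)%N -> 0 <= b <= 1 ->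
  T.+1%:R `^ b <= T%:R `^ b + 1 :> R.
Proof.
move=> T1 b01; have T0 : 0 < T%:R :> R by rewrite ltr0n.
have := powR_succ_le T0 b01; rewrite natr1 => /le_trans; apply.
rewrite lerD2l; case/andP: (b01) => b0 b1.
apply: (@le_trans _ _ (1 * 1)); last by rewrite mulr1.
apply: ler_pM; rewrite ?powR_ge0 //.
rewrite -[leRHS](powRr0 T%:R) ler_powR ?ler1n //; lra.
Qed.

Lemma sum_powR T b : (1 <= T)%N -> 0 < b <= 1 ->
  \sum_(1 <= t < T.+1) t.+1%:R `^ (b - 1) <= T%:R `^ b / b.
Proof.
move=> T1 /andP[b0 b1]; apply: le_trans (sum_powR_lt _ _) _ => //; first by rewrite b0.
rewrite ler_pM2r ?invr_gt0 //.
by have := @powR_natS_le T b T1; rewrite (ltW b0) b1 => /(_ isT); lra.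
Qed.

(** The tangents at the two ends bound the increment; the lower end may be traded
    for the upper one at the price of a factor 2. *)
Lemma powR_natS_increment T b : (1 <= T)%N -> 1 / 2 <= b <= 1 ->
  1 / 2 * (T.+1%:R : R) `^ (b - 1) <= T.+1%:R `^ b - T%:R `^ b
     <= 2 * T.+1%:R `^ (b - 1).
Proof.
move=> T1 /andP[b0 b1]; have T0 : 0 < T%:R :> R by rewrite ltr0n.
have b01 : 0 <= b <= 1 by apply/andP; split; lra.
have := powR_succ_le T0 b01; have := powR_succ_ge T0 b01; rewrite natr1.
set p := T.+1%:R `^ (b - 1); have p0 : 0 <= p by exact: powR_ge0.
have : T%:R `^ (b - 1) <= 2 * p.
  have -> : b - 1 = - (1 - b) by ring.
  have pE : p = (T.+1%:R `^ (1 - b))^-1 by rewrite /p -powRN opprB.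
  rewrite pE powRN.
  have T'0 : 0 < T%:R `^ (1 - b) by rewrite powR_gt0.
  have T''0 : 0 < T.+1%:R `^ (1 - b) by rewrite powR_gt0.
  rewrite ler_pdivlMr // mulrC ler_pdivrMr //.
  have := @powR_natS_le T (1 - b) T1; have c01 : 0 <= 1 - b <= 1 by apply/andP; split; lra.
  move=> /(_ c01) /le_trans; apply.
  suff : 1 <= T%:R `^ (1 - b) by lra.
  by rewrite -[leLHS](powRr0 T%:R) ler_powR ?ler1n //; lra.
by move=> h1 h2 h3; apply/andP; split; nra.
Qed.

Lemma powR_natS_double t T b : (1 <= T)%N -> (t <= T)%N -> 0 <= b <= 1 ->
  t.+1%:R `^ b <= 2 * T%:R `^ b :> R.
Proof.
move=> T1 tT b01; have /andP[b0 b1] := b01.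
apply: (@le_trans _ _ (T.+1%:R `^ b)).
  by rewrite ge0_ler_powR ?nnegrE ?ler0n // ler_nat.
apply: le_trans (powR_natS_le T1 b01) _.
suff : 1 <= T%:R `^ b by lra.
by rewrite -[leLHS](powRr0 T%:R) ler_powR ?ler1n.
Qed.

Lemma powR_nat_ge1 T b : (1 <= T)%N -> 0 <= b -> 1 <= T%:R `^ b :> R.
Proof. by move=> T1 b0; rewrite -[leLHS](powRr0 T%:R) ler_powR ?ler1n. Qed.

(** The left-hand side is what Abel summation leaves of a squared distance
    weighted by [t `^ b] when the comparator moves by the decrements of
    [t.+1 `^ (- (b - 1 / 2))]. At [T = 1] the tangent bound gives [1 + b], which
    is 11/6 for the largest exponent. *)
Lemma weighted_drift T b : (1 <= T)%N -> 3 / 4 <= b <= 5 / 6 ->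
  T.+1%:R `^ b + \sum_(1 <= t < T) t.+1%:R `^ b
      * (t.+1%:R `^ (- (b - 1 / 2)) - t.+2%:R `^ (- (b - 1 / 2)))
  <= 11 / 6 * T%:R `^ b :> R.
Proof.
move=> T1 /andP[b0 b1]; set c := b - 1 / 2.
have T0 : 0 < T%:R :> R by rewrite ltr0n.
have c01 : 0 <= c <= 1 by rewrite /c; apply/andP; split; lra.
have drift : \sum_(1 <= t < T) t.+1%:R `^ b
      * (t.+1%:R `^ (- c) - t.+2%:R `^ (- c)) <= 2 / 3 * (T%:R `^ (1 / 2) - 1) :> R.
  have half : 0 < (1 / 2 : R) <= 1 by lra.
  have := sum_powR_lt T1 half.
  have -> : (T%:R `^ (1 / 2) - 1) / (1 / 2) = 2 * (T%:R `^ (1 / 2) - 1) :> R by field.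
  move=> h; apply: (@le_trans _ _
    (c * \sum_(1 <= t < T) t.+1%:R `^ (1 / 2 - 1))); last first.
    have : 1 <= T%:R `^ (1 / 2) :> R by apply: powR_nat_ge1 => //; lra.
    have : 0 <= \sum_(1 <= t < T) t.+1%:R `^ (1 / 2 - 1) :> R.
      by apply: sumr_ge0 => t _; exact: powR_ge0.
    have : c <= 1 / 3 by rewrite /c; lra.
    case/andP: c01 => c0 _; nra.
  rewrite mulr_sumr ler_sum // => t _.
  have := @powR_decr_le t.+1%:R c; rewrite ltr0n natr1 => /(_ isT c01).
  move=> /(ler_wpM2l (powR_ge0 t.+1%:R b)) /le_trans; apply.
  rewrite mulrCA -powRD ?pnatr_eq0 ?implybT //.
  by have -> : b + (- c - 1) = 1 / 2 - 1 by rewrite /c; field.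
have b01 : 0 <= b <= 1 by apply/andP; split; lra.
have := powR_succ_le T0 b01; rewrite natr1.
set X := T%:R `^ (1 / 2) in drift *.
have X1 : 1 <= X by apply: powR_nat_ge1 => //; lra.
have XX : X * X = T%:R.
  by rewrite /X -powRD ?gt_eqF ?implybT // (_ : 1/2+1/2 = 1) ?powRr1 ?(ltW T0) //; field.
have Y0 : X <= T%:R `^ b by rewrite /X ler_powR ?ler1n //; lra.
have -> : T%:R `^ (b - 1) = T%:R `^ b / (X * X).
  by rewrite powRB ?(gt_eqF T0) ?implybT // powRr1 ?(ltW T0) // XX.
set Y := T%:R `^ b in Y0 *; move=> h.
have X0 : 0 < X by lra.
have : b * (Y / (X * X)) + 2 / 3 * (X - 1) <= 5 / 6 * Y.
  have E : Y / (X * X) * (X * X) = Y by rewrite divfK // gt_eqF // mulr_gt0.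
  set Q := Y / (X * X) in E *.
  have Q0 : 0 <= Q by rewrite /Q divr_ge0 // ?mulr_ge0 //; lra.
  have : 2 / 3 * (X - 1) <= 5 / 6 * Q * (X * X - 1).
    have QX : 1 <= Q * X by rewrite -(ler_pM2r X0) mul1r -mulrA E.
    have -> : 5 / 6 * Q * (X * X - 1) = 5 / 6 * (X - 1) * (Q * X + Q) by ring.
    nra.
  nra.
lra.
Qed.

End RealPowers.

(** * Contraction of the dispersion over a connected window *)

Section SumFacts.
Context {R : realType}.

Lemma sum_sqr_le_sqr_sum (I : finType) (P : pred I) (F : I -> R) :
  (forall i, P i -> 0 <= F i) ->
  \sum_(i | P i) F i ^+ 2 <= (\sum_(i | P i) F i) ^+ 2.
Proof.
move=> F0; have [] : \sum_(i | P i) F i ^+ 2 <= (\sum_(i | P i) F i) ^+ 2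
    /\ 0 <= \sum_(i | P i) F i; last by [].
elim/big_ind2 : _ => [|a b c d [h1 h2] [h3 h4]|i Pi].
- by rewrite expr0n lexx.
- by split; [nra | rewrite addr_ge0].
- by split; [exact: lexx | exact: F0].
Qed.

Lemma sqr_sum_le (I : finType) (F : I -> R) :
  (\sum_i F i) ^+ 2 <= #|I|%:R * \sum_i F i ^+ 2.
Proof.
have : 0 <= \sum_i \sum_j (F i - F j) ^+ 2.
  by apply: sumr_ge0 => i _; apply: sumr_ge0 => j _; exact: sqr_ge0.
have -> : \sum_i \sum_j (F i - F j) ^+ 2
    = 2 * (#|I|%:R * \sum_i F i ^+ 2) - 2 * (\sum_i F i) ^+ 2.
  transitivity (\sum_i (#|I|%:R * F i ^+ 2 + \sum_j F j ^+ 2 - 2 * F i * \sum_j F j)).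
    apply: eq_bigr => i _; rewrite mulr_sumr -sumrN.
    rewrite mulr_natl -sumr_const -!big_split /=.
    by apply: eq_bigr => j _; ring.
  rewrite big_split big_split /= -mulr_sumr sumr_const sumrN -mulr_suml -mulr_sumr.
  by rewrite -[(\sum_j F j ^+ 2) *+ _]mulr_natl; ring.
lra.
Qed.

End SumFacts.

Section Dispersion.
Context {R : realType} {n : nat}.
Implicit Types (a b : 'cV[R]_n) (A : 'M[R]_n).

Definition mean a : R := (\sum_i a i 0) / n%:R.

Definition deviation a : 'cV[R]_n := a - const_mx (mean a).

Definition dispersion a : R := dot (deviation a) (deviation a).

Lemma meanD a b : mean (a + b) = mean a + mean b.
Proof.
rewrite /mean -mulrDl -big_split; congr (_ / _); apply: eq_bigr => i _.
by rewrite mxE.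
Qed.

Lemma deviationD a b : deviation (a + b) = deviation a + deviation b.
Proof.
by apply/matrixP => i j; rewrite !mxE meanD; ring.
Qed.

Lemma deviation0 : deviation 0 = 0.
Proof.
apply/matrixP => i j; rewrite !mxE /mean big1 ?mul0r ?subr0 // => l _.
by rewrite mxE.
Qed.

Lemma dispersionE a : (0 < n)%N ->
  dispersion a = dot a a - n%:R * mean a ^+ 2.
Proof.
move=> n0; have n1 : n%:R != 0 :> R by rewrite pnatr_eq0 -lt0n.
have cE x : dot (const_mx x) a = x * n%:R * mean a.
  rewrite /dot /mean; transitivity (\sum_i x * a i 0).
    by apply: eq_bigr => i _; rewrite mxE.
  by rewrite -mulr_sumr -mulrA [n%:R * _]mulrC divfK.
have cc x : dot (const_mx x : 'cV[R]_n) (const_mx x) = n%:R * x ^+ 2.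
  rewrite /dot; transitivity (\sum_(i < n) x ^+ 2).
    by apply: eq_bigr => i _; rewrite mxE expr2.
  by rewrite sumr_const card_ord mulr_natl.
rewrite /dispersion /deviation dotBl !dotBr (dotC a) !cE cc; ring.
Qed.

Lemma dispersion_le_dot a : (0 < n)%N -> dispersion a <= dot a a.
Proof. by move=> n0; rewrite dispersionE // gerBl mulr_ge0 ?sqr_ge0. Qed.

Lemma mean_stochastic A a : doubly_stochastic A -> mean (A *m a) = mean a.
Proof.
case=> _ _ colA; congr (_ / _).
under eq_bigr do rewrite mxE.
rewrite exchange_big; apply: eq_bigr => i _.
by rewrite -mulr_suml colA mul1r.
Qed.

(** The mean is preserved, so what the dispersion loses is the sum, over the rows,
    of the variances of the averaged values. *)
Lemma dispersion_mix A a : (0 < n)%N -> doubly_stochastic A ->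
  2 * (dispersion a - dispersion (A *m a))
  = \sum_k \sum_i \sum_j A k i * A k j * (a i 0 - a j 0) ^+ 2.
Proof.
move=> n0 dA; have [_ rowA colA] := dA.
rewrite !dispersionE // mean_stochastic //.
have -> : dot a a = \sum_k \sum_i A k i * a i 0 ^+ 2.
  by rewrite exchange_big; apply: eq_bigr => i _; rewrite -mulr_suml colA mul1r expr2.
rewrite opprB addrA subrK {1}/dot -sumrB mulr_sumr.
apply: eq_bigr => k _; rewrite !mxE.
set S := \sum_i A k i * _; set M := \sum_j A k j * a j 0.
transitivity (\sum_i (A k i * a i 0 ^+ 2 + A k i * S - 2 * (A k i * a i 0) * M)).
  rewrite !big_split /= sumrN -!mulr_suml rowA -mulr_sumr -/M -/S mul1r; ring.
apply: eq_bigr => i _.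
have E : A k i * a i 0 ^+ 2 = \sum_j A k i * a i 0 ^+ 2 * A k j.
  by rewrite -mulr_sumr rowA mulr1.
rewrite [X in X + _ - _]E /S /M !mulr_sumr -sumrN -!big_split /=.
by apply: eq_bigr => j _; ring.
Qed.

Lemma dispersion_mix_le A a : (0 < n)%N -> doubly_stochastic A ->
  dispersion (A *m a) <= dispersion a.
Proof.
move=> n0 dA; rewrite -subr_ge0 -(@pmulr_rge0 _ 2) // dispersion_mix //.
have [A0 _ _] := dA.
by apply: sumr_ge0 => k _; apply: sumr_ge0 => i _; apply: sumr_ge0 => j _;
  apply: mulr_ge0; [exact: mulr_ge0 | exact: sqr_ge0].
Qed.

End Dispersion.

Section WindowContraction.
Context {R : realType} {n : nat} (E : nat -> rel 'I_n) (W : nat -> 'M[R]_n).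
Context (w : R) (iota : nat).
Hypotheses (n_gt0 : (0 < n)%N) (mixW : mixing E W) (hA : assumption_network E W w iota).

Let dW t : (1 <= t)%N -> doubly_stochastic (W t).
Proof. exact: weight_stochastic hA t. Qed.

Let diagW t i : (1 <= t)%N -> w <= W t i i.
Proof.
move=> t1; apply: (weight_bound hA) => //.
by have [h _] := mixW i i t1; apply: h; rewrite eqxx orbT.
Qed.

(** A row that spreads its unit mass over both sides of a cut contributes
    [c * (1 - c)], where both parts are at least [w] and one is at least [1 / 2]. *)
Lemma cut_weight t (S : pred 'I_n) k i : (1 <= t)%N -> S k != S i ->
  0 < W t k i ->
  w / 2 <= \sum_k (\sum_(i | S i) W t k i) * (\sum_(j | ~~ S j) W t k j).
Proof.
move=> t1 Ski Wki; have [W0 row1 _] := dW t1.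
have rowE l : \sum_(i | S i) W t l i + \sum_(j | ~~ S j) W t l j = 1.
  by rewrite -(row1 l) [RHS](bigID S).
have P0 (P : pred 'I_n) l : 0 <= \sum_(i | P i) W t l i by apply: sumr_ge0.
rewrite (bigD1 k) //=; apply: (@le_trans _ _
  ((\sum_(i | S i) W t k i) * (\sum_(j | ~~ S j) W t k j))); last first.
  by rewrite lerDl; apply: sumr_ge0 => l _; rewrite mulr_ge0.
have big (P : pred 'I_n) l : P l -> w <= W t k l -> w <= \sum_(i | P i) W t k i.
  by move=> Pl wl; rewrite (bigD1 l) //= (le_trans wl) // lerDl sumr_ge0.
have wki : w <= W t k i by apply: (weight_bound hA).
have wkk : w <= W t k k by apply: diagW.
have [wS wC] : w <= \sum_(i | S i) W t k i /\ w <= \sum_(j | ~~ S j) W t k j.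
  case Sk: (S k) Ski; case Si: (S i) => // _; split.
  - exact: big Sk wkk.
  - by apply: big wki; rewrite Si.
  - exact: big Si wki.
  - by apply: big wkk; rewrite Sk.
move: wS wC (rowE k) (P0 S k) (P0 (fun j => ~~ S j) k).
have /andP[w0 _] := weight_range hA.
set a := \sum_(i | S i) _; set b := \sum_(j | ~~ S j) _ => wa wb ab a0 b0.
have [h|h] := leP (1/2) a; nra.
Qed.

Variables (t0 : nat) (b : nat -> 'cV[R]_n).
Hypotheses (t0_gt0 : (1 <= t0)%N) (bS : forall l, b l.+1 = W (t0 + l)%N *m b l).

Let t0l l : (1 <= t0 + l)%N. Proof. by rewrite (leq_trans t0_gt0) ?leq_addr. Qed.

(* the initial values in increasing order; cut [k] separates the [k.+1] smallest
   ones from the others *)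
Let s := sort <=%R [seq b 0%N i 0 | i <- enum 'I_n].

Let size_s : size s = n. Proof. by rewrite size_sort size_map size_enum_ord. Qed.

Let s_mono j k : (j <= k)%N -> (k < n)%N -> s`_j <= s`_k.
Proof.
move=> jk kn; apply: (sorted_leq_nth le_trans le_refl) => //.
- exact: sort_le_sorted.
- by rewrite inE size_s (leq_ltn_trans jk).
- by rewrite inE size_s.
Qed.

Let s_val i : exists2 j, (j < n)%N & b 0%N i 0 = s`_j.
Proof.
have : b 0%N i 0 \in s by rewrite mem_sort; apply/mapP; exists i; rewrite ?mem_enum.
move=> h; exists (index (b 0%N i 0) s); rewrite ?nth_index //.
by apply: leq_trans (leqnn _); rewrite -{2}size_s index_mem.
Qed.

Let val_s j : (j < n)%N -> exists i, s`_j = b 0%N i 0.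
Proof.
move=> jn; have : s`_j \in s by rewrite mem_nth ?size_s.
by rewrite mem_sort => /mapP[i _ ->]; exists i.
Qed.

Let below k : pred 'I_n := fun i => b 0%N i 0 <= s`_k.
Let gap k := s`_k.+1 - s`_k.

Let gap_ge0 k : (k < n.-1)%N -> 0 <= gap k.
Proof. by move=> kn; rewrite subr_ge0 s_mono // -[n]prednK. Qed.

Let above k i : ~~ below k i -> (k.+1 < n)%N -> s`_k.+1 <= b 0%N i 0.
Proof.
rewrite /below -ltNge; have [j jn ->] := s_val i => skj kn.
apply: s_mono => //; rewrite ltnNge; apply: contraL skj => jk.
by rewrite -leNgt s_mono // ltnW.
Qed.

Let crossed k l := [exists x, exists i,
  (below k x != below k i) && (0 < W (t0 + l) x i)].

Let first k l := crossed k l && [forall l' : 'I_l, ~~ crossed k l'].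

(** Until the first crossing, the two sides of a cut evolve separately, so the
    gap between them does not shrink. *)
Lemma sides_separate k l : (k.+1 < n)%N -> (forall l', (l' < l)%N -> ~~ crossed k l') ->
  forall i, (below k i -> b l i 0 <= s`_k) /\ (~~ below k i -> s`_k.+1 <= b l i 0).
Proof.
move=> kn; elim: l => [|l IH] nc i; first by split=> // /above; apply.
have {}IH := IH (fun l' l'l => nc l' (ltnW l'l)).
have [W0 row1 _] := dW (t0l l).
have nol j : below k i != below k j -> W (t0 + l) i j = 0.
  move=> ij; apply/eqP; rewrite eq_le W0 andbT leNgt; apply/negP => h.
  by move: (nc l (ltnSn l)) => /negP; apply; apply/existsP; exists i; apply/existsP; exists j; rewrite ij.
rewrite bS mxE; split=> bi.
  rewrite -[leRHS]mul1r -(row1 i) mulr_suml ler_sum // => j _.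
  have [ij|/nol ->] := eqVneq (below k i) (below k j); last by rewrite !mul0r.
  by rewrite ler_wpM2l //; apply: (proj1 (IH j)); rewrite -ij.
rewrite -[leLHS]mul1r -(row1 i) mulr_suml ler_sum // => j _.
have [ij|/nol ->] := eqVneq (below k i) (below k j); last by rewrite !mul0r.
by rewrite ler_wpM2l //; apply: (proj2 (IH j)); rewrite -ij.
Qed.

Let separated k (i j : 'I_n) := below k i && ~~ below k j.

(** The cuts first crossed at step [l] that separate two given nodes have
    disjoint gaps lying between the values of these nodes. *)
Lemma gaps_between l i j N : (N <= n.-1)%N ->
  \sum_(k < N | first k l && separated k i j) gap k
  <= Num.max 0 (Num.min s`_N (b l j 0) - b l i 0).
Proof.
elim: N => [|N IH] Nn; first by rewrite big_ord0 le_max lexx.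
have N1 : (N.+1 < n)%N by rewrite -[n]prednK.
have sN : s`_N <= s`_N.+1 by apply: s_mono.
rewrite big_mkcond big_ord_recr -big_mkcond /=.
have {}IH := IH (ltnW Nn); case: ifP => [|_].
  move=> /andP[/andP[_ /forallP nc] /andP[bi bj]].
  have sep := @sides_separate N l N1 (fun l' h => nc (Ordinal h)).
  have hi := (proj1 (sep i)) bi; have hj := (proj2 (sep j)) bj.
  apply: le_trans (lerD IH (lexx _)) _.
  rewrite (min_idPl (le_trans sN hj)) (min_idPl hj) (max_idPr _) ?subr_ge0 //.
  by rewrite le_max /gap; apply/orP; right; lra.
rewrite addr0 (le_trans IH) // ge_max !le_max lexx /=; apply/orP; right.
by rewrite lerD2r le_min !ge_min sN lexx orbT.
Qed.

Lemma gaps_between_sqr l i j :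
  \sum_(k < n.-1 | first k l && separated k i j) gap k ^+ 2
  <= (b l i 0 - b l j 0) ^+ 2.
Proof.
apply: le_trans (sum_sqr_le_sqr_sum _) _; first by move=> k _; apply: gap_ge0.
rewrite -(real_normK (num_real (b l i 0 - _))).
rewrite ler_pXn2r ?nnegrE //; last first.
  by apply: sumr_ge0 => k _; apply: gap_ge0.
apply: le_trans (gaps_between l i j (leqnn _)) _.
rewrite ge_max normr_ge0 /= distrC (le_trans _ (ler_norm _)) //.
by rewrite lerD2r ge_min lexx orbT.
Qed.

(** The pairs on both sides of a cut that is first crossed at step [l] have weight
    at least [w / 2] by [cut_weight], and differ by at least the gap. *)
Lemma dispersion_step l :
  w * \sum_(k < n.-1 | first k l) gap k ^+ 2
  <= 2 * (dispersion (b l) - dispersion (b l.+1)).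
Proof.
have [W0 _ _] := dW (t0l l).
rewrite bS dispersion_mix //; last exact/dW/t0l.
apply: (@le_trans _ _ (\sum_x \sum_i \sum_j W (t0 + l) x i * W (t0 + l) x j *
   \sum_(k < n.-1 | first k l && (separated k i j || separated k j i)) gap k ^+ 2)).
  have sumE : \sum_x \sum_i \sum_j W (t0 + l) x i * W (t0 + l) x j *
     \sum_(k < n.-1 | first k l && (separated k i j || separated k j i)) gap k ^+ 2
   = \sum_(k < n.-1 | first k l) gap k ^+ 2 * (2 * \sum_x
       (\sum_(i | below k i) W (t0 + l) x i) * (\sum_(j | ~~ below k j) W (t0 + l) x j)).
    transitivity (\sum_x \sum_i \sum_j \sum_(k < n.-1 | first k l)
       (if separated k i j || separated k j i then
          gap k ^+ 2 * (W (t0 + l) x i * W (t0 + l) x j) else 0)).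
      apply: eq_bigr => x _; apply: eq_bigr => i _; apply: eq_bigr => j _.
      rewrite mulr_sumr -big_mkcondr /=; apply: eq_bigr => k _; exact: mulrC.
    under eq_bigr do under eq_bigr do rewrite exchange_big /=.
    under eq_bigr do rewrite exchange_big /=.
    rewrite exchange_big /=; apply: eq_bigr => k _.
    rewrite mulrCA mulr_sumr mulr_sumr; apply: eq_bigr => x _.
    rewrite mulrA [2 * _]mulrC -mulrA.
    transitivity (gap k ^+ 2 * \sum_i \sum_j
      (if separated k i j || separated k j i then W (t0 + l) x i * W (t0 + l) x j else 0)).
      rewrite mulr_sumr; apply: eq_bigr => i _; rewrite mulr_sumr; apply: eq_bigr => j _.
      by case: ifP; rewrite ?mulr0.
    congr (_ * _).
    rewrite (bigID (below k)) /= [2]mulr2n mulrDl mul1r; congr (_ + _).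
      rewrite big_distrlr /=; apply: eq_bigr => i bi; rewrite [RHS]big_mkcond.
      by apply: eq_bigr => j _; rewrite /separated bi /= andbF orbF.
    rewrite mulrC big_distrlr /=; apply: eq_bigr => i /negbTE bi; rewrite [RHS]big_mkcond.
    by apply: eq_bigr => j _; rewrite /separated bi /= andbT.
  rewrite sumE mulr_sumr ler_sum // => k /andP[/existsP[x /existsP[i /andP[xi Wxi]]] _].
  rewrite mulrC ler_wpM2l ?sqr_ge0 //.
  by have := cut_weight (t0l l) xi Wxi; lra.
apply: ler_sum => x _; apply: ler_sum => i _; apply: ler_sum => j _.
rewrite ler_wpM2l ?mulr_ge0 //.
case: (boolP (b 0%N i 0 <= b 0%N j 0)) => ij.
  apply: le_trans (gaps_between_sqr l i j).
  rewrite le_eqVlt; apply/orP; left; apply/eqP; apply: eq_bigl => k.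
  rewrite /separated; congr (_ && _).
  case bi: (below k i) => //=; rewrite ?andbF ?orbF ?andbT //.
  by apply: contraFF bi => h; rewrite /below (le_trans ij).
rewrite -sqrrN opprB; apply: le_trans (gaps_between_sqr l j i).
rewrite le_eqVlt; apply/orP; left; apply/eqP; apply: eq_bigl => k.
rewrite /separated; congr (_ && _).
case bi: (below k j) => //=; rewrite ?andbF ?orbF ?andbT //.
move: ij; rewrite -ltNge => /ltW ij.
by apply: contraFF bi => h; rewrite /below (le_trans ij).
Qed.

(** If no step of the window crossed the cut, the lower side would be closed in
    the union graph, which is connected. *)
Lemma first_crossing k : (k < n.-1)%N -> gap k != 0 ->
  exists2 l, (l < iota)%N & first k l.
Proof.
move=> kn gk; have kn' : (k.+1 < n)%N by rewrite -[n]prednK.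
suff [l0 l0i cl0] : exists2 l, (l < iota)%N & crossed k l.
  have ex : exists l, crossed k l by exists l0.
  have := ex_minnP ex; case: ex_minnP => l cl lmin _.
  exists l; first by rewrite (leq_ltn_trans (lmin _ cl0)).
  rewrite /first cl; apply/forallP => l'; apply/negP => /lmin.
  by rewrite leqNgt ltn_ord.
have [i0 i0E] := val_s (ltnW kn'); have [j0 j0E] := val_s kn'.
have bi0 : below k i0 by rewrite /below i0E.
have bj0 : ~~ below k j0.
  by rewrite /below -j0E -ltNge -subr_gt0 lt0r gk gap_ge0.
have conn := window_connected hA t0_gt0 i0 j0.
case: (boolP [exists l : 'I_iota, crossed k l]) => [/existsP[l cl]|nc].
  by exists l.
exfalso; move: bj0; apply/negP; rewrite negbK.
have cl : fingraph.closed [rel i j | [exists l : 'I_iota, E (t0 + l)%N i j]] (below k).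
  move=> i j /= /existsP[l Eij]; apply/eqP; apply: contraNT nc => nb.
  apply/existsP; exists l; apply/existsP; exists j; apply/existsP; exists i.
  rewrite eq_sym nb /=; have [h _] := mixW j i (t0l l); apply: h.
  by rewrite Eij.
by have := closed_connect cl conn; rewrite /in_mem /= bi0 => <-.
Qed.

(** Every deviation is at most the range, which is the sum of the gaps. *)
Lemma dispersion_le_gaps :
  dispersion (b 0%N) <= n%:R ^+ 2 * \sum_(k < n.-1) gap k ^+ 2.
Proof.
have n1 : n%:R != 0 :> R by rewrite pnatr_eq0 -lt0n.
have n0 : 0 < n%:R :> R by rewrite ltr0n.
have nn : n.-1.+1 = n by rewrite prednK.
have rangeE : \sum_(k < n.-1) gap k = s`_(n.-1) - s`_0.
  by rewrite -(big_mkord xpredT (fun k => s`_k.+1 - s`_k)) telescope_sumr.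
have inr i : s`_0 <= b 0%N i 0 <= s`_(n.-1).
  have [j jn ->] := s_val i; apply/andP; split; apply: s_mono => //.
  - by rewrite -ltnS nn.
  - by rewrite ltn_predL.
set D := \sum_(k < n.-1) gap k in rangeE.
have mr : s`_0 <= mean (b 0%N) <= s`_(n.-1).
  rewrite /mean ler_pdivlMr // ler_pdivrMr // !mulr_natr.
  have cst (c : R) : c *+ n = \sum_(i < n) c by rewrite sumr_const card_ord.
  rewrite !cst.
  by apply/andP; split; apply: ler_sum => i _; have /andP[] := inr i.
have D2 : dispersion (b 0%N) <= n%:R * D ^+ 2.
  have -> : n%:R * D ^+ 2 = \sum_(i < n) D ^+ 2.
    by rewrite sumr_const card_ord mulr_natl.
  apply: ler_sum => i _.
  rewrite !mxE -expr2; move: mr (inr i) => /andP[m1 m2] /andP[h1 h2].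
  rewrite -(real_normK (num_real (_ - _))) ler_pXn2r ?nnegrE //.
    by rewrite ler_norml rangeE; apply/andP; split; lra.
  by rewrite rangeE; lra.
apply: le_trans D2 _; rewrite expr2 -mulrA ler_wpM2l ?ler0n //.
apply: le_trans (sqr_sum_le _) _; rewrite card_ord ler_wpM2r //.
  by apply: sumr_ge0 => k _; exact: sqr_ge0.
by rewrite ler_nat leq_pred.
Qed.

(** Over a window the graph is connected, so every cut of the sorted values is
    crossed at least once; its first crossing dissipates the squared gap. *)
Lemma window_contraction :
  dispersion (b iota) <= (1 - w / (2 * n%:R ^+ 2)) * dispersion (b 0%N).
Proof.
have /andP[w0 _] := weight_range hA.
have np : 0 < n%:R :> R by rewrite ltr0n.
have n0 : 0 < n%:R ^+ 2 :> R by rewrite exprn_gt0.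
have tele L : w * \sum_(l < L) \sum_(k < n.-1 | first k l) gap k ^+ 2
    <= 2 * (dispersion (b 0%N) - dispersion (b L)).
  elim: L => [|L IH]; first by rewrite big_ord0 subrr !mulr0.
  rewrite big_ord_recr /= mulrDr; have := dispersion_step L; lra.
have all : \sum_(k < n.-1) gap k ^+ 2
    <= \sum_(l < iota) \sum_(k < n.-1 | first k l) gap k ^+ 2.
  rewrite (exchange_big_dep xpredT) //=; apply: ler_sum => k _.
  have [->|gk] := eqVneq (gap k) 0.
    by rewrite expr0n /= sumr_ge0.
  have [l li fl] := first_crossing (ltn_ord k) gk.
  rewrite (bigD1 (Ordinal li)) //= lerDl; apply: sumr_ge0 => *; exact: sqr_ge0.
have := tele iota; have := dispersion_le_gaps.
set S := \sum_(k < n.-1) _ in all *; set S' := \sum_(l < iota) _ in all *.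
move=> h1 h2; rewrite mulrBl mul1r.
suff : w / (2 * n%:R ^+ 2) * dispersion (b 0%N) <= dispersion (b 0%N) - dispersion (b iota) by lra.
rewrite mulrAC ler_pdivrMr ?mulr_gt0 //.
have h3 : w * dispersion (b 0%N) <= w * (n%:R ^+ 2 * S) by rewrite ler_pM2l.
have h4 : n%:R ^+ 2 * (w * S) <= n%:R ^+ 2 * (2 * (dispersion (b 0%N) - dispersion (b iota))).
  by rewrite ler_pM2l // (le_trans _ h2) // ler_pM2l.
lra.
Qed.

End WindowContraction.

(** * Disagreement under perturbed averaging *)

Section PerturbedConsensus.
Context {R : realType} {n : nat} (E : nat -> rel 'I_n) (W : nat -> 'M[R]_n).
Context (w : R) (iota : nat).
Hypotheses (n_gt0 : (0 < n)%N) (mixW : mixing E W) (hA : assumption_network E W w iota).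

Let eps := w / (2 * n%:R ^+ 2).
Let rho := Num.sqrt (1 - eps).

Fixpoint mix_from (t N : nat) (a : 'cV[R]_n) : 'cV[R]_n :=
  if N is N'.+1 then W (t + N')%N *m mix_from t N' a else a.

Lemma mix_fromD t N M a : mix_from t (N + M) a = mix_from (t + N) M (mix_from t N a).
Proof. by elim: M => [|M IH]; rewrite ?addn0 // addnS /= IH addnA. Qed.

Let eps01 : 0 < eps <= 1 / 2.
Proof.
have /andP[w0 w1] := weight_range hA.
have n1 : 1 <= n%:R ^+ 2 :> R by rewrite exprn_ege1 // ler1n.
by rewrite /eps divr_gt0 //= ?ler_pdivrMr; nra.
Qed.

Let rho_sqr : rho ^+ 2 = 1 - eps.
Proof. by rewrite sqr_sqrtr //; case/andP: eps01 => _ h; lra. Qed.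

Let rho01 : 0 <= rho < 1.
Proof.
have := rho_sqr; have := sqrtr_ge0 (1 - eps); rewrite -/rho; case/andP: eps01; nra.
Qed.

Lemma mix_from_contracts t N a : (1 <= t)%N ->
  enorm (deviation (mix_from t N a)) <= rho ^+ (N %/ iota) * enorm (deviation a).
Proof.
move=> t1; have /andP[r0 r1] := rho01.
have mono M b s : (1 <= s)%N -> dispersion (mix_from s M b) <= dispersion b.
  move=> s1; elim: M => // M IH /=; apply: le_trans IH.
  by apply: dispersion_mix_le => //; apply: (weight_stochastic hA); rewrite (leq_trans s1) ?leq_addr.
have win j b s : (1 <= s)%N -> dispersion (mix_from s (j * iota) b) <= (rho ^+ 2) ^+ j * dispersion b.
  move=> s1; elim: j => [|j IH]; first by rewrite mul1r.
  rewrite mulSnr mix_fromD exprS -mulrA.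
  have s'1 : (1 <= s + j * iota)%N by rewrite (leq_trans s1) ?leq_addr.
  have := @window_contraction _ _ E W w iota n_gt0 mixW hA (s + j * iota)
    (fun l => mix_from (s + j * iota) l (mix_from s (j * iota) b)) s'1 (fun l => erefl).
  rewrite -/eps -rho_sqr /= => /le_trans; apply.
  by rewrite ler_wpM2l ?sqr_ge0.
have dE b : dispersion b = enorm (deviation b) ^+ 2 by rewrite sqr_enorm.
rewrite -(@ler_pXn2r _ 2) ?nnegrE ?mulr_ge0 ?exprn_ge0 ?enorm_ge0 // -dE exprMn -dE.
rewrite {1}(divn_eq N iota) mix_fromD -exprM [(_ * 2)%N]mulnC exprM.
apply: le_trans (mono _ _ _ _) (win _ _ _ t1).
by rewrite (leq_trans t1) ?leq_addr.
Qed.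

Lemma sum_window_geometric (r : R) M : 0 <= r < 1 ->
  \sum_(0 <= N < M) r ^+ (N %/ iota) <= iota%:R / (1 - r).
Proof.
move=> /andP[r0 r1]; have i0 := window_pos hA.
have r1' : 0 < 1 - r by lra.
have full j : \sum_(0 <= N < j * iota) r ^+ (N %/ iota) = iota%:R * \sum_(0 <= l < j) r ^+ l.
  elim: j => [|j IH]; first by rewrite !big_geq // mulr0.
  rewrite mulSnr (@big_cat_nat _ _ _ (j * iota)) ?leq_addr //= IH.
  rewrite big_nat_recr //= mulrDr; congr (_ + _).
  rewrite -{1}[(j * iota)%N]add0n big_addn addKn.
  rewrite big_nat (eq_bigr (fun=> r ^+ j)); last first.
    by move=> N /andP[_ Ni]; rewrite addnC divnMDl // divn_small // addn0.
  by rewrite -big_nat sumr_const_nat subn0 mulr_natl.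
apply: (@le_trans _ _ (\sum_(0 <= N < M * iota) r ^+ (N %/ iota))).
  rewrite [leRHS](@big_cat_nat _ _ _ M) ?leq_pmulr //= lerDl.
  by apply: sumr_ge0 => N _; rewrite exprn_ge0.
rewrite full ler_wpM2l ?ler0n // -[leRHS]mul1r ler_pdivlMr // mulrC.
have -> : (1 - r) * \sum_(0 <= l < M) r ^+ l = 1 - r ^+ M.
  rewrite big_mkord; have := subrX1 r M; lra.
by rewrite gerBl exprn_ge0.
Qed.

(** The norm of the deviation contracts by [rho = sqrt (1 - eps)] per window,
    which sums to [iota / (1 - rho)]. The bound is stated through the rate per
    round [lambda = (1 - eps) ^ (1 / iota)]. *)
Lemma window_rate : iota%:R / (1 - rho) <= 2 * tau n w / (1 - lambda n w iota).
Proof.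
have /andP[r0 r1] := rho01; have /andP[e0 e1] := eps01; have i0 := window_pos hA.
have ip : 0 < iota%:R :> R by rewrite ltr0n.
have b0 : 0 < 1 - eps by lra.
rewrite /tau /lambda -/eps; set l := (1 - eps) `^ _.
have l0 : 0 < l by rewrite powR_gt0.
have lE : l ^+ iota = 1 - eps.
  rewrite -powR_mulrn ?(ltW l0) // /l -powRrM mulVf ?(gt_eqF ip) //.
  by rewrite powRr1 //; exact: ltW.
have l1 : l < 1.
  rewrite ltNge; apply/negP => l1.
  by have := exprn_ege1 iota l1; rewrite lE; lra.
(* Bernoulli applied to the inverse of [1 - eps] *)
have bern : iota%:R * (1 - l) * (1 - eps) <= eps * l.
  have y0 : 0 < (1 - eps)^-1 by rewrite invr_gt0.
  have i01 : 0 <= (iota%:R^-1 : R) <= 1 by rewrite invr_ge0 ler0n invf_le1 // ler1n.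
  have := powR_bernoulli y0 i01.
  have -> : (1 - eps)^-1 `^ iota%:R^-1 = l^-1.
    by rewrite /l -[in LHS](powR_inv1 (ltW b0)) -powRrM mulN1r powRN.
  have bl : 0 < iota%:R * ((1 - eps) * l) by rewrite !mulr_gt0.
  rewrite -(ler_pM2l bl).
  have -> : iota%:R * ((1 - eps) * l) * l^-1 = iota%:R * (1 - eps).
    by field; rewrite gt_eqF.
  have -> : iota%:R * ((1 - eps) * l) * (1 + iota%:R^-1 * ((1 - eps)^-1 - 1))
     = iota%:R * ((1 - eps) * l) + l * eps by field; rewrite !gt_eqF.
  lra.
have r1' : 0 < 1 - rho by lra.
have l1' : 0 < 1 - l by lra.
rewrite ler_pdivrMr // mulrAC ler_pdivlMr //.
have epsE : eps = (1 - rho) * (1 + rho) by have := rho_sqr; lra.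
set V := (1 - eps) ^- 2.
have VE : V * (1 - eps) ^+ 2 = 1 by rewrite mulVf // expf_neq0 // gt_eqF.
have V0 : 0 < V by rewrite invr_gt0 exprn_gt0.
have b2 : 0 < (1 - eps) ^+ 2 by rewrite exprn_gt0.
rewrite -(ler_pM2r b2).
have -> : 2 * V * (1 - rho) * (1 - eps) ^+ 2 = 2 * (1 - rho).
  by rewrite mulrAC -[2 * V * _]mulrA VE mulr1.
rewrite expr2 mulrA; apply: (@le_trans _ _ (eps * l * (1 - eps))).
  by rewrite ler_pM2r.
have : eps * l * (1 - eps) <= eps.
  rewrite -mulrA ler_piMr ?(ltW e0) // mulr_ile1 ?(ltW l0) ?(ltW l1) ?(ltW b0) //; lra.
nra.
Qed.

Lemma disagreement_constant_ge0 : 0 <= tau n w / (1 - lambda n w iota).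
Proof.
have := window_rate; have /andP[_ r1] := rho01.
have : 0 <= iota%:R / (1 - rho) by rewrite divr_ge0 // subr_ge0 ltW.
lra.
Qed.

Lemma sum_shift_le (h : nat -> R) k T c : (forall N, 0 <= h N) ->
  (forall M, \sum_(0 <= N < M) h N <= c) ->
  \sum_(1 <= t < T | (k <= t)%N) h (t.+1 - k)%N <= c.
Proof.
move=> h0 hc; have [kT|Tk] := leqP k.+1 T; last first.
  rewrite big_nat_cond big_pred0 => [|t]; last first.
    apply/negbTE/negP => /andP[/andP[_ tT] kt].
    by have := leq_ltn_trans kt tT; rewrite ltnNge -ltnS Tk.
  by have := hc 0%N; rewrite big_geq.
apply: (@le_trans _ _ (\sum_(0 <= t < T | (k <= t)%N) h (t.+1 - k)%N)).
  rewrite [leRHS]big_ltn_cond ?(leq_ltn_trans _ kT) //; case: ifP => // _.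
  by rewrite lerDr.
rewrite (big_cat_nat (leq0n k) (ltnW kT)) /= big_nat_cond big_pred0 ?add0r; last first.
  by move=> t; apply/negbTE/negP => /andP[/andP[_ tk]]; rewrite leqNgt tk.
rewrite -{1}[k]add0n big_addn; apply: le_trans (hc (T - k).+1).
rewrite [leRHS]big_nat_recl //= ler_wpDl //.
rewrite le_eqVlt; apply/orP; left; apply/eqP.
rewrite big_mkcond; apply: eq_bigr => t _; rewrite leq_addl.
by rewrite -addSn addnK.
Qed.

Variables (q e : nat -> 'cV[R]_n).
Hypotheses (q1 : q 1%N = 0)
  (qS : forall t, (1 <= t)%N -> q t.+1 = W t *m q t + e t.+1).

Lemma mixed_state t : (1 <= t)%N ->
  W t *m q t = \sum_(2 <= k < t.+1) mix_from k (t.+1 - k) (e k).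
Proof.
elim: t => // t IH _; have [->|t0] := eqVneq t 0%N.
  by rewrite q1 mulmx0 big_geq.
have t1 : (1 <= t)%N by rewrite lt0n.
rewrite qS // IH // mulmxDr mulmx_sumr [RHS]big_nat_recr // subSnn /= addn0.
congr (_ + _); rewrite big_nat [RHS]big_nat; apply: eq_bigr => k /andP[_ kt].
by rewrite (subSn (ltnW kt)) /= (subnKC (ltnW kt)).
Qed.

(** Each perturbation is averaged out geometrically, window by window, so it
    contributes to the total disagreement only a multiple of its norm. *)
Lemma sum_disagreement T :
  \sum_(1 <= t < T.+1) enorm (deviation (W t *m q t))
  <= 2 * tau n w / (1 - lambda n w iota) * \sum_(2 <= k < T.+1) enorm (e k).
Proof.
have /andP[r0 r1] := rho01.
apply: (@le_trans _ _ (\sum_(1 <= t < T.+1) \sum_(2 <= k < T.+1 | (k <= t)%N)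
   rho ^+ ((t.+1 - k) %/ iota) * enorm (e k))).
  rewrite big_nat [leRHS]big_nat; apply: ler_sum => t /andP[t1 tT].
  rewrite mixed_state // (big_morph (@deviation R n) (@deviationD R n) (@deviation0 R n)).
  apply: le_trans (enorm_sum _ _ _) _.
  have -> : \sum_(2 <= k < T.+1 | (k <= t)%N) rho ^+ ((t.+1 - k) %/ iota) * enorm (e k)
     = \sum_(2 <= k < t.+1) rho ^+ ((t.+1 - k) %/ iota) * enorm (e k).
    by rewrite [RHS](big_nat_widen _ _ T.+1).
  rewrite big_nat [leRHS]big_nat; apply: ler_sum => k /andP[k2 kt].
  apply: le_trans (mix_from_contracts _ _ _) _; first exact: ltnW.
  rewrite ler_wpM2l ?exprn_ge0 // enorm_le2 -/(dispersion _).
  exact: dispersion_le_dot.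
rewrite (exchange_big_dep xpredT) //= mulr_sumr; apply: ler_sum => k _.
rewrite -mulr_suml ler_wpM2r ?enorm_ge0 //.
apply: (@le_trans _ _ (iota%:R / (1 - rho))); last exact: window_rate.
apply: (sum_shift_le (h := fun N => rho ^+ (N %/ iota))) => [N|M].
  exact: exprn_ge0.
by apply: sum_window_geometric; rewrite r0.
Qed.

End PerturbedConsensus.

(** * Projected descent and sums of noise *)

Section OneStep.
Context {R : realType} {k : nat}.

(** The projection brings the iterate no further from any point of the set it
    projects onto; expand the squared distance before the projection. *)
Lemma projected_step (K : set 'cV[R]_k) (z z' y a : 'cV[R]_k) (eta rad : R) :
  convex_set K -> closed K -> K `<=` eball rad -> K y ->
  z' = eproj K (z - eta *: a) ->
  2 * eta * dot a (z - y)
  <= dot (z - y) (z - y) - dot (z' - y) (z' - y) + eta ^+ 2 * dot a a.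
Proof.
move=> vK cK Kr Ky ->; have := eproj_nearer (z - eta *: a) vK cK Kr Ky.
have -> : z - eta *: a - y = (z - y) - eta *: a by rewrite addrAC.
move: (z - y) (dot (eproj _ _ - y) _) => d s.
by rewrite !dotE (dotC d a); lra.
Qed.

Definition noise_sum (c : nat -> R) (a v : nat -> 'cV[R]_k) (t : nat) : 'cV[R]_k :=
  \sum_(1 <= s < t) c s *: (a s - v s).

(** A sum of vectors [N_t = a_t - v_t] has squared norm at most the sum of the
    [|a_t|^2], up to terms linear in the [N_t] whose coefficients involve only
    the [v_t] and the earlier [N_s]. *)
Lemma sqr_norm_noise_sum (c : nat -> R) (a v : nat -> 'cV[R]_k) T :
  dot (noise_sum c a v T.+1) (noise_sum c a v T.+1)
  <= \sum_(1 <= t < T.+1) c t ^+ 2 * dot (a t) (a t)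
    + \sum_(1 <= t < T.+1)
        dot ((2 * c t) *: noise_sum c a v t - (2 * c t ^+ 2) *: v t) (a t - v t).
Proof.
elim: T => [|T IH]; first by rewrite /noise_sum !big_geq // dot0l addr0.
rewrite !(big_nat_recr T.+1) //=.
have -> : noise_sum c a v T.+2 = noise_sum c a v T.+1 + c T.+1 *: (a T.+1 - v T.+1).
  by rewrite /noise_sum big_nat_recr.
move: IH; set m' := noise_sum c a v T.+1.
move: (c T.+1) (a T.+1) (v T.+1) => c' a' v' IH.
have := dot_ge0 v'; have := sqr_ge0 c'.
rewrite !dotE (dotC a' m') (dotC v' m') (dotC a' v') => h1 h2.
have := mulr_ge0 h1 h2; move: IH; lra.
Qed.

(** Abel summation with nondecreasing weights [om]: a distance between [0] and
    [D] that contracts at each step, up to a drift of the comparator. *)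
Lemma weighted_telescope (om d d' drift : nat -> R) D T : (1 <= T)%N ->
  (forall t, (1 <= t)%N -> 0 <= om t <= om t.+1) ->
  (forall t, (1 <= t)%N -> d t <= D) ->
  (forall t, (1 <= t)%N -> 0 <= d' t) ->
  (forall t, (1 <= t)%N -> d t.+1 <= d' t + D * drift t) ->
  \sum_(1 <= t < T.+1) om t * (d t - d' t)
  <= D * (om T + \sum_(1 <= t < T) om t * drift t).
Proof.
move=> T1 om0 dD d'0 dd'.
suff : \sum_(1 <= t < T.+1) om t * (d t - d' t)
    <= D * (om T + \sum_(1 <= t < T) om t * drift t) - om T * d' T.
  have := mulr_ge0 (proj1 (andP (om0 _ T1))) (d'0 _ T1); lra.
elim: T T1 => // T IH _; have [->|T0] := eqVneq T 0%N.
  rewrite big_nat1 big_geq // addr0.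
  have := ler_wpM2l (proj1 (andP (om0 1%N isT))) (dD 1%N isT); lra.
have T1 : (1 <= T)%N by rewrite lt0n.
have {}IH := IH T1; rewrite (big_nat_recr T.+1) //= [X in _ <= D * (_ + X) - _](big_nat_recr T) //=.
have /andP[om_T0 om_T1] := om0 _ T1.
have h1 := ler_wpM2l om_T0 (dd' _ T1).
have h2 : (om T.+1 - om T) * d T.+1 <= (om T.+1 - om T) * D.
  by rewrite ler_wpM2l ?subr_ge0 // dD.
move: IH; lra.
Qed.

End OneStep.

(** * The dual variables *)

Lemma sqr_shift (R : realType) k (a b : 'cV[R]_k) (c : R) :
  dot (a + c *: b) (a + c *: b) = dot a a + 2 * (c * dot a b) + c ^+ 2 * dot b b.
Proof. by rewrite !dotE (dotC b a); ring. Qed.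

Lemma enorm_mono (R : realType) k (a b : 'cV[R]_k) :
  (forall j, 0 <= a j 0 <= b j 0) -> enorm a <= enorm b.
Proof.
move=> ab; rewrite enorm_le2; apply: ler_sum => j _.
by have /andP[a0 ab'] := ab j; apply: ler_pM.
Qed.

(** What remains of the dual telescope after the regularisation has paid for the
    increments of [1 / gamma] and for the estimation of the gradients. *)
Definition dual_potential (R : realType) (n m : nat) (W : nat -> 'M[R]_n)
    (q : 'I_n -> nat -> 'cV[R]_m) (th2 : R) (T : nat) : R :=
  T.+1%:R `^ (1 - th2) / 2 * \sum_i dot (q i T.+1) (q i T.+1)
  + \sum_(1 <= t < T.+1) \sum_i
      (11 / 8 / t.+1%:R `^ th2 - (t.+1%:R `^ (1 - th2) - t%:R `^ (1 - th2)) / 2)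
      * dot (qtilde W q i t.+1) (qtilde W q i t.+1).

Section DualVariables.
Context {R : realType} {n m : nat} (E : nat -> rel 'I_n) (W : nat -> 'M[R]_n).
Context (w : R) (iota : nat).
Hypotheses (n_gt0 : (0 < n)%N) (mixW : mixing E W) (hA : assumption_network E W w iota).
Variables (q : 'I_n -> nat -> 'cV[R]_m) (obs : 'I_n -> nat -> 'cV[R]_m).
Variables (F th2 : R).
Hypotheses (F0 : 0 <= F) (th2_01 : 0 < th2 <= 1 / 6).
Hypothesis obs_bound : forall i t j, (1 <= t)%N -> `|obs i t j 0| <= F.
Hypothesis q1 : forall i, q i 1%N = 0.

Let s i t := qtilde W q i t.+1.

Hypothesis qS : forall i t, (1 <= t)%N ->
  q i t.+1 = pos_part ((1 - 2 / t.+1%:R `^ th2 * (1 / t.+1%:R `^ (1 - th2))) *: s i t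
                       + (1 / t.+1%:R `^ (1 - th2)) *: obs i t).

Let dW t : (1 <= t)%N -> doubly_stochastic (W t).
Proof. exact: weight_stochastic hA t. Qed.

Let sE i t j : s i t j 0 = \sum_k W t i k * q k t j 0.
Proof. by rewrite /s /qtilde summxE; apply: eq_bigr => k _; rewrite mxE. Qed.

Let P t : R := t.+1%:R `^ (1 - th2).
Let Q t : R := t.+1%:R `^ th2.

Let P0 t : 0 < P t. Proof. by rewrite powR_gt0 // ltr0n. Qed.
Let Q0 t : 0 < Q t. Proof. by rewrite powR_gt0 // ltr0n. Qed.
Let PQ t : P t * Q t = t.+1%:R.
Proof.
rewrite /P /Q -powRD ?subrK ?powRr1 ?ler0n // ?pnatr_eq0.
by apply/implyP.
Qed.

(** The regularisation [beta] keeps the dual variables of the order of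
    [1 / beta]: the bound [F / beta] is reproduced by one step. *)
Lemma dual_bounds t : (1 <= t)%N ->
  forall i j, 0 <= q i t j 0 <= F / 2 * t%:R `^ th2.
Proof.
elim: t => // t IH _ i j; have [->|t0] := eqVneq t 0%N.
  by rewrite q1 mxE powR1 lexx mulr1 divr_ge0.
have t1 : (1 <= t)%N by rewrite lt0n.
have [W0 row1 _] := dW t1.
have s0 : 0 <= s i t j 0.
  by rewrite sE; apply: sumr_ge0 => k _; rewrite mulr_ge0 //; have /andP[] := IH t1 k j.
have sF : s i t j 0 <= F / 2 * Q t.
  apply: (@le_trans _ _ (F / 2 * t%:R `^ th2)); last first.
    rewrite ler_wpM2l ?divr_ge0 // ge0_ler_powR ?nnegrE ?ler0n ?ler_nat //.
    by case/andP: th2_01 => /ltW.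
  rewrite sE -[leRHS]mul1r -[X in _ <= X * _](row1 i) mulr_suml; apply: ler_sum => k _.
  by rewrite ler_wpM2l //; have /andP[] := IH t1 k j.
rewrite qS // pos_partE le_max lexx /= ge_max -/(Q t) -/(P t).
have FQ : 0 <= F / 2 * Q t by rewrite mulr_ge0 ?divr_ge0 ?(ltW (Q0 t)).
rewrite FQ !mxE.
have tt : 2 <= P t * Q t by rewrite PQ ler_nat.
have := obs_bound i j t1; rewrite ler_norml => /andP[_ h].
have PQp : 0 < P t * Q t by rewrite mulr_gt0.
have -> : 2 / Q t * (1 / P t) = 2 / (P t * Q t) by field; rewrite !gt_eqF.
have c0 : 0 <= 1 - 2 / (P t * Q t) by rewrite subr_ge0 ler_pdivrMr // mul1r.
apply: (@le_trans _ _ ((1 - 2 / (P t * Q t)) * (F / 2 * Q t) + 1 / P t * F)).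
  by apply: lerD; rewrite ler_wpM2l // divr_ge0 // (ltW (P0 t)).
by rewrite le_eqVlt; apply/orP; left; apply/eqP; field; rewrite !gt_eqF.
Qed.

Lemma mixed_dual_bounds t : (1 <= t)%N ->
  forall i j, 0 <= s i t j 0 <= F / 2 * t%:R `^ th2.
Proof.
move=> t1 i j; have [W0 row1 _] := dW t1; rewrite sE; apply/andP; split.
  by apply: sumr_ge0 => k _; rewrite mulr_ge0 //; have /andP[] := dual_bounds t1 k j.
rewrite -[leRHS]mul1r -[X in _ <= X * _](row1 i) mulr_suml; apply: ler_sum => k _.
by rewrite ler_wpM2l //; have /andP[] := dual_bounds t1 k j.
Qed.

Let resid i t : 'cV[R]_m := obs i t - (2 / Q t) *: s i t.

Let qS' i t : (1 <= t)%N -> q i t.+1 = pos_part (s i t + (P t)^-1 *: resid i t).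
Proof.
move=> t1; rewrite qS // -/(P t) -/(Q t); congr pos_part.
apply/matrixP => a b; rewrite !mxE; field.
by rewrite !gt_eqF // powR_gt0 // ltr0n.
Qed.

Let resid_bound i t j : (1 <= t)%N -> `|resid i t j 0| <= 2 * F.
Proof.
move=> t1; rewrite !mxE; have := obs_bound i j t1; rewrite !ler_norml => /andP[h1 h2].
have /andP[s0 sF] := mixed_dual_bounds t1 i j.
have : 2 / Q t * s i t j 0 <= F.
  rewrite mulrAC ler_pdivrMr // mulrC; apply: (@le_trans _ _ (2 * (F / 2 * t%:R `^ th2))).
    by rewrite mulrC ler_pM2l.
  have : t%:R `^ th2 <= Q t.
    rewrite ge0_ler_powR ?nnegrE ?ler0n ?ler_nat //.
    by case/andP: th2_01 => /ltW.
  by move=> /(ler_wpM2l F0); lra.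
have : 0 <= 2 / Q t * s i t j 0 by rewrite mulr_ge0 // divr_ge0 // (ltW (Q0 t)).
by move=> *; apply/andP; split; lra.
Qed.

(** Clipping at zero does not increase the norm, so expanding the square of the
    step gives the inequality; the residual is bounded by [2 F]. *)
Lemma dual_step i t : (1 <= t)%N ->
  - dot (obs i t) (s i t)
  <= P t / 2 * (dot (s i t) (s i t) - dot (q i t.+1) (q i t.+1))
     - 2 / Q t * dot (s i t) (s i t) + 2 * m%:R * F ^+ 2 / P t.
Proof.
move=> t1; rewrite (qS' i t1).
have : dot (pos_part (s i t + (P t)^-1 *: resid i t)) (pos_part (s i t + (P t)^-1 *: resid i t))
   <= dot (s i t + (P t)^-1 *: resid i t) (s i t + (P t)^-1 *: resid i t).
  apply: ler_sum => j _; rewrite pos_partE; set y := (s i t + (P t)^-1 *: resid i t) j 0.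
  by case: (leP 0 y) => // _; rewrite mul0r -expr2 sqr_ge0.
set A := dot (pos_part _) _.
have : dot (resid i t) (resid i t) <= m%:R * (2 * F) ^+ 2.
  by apply: enorm_le_coord => [|j]; [rewrite mulr_ge0 | exact: resid_bound].
have rs : dot (s i t) (resid i t) = dot (obs i t) (s i t) - 2 / Q t * dot (s i t) (s i t).
  by rewrite /resid dotBr dotZr (dotC (s i t) (obs i t)).
rewrite sqr_shift rs.
set r2 := dot (resid i t) (resid i t); set s2 := dot (s i t) (s i t); set gs := dot (obs i t) _.
move: (P0 t) (Q0 t); move: (P t) (Q t) => p q' p0 q0 h1 h2.
have h3 : p / 2 * A <= p / 2 * (s2 + 2 * (p^-1 * (gs - 2 / q' * s2)) + p^-1 * (p^-1 * r2)).
  by rewrite ler_pM2l ?divr_gt0 //; move: h2; rewrite expr2; lra.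
have E1 : p / 2 * (s2 + 2 * (p^-1 * (gs - 2 / q' * s2)) + p^-1 * (p^-1 * r2))
   = p / 2 * s2 + gs - 2 / q' * s2 + p^-1 / 2 * r2 by field; rewrite !gt_eqF.
have : p^-1 / 2 * r2 <= p^-1 / 2 * (m%:R * (2 * F) ^+ 2).
  by rewrite ler_wpM2l // divr_ge0 // invr_ge0 (ltW p0).
have -> : p^-1 / 2 * (m%:R * (2 * F) ^+ 2) = 2 * m%:R * F ^+ 2 / p by field; rewrite gt_eqF.
rewrite E1 in h3; lra.
Qed.

Lemma convex_comb_sqr (c : 'I_n -> R) (v : 'I_n -> 'cV[R]_m) :
  (forall i, 0 <= c i) -> \sum_i c i = 1 ->
  dot (\sum_i c i *: v i) (\sum_i c i *: v i) <= \sum_i c i * dot (v i) (v i).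
Proof.
move=> c0 c1; set b := \sum_i c i *: v i.
have : 0 <= \sum_i c i * dot (v i - b) (v i - b).
  by apply: sumr_ge0 => i _; rewrite mulr_ge0 ?dot_ge0.
have bb : \sum_i c i * dot (v i) b = dot b b.
  by rewrite {2}/b dot_suml; apply: eq_bigr => i _; rewrite dotZl.
have -> : \sum_i c i * dot (v i - b) (v i - b)
   = \sum_i c i * dot (v i) (v i) - 2 * (\sum_i c i * dot (v i) b)
     + (\sum_i c i) * dot b b.
  transitivity (\sum_i (c i * dot (v i) (v i) - 2 * (c i * dot (v i) b) + c i * dot b b)).
    by apply: eq_bigr => i _; rewrite !(dotBl, dotBr) (dotC b); ring.
  by rewrite big_split /= sumrB -mulr_sumr -mulr_suml.
rewrite bb c1; lra.
Qed.

(** Jensen's inequality in each row, then the column sums. *)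
Lemma mix_sqr_le t : (1 <= t)%N ->
  \sum_i dot (s i t) (s i t) <= \sum_i dot (q i t) (q i t).
Proof.
move=> t1; have [W0 row1 col1] := dW t1.
apply: (@le_trans _ _ (\sum_i \sum_k W t i k * dot (q k t) (q k t))).
  by apply: ler_sum => i _; apply: convex_comb_sqr.
rewrite exchange_big /=; apply: ler_sum => k _.
by rewrite -mulr_suml col1 mul1r.
Qed.

(** Summing [dual_step] and telescoping: since [1 / gamma] increases, part of the
    regularisation is spent on its increments. *)
Lemma dual_sum T :
  \sum_(1 <= t < T.+1) \sum_i - dot (obs i t) (s i t)
  <= \sum_(1 <= t < T.+1) \sum_i
       ((t.+1%:R `^ (1 - th2) - t%:R `^ (1 - th2)) / 2 - 2 / t.+1%:R `^ th2)
         * dot (s i t) (s i t)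
     - T.+1%:R `^ (1 - th2) / 2 * \sum_i dot (q i T.+1) (q i T.+1)
     + 2 * m%:R * n%:R * F ^+ 2 * \sum_(1 <= t < T.+1) (t.+1%:R `^ (1 - th2))^-1.
Proof.
elim: T => [|T IH].
  rewrite !big_geq // mulr0 addr0 sub0r.
  by rewrite big1 ?mulr0 ?oppr0 // => i _; rewrite q1 dot0l.
rewrite !(big_nat_recr T.+1) //=.
have : \sum_i - dot (obs i T.+1) (s i T.+1) <= \sum_i
   (P T.+1 / 2 * (dot (s i T.+1) (s i T.+1) - dot (q i T.+2) (q i T.+2))
     - 2 / Q T.+1 * dot (s i T.+1) (s i T.+1) + 2 * m%:R * F ^+ 2 / P T.+1).
  by apply: ler_sum => i _; apply: dual_step.
rewrite [leRHS]big_split /= sumr_const card_ord -[_ *+ n]mulr_natl.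
rewrite sumrB -!mulr_sumr sumrB.
have h := mix_sqr_le (ltn0Sn T).
have : T.+1%:R `^ (1 - th2) / 2 * \sum_i dot (s i T.+1) (s i T.+1)
   <= T.+1%:R `^ (1 - th2) / 2 * \sum_i dot (q i T.+1) (q i T.+1).
  by rewrite ler_wpM2l // divr_ge0 ?powR_ge0.
rewrite -/(P T.+1) -/(Q T.+1) mulrDr.
have -> : n%:R * (2 * m%:R * F ^+ 2 / P T.+1) = 2 * m%:R * n%:R * F ^+ 2 * (P T.+1)^-1 by ring.
move: IH; lra.
Qed.

(** The constraints bind only in total, so what the individual terms can lose is
    the disagreement of the dual variables. *)
Lemma feasible_dual_sum (d : 'I_n -> nat -> 'cV[R]_m) T :
  (forall i t j, (1 <= t <= T)%N -> `|d i t j 0| <= F) ->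
  (forall t j, (1 <= t <= T)%N -> \sum_i d i t j 0 <= 0) ->
  \sum_(1 <= t < T.+1) \sum_i dot (d i t) (s i t)
  <= 4 * m%:R * n%:R * F ^+ 2 * tau n w / (1 - lambda n w iota)
     * \sum_(1 <= t < T.+1) (t.+1%:R `^ (1 - th2))^-1.
Proof.
move=> dF d0; set K := 2 * tau n w / (1 - lambda n w iota).
set G := \sum_(1 <= t < T.+1) (t.+1%:R `^ (1 - th2))^-1.
pose qv j t : 'cV[R]_n := \col_i q i t j 0.
have Wqv j t i : (W t *m qv j t) i 0 = s i t j 0.
  by rewrite sE mxE; apply: eq_bigr => k _; rewrite mxE.
pose e j t : 'cV[R]_n := qv j t - W t.-1 *m qv j t.-1.
pose rt : R := Num.sqrt n%:R.
have rt2 : rt * rt = n%:R by rewrite -expr2 sqr_sqrtr ?ler0n.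
have rt0 : 0 <= rt by exact: sqrtr_ge0.
have small (v : 'cV[R]_n) a : 0 <= a -> (forall i, `|v i 0| <= a) -> enorm v <= rt * a.
  move=> a0 va; rewrite enorm_le ?mulr_ge0 // exprMn expr2 rt2.
  exact: enorm_le_coord.
have eF j t : (1 <= t)%N -> enorm (e j t.+1) <= rt * (2 * F / P t).
  move=> t1; apply: small => [|i]; first by rewrite divr_ge0 ?(ltW (P0 t)) ?mulr_ge0.
  have -> : e j t.+1 i 0 = q i t.+1 j 0 - s i t j 0.
    by rewrite /e /= mxE [X in _ + X]mxE Wqv mxE.
  rewrite qS' // pos_partE.
  have -> : (s i t + (P t)^-1 *: resid i t) j 0 = s i t j 0 + (P t)^-1 * resid i t j 0.
    by rewrite mxE [X in _ + X]mxE.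
  have := resid_bound i j t1; have /andP[s0 _] := mixed_dual_bounds t1 i j.
  set r := resid i t j 0; set a := s i t j 0 in s0 *; move=> rF.
  have : `|(P t)^-1 * r| <= 2 * F / P t.
    by rewrite normrM gtr0_norm ?invr_gt0 // mulrC ler_pM2r ?invr_gt0.
  rewrite !ler_norml => /andP[h1 h2].
  by case: (leP 0 (a + (P t)^-1 * r)) => h; apply/andP; split; lra.
have disag j : \sum_(1 <= t < T.+1) enorm (deviation (W t *m qv j t)) <= K * (rt * (2 * F) * G).
  have := @sum_disagreement _ _ E W w iota n_gt0 mixW hA (qv j) (e j) _ _ T.
  move=> h; apply: le_trans (h _ _) _.
  - by apply/matrixP => i l; rewrite !mxE q1 mxE.
  - by move=> t t1; rewrite /e /= addrC subrK.
  have K0 : 0 <= K by have := disagreement_constant_ge0 n_gt0 hA; rewrite /K; lra.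
  rewrite ler_wpM2l // big_add1 /=.
  apply: (@le_trans _ _ (\sum_(1 <= t < T) rt * (2 * F / P t))).
    by rewrite big_nat [leRHS]big_nat; apply: ler_sum => t /andP[t1 _]; exact: eF.
  under eq_bigr do rewrite mulrA.
  rewrite -mulr_sumr; apply: ler_wpM2l; first by rewrite !mulr_ge0.
  rewrite /G; case: (T) => [|T']; first by rewrite !big_geq.
  by rewrite [leRHS]big_nat_recr //= lerDl invr_ge0 powR_ge0.
have step t : (1 <= t <= T)%N ->
    \sum_i dot (d i t) (s i t) <= \sum_j rt * F * enorm (deviation (W t *m qv j t)).
  move=> tT; have /andP[t1 _] := tT.
  rewrite exchange_big /=; apply: ler_sum => j _.
  pose dv : 'cV[R]_n := \col_i d i t j 0.
  have -> : \sum_i d i t j 0 * s i t j 0 = dot dv (W t *m qv j t).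
    by apply: eq_bigr => i _; rewrite mxE Wqv.
  have := dot_le_enorm dv (deviation (W t *m qv j t)).
  rewrite {1}/deviation dotBr.
  have -> : dot dv (const_mx (mean (W t *m qv j t)))
      = mean (W t *m qv j t) * \sum_i d i t j 0.
    by rewrite mulr_sumr; apply: eq_bigr => i _; rewrite !mxE mulrC.
  have m0 : 0 <= mean (W t *m qv j t).
    rewrite divr_ge0 ?ler0n // sumr_ge0 // => i _; rewrite Wqv.
    by have /andP[] := mixed_dual_bounds t1 i j.
  have : enorm dv * enorm (deviation (W t *m qv j t)) <= rt * F * enorm (deviation (W t *m qv j t)).
    rewrite ler_wpM2r ?enorm_ge0 //; apply: small => // i; rewrite mxE; exact: dF.
  have := d0 t j tT => h; have := mulr_ge0 m0 (_ : 0 <= - \sum_i d i t j 0).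
  by rewrite oppr_ge0 => /(_ h); rewrite mulrN; lra.
apply: (@le_trans _ _ (\sum_j \sum_(1 <= t < T.+1) rt * F * enorm (deviation (W t *m qv j t)))).
  rewrite [leRHS]exchange_big /= big_nat [leRHS]big_nat; apply: ler_sum => t tT.
  exact: step.
apply: (@le_trans _ _ (\sum_(j < m) rt * F * (K * (rt * (2 * F) * G)))).
  by apply: ler_sum => j _; rewrite -mulr_sumr ler_wpM2l // mulr_ge0.
rewrite sumr_const card_ord -[_ *+ m]mulr_natl le_eqVlt; apply/orP; left; apply/eqP.
have -> : m%:R * (rt * F * (K * (rt * (2 * F) * G)))
  = m%:R * (rt * rt) * F ^+ 2 * (2 * K) * G by ring.
by rewrite rt2 /K; ring.
Qed.

(** Clipping only increases the dual variables, so each step bounds the observed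
    constraint by their increment and the regularisation; Abel summation. *)
Lemma cumulated_observations T j :
  \sum_(1 <= t < T.+1) \sum_i obs i t j 0
  <= T.+1%:R `^ (1 - th2) * \sum_i q i T.+1 j 0
     + \sum_(1 <= t < T.+1) \sum_i
        (2 / t.+1%:R `^ th2 - (t.+1%:R `^ (1 - th2) - t%:R `^ (1 - th2))) * s i t j 0.
Proof.
elim: T => [|T IH].
  by rewrite !big_geq // addr0 big1 ?mulr0 // => i _; rewrite q1 mxE.
rewrite !(big_nat_recr T.+1) //= -/(P T.+1) -/(Q T.+1).
have [W0 row1 col1] := dW (ltn0Sn T).
have sq : \sum_i s i T.+1 j 0 = \sum_i q i T.+1 j 0.
  under eq_bigr do rewrite sE.
  by rewrite exchange_big; apply: eq_bigr => k _; rewrite -mulr_suml col1 mul1r.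
have : \sum_i obs i T.+1 j 0
    <= \sum_i (P T.+1 * (q i T.+2 j 0 - s i T.+1 j 0) + 2 / Q T.+1 * s i T.+1 j 0).
  apply: ler_sum => i _; rewrite qS' // pos_partE.
  have -> : (s i T.+1 + (P T.+1)^-1 *: resid i T.+1) j 0
      = s i T.+1 j 0 + (P T.+1)^-1 * (obs i T.+1 j 0 - 2 / Q T.+1 * s i T.+1 j 0).
    have rE : resid i T.+1 j 0 = obs i T.+1 j 0 - 2 / Q T.+1 * s i T.+1 j 0.
      by rewrite !mxE.
    by rewrite mxE [X in _ + X]mxE rE.
  set sj := s i T.+1 j 0; set oj := obs i T.+1 j 0; set c := 2 / Q T.+1.
  have : sj + (P T.+1)^-1 * (oj - c * sj) <= Num.max 0 (sj + (P T.+1)^-1 * (oj - c * sj)).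
    by rewrite le_max lexx orbT.
  set M := Num.max _ _ => h.
  have := ler_wpM2l (ltW (P0 T.+1)) h.
  rewrite mulrDr mulrA divff ?gt_eqF // mul1r; lra.
rewrite big_split /= -!mulr_sumr sumrB sq.
move: IH; lra.
Qed.

(** The weights with which the dual variables enter the violation are
    controlled, by Young's inequality, by their weights in the potential. *)
Lemma violation_le_potential T (rho : R) : (1 <= T)%N -> 0 < rho ->
  enorm (pos_part (\sum_(1 <= t < T.+1) \sum_i obs i t))
  <= rho * dual_potential W q th2 T
     + n%:R / (2 * rho) * (1 + (1 - th2)^-1) * T%:R `^ (1 - th2).
Proof.
move=> T1 rho0; set kap := 1 - th2.
have [k0 k1] : 5 / 6 <= kap /\ kap < 1.
  by case/andP: th2_01 => h1 h2; rewrite /kap; split; lra.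
pose c t : R := 2 / Q t - (P t - t%:R `^ kap).
have QE t : (Q t)^-1 = t.+1%:R `^ (kap - 1).
  by rewrite /Q /kap -powRN; congr (_ `^ _); ring.
have incr t : (1 <= t)%N -> 1 / 2 * (Q t)^-1 <= P t - t%:R `^ kap <= 2 * (Q t)^-1.
  by move=> t1; rewrite QE; apply: powR_natS_increment => //; apply/andP; split; lra.
have c0 t : (1 <= t)%N -> 0 <= c t.
  by move=> /incr/andP[_]; rewrite /c; lra.
pose V : 'cV[R]_m := P T *: \sum_i q i T.+1
   + \sum_(1 <= t < T.+1) \sum_i c t *: s i t.
have VE j : V j 0 = P T * \sum_i q i T.+1 j 0
    + \sum_(1 <= t < T.+1) \sum_i c t * s i t j 0.
  rewrite /V mxE [X in X + _]mxE !summxE; congr (_ + _).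
  by apply: eq_bigr => t _; rewrite summxE; apply: eq_bigr => i _; rewrite mxE.
have V0 j : 0 <= V j 0.
  rewrite VE addr_ge0 ?mulr_ge0 ?(ltW (P0 T)) //.
    by apply: sumr_ge0 => i _; have /andP[] := dual_bounds (ltn0Sn T) i j.
  rewrite big_nat; apply: sumr_ge0 => t /andP[t1 _]; apply: sumr_ge0 => i _.
  by rewrite mulr_ge0 ?c0 //; have /andP[] := mixed_dual_bounds t1 i j.
have le1 : enorm (pos_part (\sum_(1 <= t < T.+1) \sum_i obs i t)) <= enorm V.
  apply: enorm_mono => j; rewrite pos_partE le_max lexx /= ge_max V0 VE /=.
  rewrite summxE; under [leLHS]eq_bigr do rewrite summxE.
  exact: cumulated_observations.
have le2 : enorm V <= P T * \sum_i enorm (q i T.+1)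
    + \sum_(1 <= t < T.+1) c t * \sum_i enorm (s i t).
  apply: le_trans (enormD _ _) _; rewrite enormZ (gtr0_norm (P0 T)) lerD //.
    by rewrite ler_pM2l // enorm_sum.
  apply: le_trans (enorm_sum _ _ _) _; rewrite big_nat [leRHS]big_nat.
  apply: ler_sum => t /andP[t1 _]; apply: le_trans (enorm_sum _ _ _) _.
  by rewrite mulr_sumr; apply: ler_sum => i _; rewrite enormZ ger0_norm // c0.
have young1 (y : R) : y <= rho * (1 / 2 * y ^+ 2) + 1 / (2 * rho).
  rewrite -(ler_pM2l rho0) mulrDr.
  have -> : rho * (1 / (2 * rho)) = 1 / 2 by field; rewrite gt_eqF.
  have := sqr_ge0 (rho * y - 1); rewrite !expr2; lra.
have young2 t (y : R) : (1 <= t)%N ->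
    c t * y <= rho * ((11 / 8 / Q t - (P t - t%:R `^ kap) / 2) * y ^+ 2) + (Q t)^-1 / (2 * rho).
  move=> t1; have := incr t t1; rewrite /c.
  have i0 : 0 < (Q t)^-1 by rewrite invr_gt0.
  set e := (Q t)^-1 in i0 *; set D := P t - _ => /andP[D1 D2].
  have [kk kE] : exists kk, D = kk * e by exists (D / e); rewrite divfK // gt_eqF.
  rewrite kE in D1 D2 *.
  have kk1 : 1 / 2 <= kk by move: D1; rewrite ler_pM2r.
  have kk2 : kk <= 2 by move: D2; rewrite ler_pM2r.
  have -> : (2 * e - kk * e) * y = e * ((2 - kk) * y) by ring.
  have -> : rho * ((11 / 8 * e - kk * e / 2) * y ^+ 2) + e / (2 * rho)
     = e * (rho * ((11 / 8 - kk / 2) * y ^+ 2) + 1 / (2 * rho)).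
    by field; rewrite gt_eqF.
  rewrite ler_pM2l // -(ler_pM2l rho0) mulrDr.
  have -> : rho * (1 / (2 * rho)) = 1 / 2 by field; rewrite gt_eqF.
  (* the difference of the two sides of [disc] is
     (2 * kk - 1) * (2 * kk - 5) / 4, nonpositive on [1/2, 2] *)
  set Y := rho * y.
  have -> : rho * ((2 - kk) * y) = (2 - kk) * Y by rewrite /Y; ring.
  have -> : rho * (rho * ((11 / 8 - kk / 2) * y ^+ 2)) = (11 / 8 - kk / 2) * (Y * Y).
    by rewrite /Y; ring.
  have disc : (2 - kk) ^+ 2 <= 2 * (11 / 8 - kk / 2) by rewrite expr2; nra.
  have YY := sqr_ge0 ((2 - kk) * Y - 1).
  have Y2 : 0 <= Y * Y by rewrite -expr2 sqr_ge0.
  have := ler_wpM2r Y2 disc; move: YY; rewrite !expr2; lra.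
have s1 i : s i 1%N = 0.
  by rewrite /s /qtilde; apply: big1 => k _; rewrite q1 scaler0.
have sum1 : P T * \sum_i enorm (q i T.+1)
    <= rho * (P T / 2 * \sum_i dot (q i T.+1) (q i T.+1)) + P T * (n%:R / (2 * rho)).
  have : \sum_i enorm (q i T.+1) <= \sum_i (rho * (1 / 2 * dot (q i T.+1) (q i T.+1)) + 1 / (2 * rho)).
    by apply: ler_sum => i _; rewrite -sqr_enorm.
  rewrite big_split /= -!mulr_sumr sumr_const card_ord -[_ *+ n]mulr_natl.
  move=> /(ler_wpM2l (ltW (P0 T))); lra.
(* the mixed dual variables of round 1 vanish, which leaves room to shift the sum
   of the [1 / Q t] by one round *)
have sum2 : \sum_(1 <= t < T.+1) c t * \sum_i enorm (s i t)
    <= rho * (\sum_(1 <= t < T.+1) \sum_i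
      (11 / 8 / Q t - (P t - t%:R `^ kap) / 2) * dot (s i t) (s i t))
      + n%:R / (2 * rho) * \sum_(1 <= t < T) t.+1%:R `^ (kap - 1).
  have split1 (h : nat -> R) :
      \sum_(1 <= t < T.+1) h t = h 1%N + \sum_(2 <= t < T.+1) h t.
    by rewrite big_ltn.
  rewrite !split1.
  have -> : \sum_i enorm (s i 1%N) = 0 by apply: big1 => i _; rewrite s1 enorm0.
  have -> : \sum_i (11 / 8 / Q 1 - (P 1 - 1%:R `^ kap) / 2) * dot (s i 1%N) (s i 1%N) = 0.
    by apply: big1 => i _; rewrite s1 dot0l mulr0.
  rewrite mulr0 !add0r.
  apply: (@le_trans _ _ (\sum_(2 <= t < T.+1) \sum_i
     (rho * ((11 / 8 / Q t - (P t - t%:R `^ kap) / 2) * dot (s i t) (s i t)) + (Q t)^-1 / (2 * rho)))).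
    rewrite big_nat [leRHS]big_nat; apply: ler_sum => t /andP[t2 _].
    rewrite mulr_sumr; apply: ler_sum => i _; rewrite -sqr_enorm.
    by apply: young2; apply: ltnW.
  under [leLHS]eq_bigr do rewrite big_split /= -mulr_sumr sumr_const card_ord.
  rewrite [leLHS]big_split /= -mulr_sumr lerD2l.
  rewrite mulr_sumr big_add1 /= big_nat [leRHS]big_nat; apply: ler_sum => t /andP[t1 _].
  rewrite -[_ *+ n]mulr_natl (QE t.+1) mulrA mulrAC ler_wpM2l //.
    by rewrite divr_ge0 ?ler0n ?mulr_ge0 ?(ltW rho0).
  rewrite -[kap - 1]opprB !powRN lef_pV2 ?posrE ?powR_gt0 ?ltr0n //.
  by rewrite ge0_ler_powR ?nnegrE ?ler0n ?ler_nat //; lra.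
have kk01 : 0 < kap <= 1 by apply/andP; split; lra.
have kk01' : 0 <= kap <= 1 by apply/andP; split; lra.
have h3 := sum_powR_lt T1 kk01.
have h4 := powR_natS_le T1 kk01'.
have nr0 : 0 <= n%:R / (2 * rho) by rewrite divr_ge0 ?ler0n ?mulr_ge0 ?(ltW rho0).
have h5 := ler_wpM2l nr0 h3; have h6 := ler_wpM2l nr0 h4.
have ki : 1 <= kap^-1 by rewrite invf_ge1; lra.
have h7 := ler_wpM2l nr0 ki.
apply: le_trans le1 _; apply: le_trans le2 _; rewrite /dual_potential -/kap.
move: sum1 sum2 h5 h6 h7; rewrite /P -/kap; lra.
Qed.

End DualVariables.

(** * The regret of one learner *)

Section Learner.
Context {R : realType} {k m : nat}.
Variables (X : set 'cV[R]_k) (r Rad Ff Fg Gf Gg F : R) (th1 th2 th3 : R).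
Hypotheses (k_gt0 : (0 < k)%N) (m_gt0 : (0 < m)%N).
Hypotheses (r0 : 0 < r) (Rad0 : 0 < Rad) (Ff0 : 0 < Ff) (Fg0 : 0 < Fg)
  (Gf0 : 0 < Gf) (Gg0 : 0 < Gg) (F0 : 0 <= F).
Hypotheses (vX : convex_set X) (cX : closed X) (inX : eball r `<=` X)
  (Xout : X `<=` eball Rad).
Hypotheses (hth1 : 3 / 4 < th1 <= 5 / 6) (hth2 : th2 = 2 * th1 - 3 / 2)
  (hth3 : th3 = th1 - 1 / 2).

Let al t : R := r ^+ 2 / (4 * m%:R * k%:R ^+ 2 * Fg ^+ 2 * t%:R `^ th1).
Let xi t : R := 1 / t.+1%:R `^ th3.
Let de t : R := r / t.+1%:R `^ th3.

Let p3_gt0 t : 0 < t.+1%:R `^ th3 :> R.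
Proof. by rewrite powR_gt0 // ltr0n. Qed.

Let p1_gt0 t : 0 < t.+1%:R `^ th1 :> R.
Proof. by rewrite powR_gt0 // ltr0n. Qed.

Let th3_01 : 0 < th3 <= 1 / 3.
Proof. by case/andP: hth1 => h1 h2; rewrite hth3; apply/andP; split; lra. Qed.

Lemma shrinkage_range t : (1 <= t)%N -> 0 < xi t < 1.
Proof.
move=> t1; rewrite /xi divr_gt0 //= ltr_pdivrMr // mul1r.
case/andP: th3_01 => h _; have := @gt0_ltr_powR R th3 h 1 t.+1%:R.
by rewrite !nnegrE ler01 ler0n ltr1n powR1; apply.
Qed.

Lemma perturbed_feasible t y b : (1 <= t)%N -> X y -> enorm b <= 1 ->
  X ((1 - xi t) *: y + de t *: b).
Proof.
move=> t1 Xy b1; have /andP[x0 x1] := shrinkage_range t1.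
have Xb : X (r *: b).
  by apply: inX; rewrite /eball /= enormZ gtr0_norm // ler_piMr // ltW.
have c01 : 0 <= 1 - xi t <= 1 by rewrite subr_ge0 (ltW x1) gerBl (ltW x0).
have := convex_setE vX Xy Xb c01.
have E : xi t * r = de t by rewrite /xi /de mulrC mulrA mulr1.
by rewrite subKr scalerA E.
Qed.

Lemma center_feasible : X 0.
Proof. by apply: inX; rewrite /eball /= enorm0 ltW. Qed.

Let shrunk_feasible t y : (1 <= t)%N -> X y -> X ((1 - xi t) *: y).
Proof.
by move=> t1 /(perturbed_feasible (b := 0) t1); rewrite scaler0 addr0 enorm0; apply.
Qed.

Variables (f : nat -> 'cV[R]_k -> R) (g : nat -> 'cV[R]_k -> 'cV[R]_m).
Variables (u z x a v : nat -> 'cV[R]_k) (s : nat -> 'cV[R]_m) (T : nat).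
Hypothesis T1 : (1 <= T)%N.

Let phi t y := f t y + dot (g t y) (s t).
Let slope t := Gf + Gg * \sum_j s t j 0.

Hypothesis z1 : shrink (xi 1) X (z 1%N).
Hypothesis zS : forall t, (1 <= t)%N ->
  z t.+1 = eproj (shrink (xi t.+1) X) (z t - al t.+1 *: a t).
Hypothesis xE : forall t, (1 <= t)%N -> x t = z t + de t *: u t.
Hypothesis u1 : forall t, (1 <= t)%N -> enorm (u t) = 1.
Hypothesis aE : forall t, (1 <= t)%N -> a t = (k%:R / de t * phi t (x t)) *: u t.
Hypothesis s_bound : forall t j, (1 <= t)%N -> 0 <= s t j 0 <= F / 2 * t%:R `^ th2.
Hypothesis f_bound : forall t y, (1 <= t)%N -> X y -> `|f t y| <= Ff.
Hypothesis g_bound : forall t y j, (1 <= t)%N -> X y -> `|g t y j 0| <= Fg.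
Hypothesis phi_lip : forall t, (1 <= t)%N -> lipschitz_on X (slope t) (phi t).
Hypothesis vP : forall t y, (1 <= t)%N -> X y ->
  phi t (z t) - phi t ((1 - xi t) *: y) - slope t * de t
  <= dot (v t) (z t - (1 - xi t) *: y).

Let z_shrink t : (1 <= t)%N -> shrink (xi t) X (z t).
Proof.
case: t => // t _; have [->//|t0] := eqVneq t 0%N.
have t1 : (1 <= t)%N by rewrite lt0n.
rewrite zS //; have /andP[x0 x1] := shrinkage_range (ltn0Sn t).
have sub : shrink (xi t.+1) X `<=` eball Rad.
  by apply: shrink_bounded; rewrite ?(ltW x0) //; exact: center_feasible.
have ne : shrink (xi t.+1) X !=set0.
  by exists ((1 - xi t.+1) *: 0), 0 => //; exact: center_feasible.
by have [] := eproj_min (z t - al t.+1 *: a t) (shrink_closed x1 cX) ne sub.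
Qed.

Let z_norm t : (1 <= t)%N -> enorm (z t) <= Rad.
Proof.
move=> t1; have /andP[x0 x1] := shrinkage_range t1.
apply: Xout; apply: shrinkP (z_shrink t1) => //; first by rewrite ltW.
exact: center_feasible.
Qed.

Lemma decision_feasible t b : (1 <= t)%N -> enorm b <= 1 -> X (z t + de t *: b).
Proof.
by move=> t1 b1; have [y Xy <-] := z_shrink t1; apply: perturbed_feasible.
Qed.

Let x_feasible t : (1 <= t)%N -> X (x t).
Proof. by move=> t1; rewrite xE //; apply: decision_feasible; rewrite ?u1. Qed.

Let slope_ge0 t : (1 <= t)%N -> 0 <= slope t.
Proof.
move=> t1; rewrite /slope addr_ge0 ?(ltW Gf0) // mulr_ge0 ?(ltW Gg0) //.
by apply: sumr_ge0 => j _; have /andP[] := s_bound j t1.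
Qed.

Let A2 := m%:R * k%:R ^+ 2 * Fg ^+ 2 * Rad ^+ 2 / r ^+ 2.

(** Weight of the squared noise norm, balanced against the part of the regret
    budget that the descent itself leaves unused. *)
Definition noise_weight : R :=
  3 / 112 * (r ^+ 2 / (m%:R * k%:R ^+ 2 * Fg ^+ 2 * T%:R `^ th1)).

(** What multiplies the noise of round [t] once the squared norm of the noise sum
    has been expanded: it involves the noise of the earlier rounds only. *)
Definition noise_direction t : 'cV[R]_k :=
  noise_weight *: ((2 * (1 - xi t)) *: noise_sum (fun t => 1 - xi t) a v t
                   - (2 * (1 - xi t) ^+ 2) *: v t) - z t.

Let mp : 0 < m%:R :> R. Proof. by rewrite ltr0n. Qed.
Let kp : 0 < k%:R :> R. Proof. by rewrite ltr0n. Qed.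

(** The weights [1 / alpha] grow like [t `^ th1] and the comparator moves with the
    shrinkage. Two points of the domain are at squared distance at most
    [4 Rad ^+ 2], so [weighted_drift] gives the constant [2 * 4 * 11 / 6]. *)
Lemma descent_sum y : X y ->
  \sum_(1 <= t < T.+1) dot (a t) (z t - (1 - xi t) *: y)
  <= 44 / 3 * A2 * T%:R `^ th1 + \sum_(1 <= t < T.+1) al t.+1 / 2 * dot (a t) (a t).
Proof.
move=> Xy; pose yy t := (1 - xi t) *: y.
pose d t := dot (z t - yy t) (z t - yy t).
pose d' t := dot (z t.+1 - yy t) (z t.+1 - yy t).
pose B := 2 * m%:R * k%:R ^+ 2 * Fg ^+ 2 / r ^+ 2.
have B0 : 0 <= B by rewrite /B !mulr_ge0 ?invr_ge0 ?exprn_ge0 ?ler0n ?(ltW r0) ?(ltW Fg0).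
have alE t : al t.+1 * (2 * B * t.+1%:R `^ th1) = 1.
  by rewrite /al /B; field; rewrite !gt_eqF.
have al0 t : 0 < al t.+1.
  by rewrite /al divr_gt0 ?exprn_gt0 // !mulr_gt0 // ?exprn_gt0.
have step t : (1 <= t)%N ->
    dot (a t) (z t - yy t) <= B * (t.+1%:R `^ th1 * (d t - d' t)) + al t.+1 / 2 * dot (a t) (a t).
  move=> t1; have /andP[x0 x1] := shrinkage_range t1.
  have /andP[x'0 x'1] := shrinkage_range (ltn0Sn t).
  have mono : xi t.+1 <= xi t.
    rewrite /xi ler_pM2l // lef_pV2 ?posrE // ge0_ler_powR ?nnegrE ?ler0n ?ler_nat //.
    by case/andP: th3_01 => /ltW.
  have sub : shrink (xi t.+1) X `<=` eball Rad.
    by apply: shrink_bounded; rewrite ?(ltW x'0) //; exact: center_feasible.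
  have yin : shrink (xi t.+1) X (yy t).
    have c0 : 0 < 1 - xi t.+1 by lra.
    exists (((1 - xi t) / (1 - xi t.+1)) *: y); last first.
      by rewrite scalerA mulrC divfK // gt_eqF.
    have c01 : 0 <= (1 - xi t) / (1 - xi t.+1) <= 1.
      by rewrite divr_ge0 ?subr_ge0 ?(ltW x1) ?(ltW x'1) //= ler_pdivrMr // mul1r lerD2l lerN2.
    by have := convex_setE vX Xy center_feasible c01; rewrite scaler0 addr0.
  have := projected_step (shrink_convex (xi := xi t.+1) vX) (shrink_closed x'1 cX) sub yin (zS t1).
  rewrite -/(d t) -/(d' t) => h.
  have h2 := ler_wpM2l (ltW (al0 t)) h.
  rewrite -(ler_pM2l (al0 t)).
  have E : al t.+1 * (B * (t.+1%:R `^ th1 * (d t - d' t))) = (d t - d' t) / 2.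
    have -> : al t.+1 * (B * (t.+1%:R `^ th1 * (d t - d' t)))
      = al t.+1 * (2 * B * t.+1%:R `^ th1) * ((d t - d' t) / 2) by field.
    by rewrite alE mul1r.
  rewrite mulrDr E; move: h; rewrite expr2; lra.
apply: (@le_trans _ _ (\sum_(1 <= t < T.+1) (B * (t.+1%:R `^ th1 * (d t - d' t))
    + al t.+1 / 2 * dot (a t) (a t)))).
  by rewrite big_nat [leRHS]big_nat; apply: ler_sum => t /andP[t1 _]; exact: step.
rewrite big_split /= lerD2r -mulr_sumr.
have nrm (w w' : 'cV[R]_k) : enorm w <= Rad -> enorm w' <= Rad ->
    dot (w - w') (w - w') <= 4 * Rad ^+ 2.
  move=> h h'; have : enorm (w - w') <= 2 * Rad.
    by apply: le_trans (enormB _ _) _; lra.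
  by rewrite enorm_le ?mulr_ge0 ?(ltW Rad0) // exprMn (_ : 2 ^+ 2 = 4) //; ring.
have yn t : (1 <= t)%N -> enorm (yy t) <= Rad.
  by move=> t1; apply: Xout; exact: shrunk_feasible.
have := @weighted_telescope R (fun t => t.+1%:R `^ th1) d d'
   (fun t => xi t - xi t.+1) (4 * Rad ^+ 2) T T1.
move=> tel; apply: le_trans (ler_wpM2l B0 (tel _ _ _ _)) _.
- move=> t t1; rewrite powR_ge0 /= ge0_ler_powR ?nnegrE ?ler0n ?ler_nat //.
  by case/andP: hth1 => h _; lra.
- by move=> t t1; apply: nrm; [exact: z_norm | exact: yn].
- by move=> t _; exact: dot_ge0.
- move=> t t1; have e0 : 0 <= xi t - xi t.+1.
    rewrite subr_ge0 /xi ler_pM2l // lef_pV2 ?posrE // ge0_ler_powR ?nnegrE ?ler0n ?ler_nat //.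
    by case/andP: th3_01 => /ltW.
  pose z' := z t.+1.
  have -> : d t.+1 = d' t + dot (yy t - yy t.+1) ((z' - yy t) + (z' - yy t.+1)).
    rewrite /d /d' -/z'; move: z' (yy t) (yy t.+1) => c b b'.
    by rewrite !dotE (dotC b c) (dotC b' c) (dotC b' b); ring.
  rewrite lerD2l; apply: le_trans (dot_le_enorm _ _) _.
  have -> : yy t - yy t.+1 = (- (xi t - xi t.+1)) *: y.
    by rewrite /yy -scalerBl; congr (_ *: _); ring.
  rewrite enormZ normrN ger0_norm //.
  have yR : enorm y <= Rad by exact: Xout.
  have zR : enorm ((z' - yy t) + (z' - yy t.+1)) <= 4 * Rad.
    apply: le_trans (enormD _ _) _; have := enormB z' (yy t); have := enormB z' (yy t.+1).
    have := yn t t1; have := yn t.+1 isT; have := z_norm (ltn0Sn t); rewrite -/z'; lra.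
  rewrite -mulrA [4 * _ * _]mulrC ler_wpM2l //.
  apply: le_trans (ler_pM (enorm_ge0 _) (enorm_ge0 _) yR zR) _.
  by rewrite expr2 le_eqVlt; apply/orP; left; apply/eqP; ring.
have dr := @weighted_drift R T th1 T1.
have -> : 44 / 3 * A2 * T%:R `^ th1 = B * (4 * Rad ^+ 2 * (11 / 6 * T%:R `^ th1)).
  by rewrite /A2 /B; field; rewrite gt_eqF.
rewrite ler_wpM2l // ler_wpM2l ?mulr_ge0 ?exprn_ge0 ?(ltW Rad0) //.
have := dr _; rewrite -hth3 => /(_ _)/(le_trans _); apply; last first.
  by case/andP: hth1 => /ltW -> ->.
rewrite lerD2l le_eqVlt; apply/orP; left; apply/eqP.
by apply: eq_bigr => t _; rewrite /xi !powRN !mul1r.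
Qed.

Let A2_gt0 : 0 < A2.
Proof. by rewrite /A2 !(mulr_gt0, exprn_gt0, invr_gt0). Qed.

Let pT_gt0 : 0 < T%:R `^ th1 :> R.
Proof. by rewrite powR_gt0 // ltr0n. Qed.

Let weight_gt0 : 0 < noise_weight.
Proof.
rewrite /noise_weight; apply: mulr_gt0; first by lra.
by rewrite divr_gt0 ?exprn_gt0 // !mulr_gt0 ?exprn_gt0.
Qed.

(** The comparator is chosen after the noise; the noise can only be exploited
    through its weighted sum. *)
Lemma noise_against_comparator y : X y ->
  \sum_(1 <= t < T.+1) dot (a t - v t) ((1 - xi t) *: y)
  <= 28 / 3 * A2 * T%:R `^ th1
     + noise_weight * dot (noise_sum (fun t => 1 - xi t) a v T.+1)
                          (noise_sum (fun t => 1 - xi t) a v T.+1).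
Proof.
move=> Xy; set M := noise_sum _ _ _ _.
have -> : \sum_(1 <= t < T.+1) dot (a t - v t) ((1 - xi t) *: y) = dot M y.
  rewrite /M /noise_sum dot_suml; apply: eq_bigr => t _.
  by rewrite dotZl dotZr.
apply: le_trans (dot_le_enorm _ _) _; rewrite -sqr_enorm.
have := enorm_ge0 M; set mu := enorm M => mu0.
have yR : enorm y <= Rad by exact: Xout.
apply: (@le_trans _ _ (mu * Rad)); first by rewrite ler_wpM2l.
set Pp := 28 / 3 * A2 * T%:R `^ th1.
have P0 : 0 < Pp by rewrite /Pp; apply: mulr_gt0 => //; apply: mulr_gt0.
have PK : Pp * noise_weight = Rad ^+ 2 / 4.
  by rewrite /Pp /noise_weight /A2; field; rewrite !gt_eqF.
rewrite -(ler_pM2l P0) mulrDr [Pp * (noise_weight * _)]mulrA PK.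
have := sqr_ge0 (Pp - Rad * mu / 2); rewrite !expr2; lra.
Qed.

Let phi_sqr t : (1 <= t)%N ->
  phi t (x t) ^+ 2 <= 7 / 5 * Ff ^+ 2 + 7 / 2 * (m%:R * Fg ^+ 2) * dot (s t) (s t).
Proof.
move=> t1; rewrite /phi; set h := dot (g t (x t)) (s t).
have f2 : f t (x t) ^+ 2 <= Ff ^+ 2.
  have fb := f_bound t1 (x_feasible t1).
  by rewrite -(real_normK (num_real (f t (x t)))) ler_pXn2r // nnegrE // ltW.
have h2 : h ^+ 2 <= m%:R * Fg ^+ 2 * dot (s t) (s t).
  apply: (@le_trans _ _ (dot (g t (x t)) (g t (x t)) * dot (s t) (s t))).
    rewrite -(real_normK (num_real h)) -!sqr_enorm -exprMn.
    by rewrite ler_pXn2r ?nnegrE ?mulr_ge0 ?enorm_ge0 // normr_dot.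
  rewrite ler_wpM2r ?dot_ge0 //; apply: enorm_le_coord => [|j]; first exact: ltW Fg0.
  by apply: g_bound => //; exact: x_feasible.
(* the weights 7/5 and 7/2 have inverses that add up to 1 *)
have := sqr_ge0 (2 / 5 * f t (x t) - h); move: f2 h2; rewrite !expr2; lra.
Qed.

(** The estimate has norm [k / delta * |phi|]; the shrinkage exponent is such that
    the step size over [delta ^+ 2] is of order [t `^ (th1 - 1)]. The step
    contributes 1/8 and the noise sum 3/56; with
    the weights 7/5 and 7/2 of the loss and of the constraints the total 5/28
    becomes 1/4 and 5/8. *)
Lemma second_moment t : (1 <= t <= T)%N ->
  (al t.+1 / 2 + noise_weight * (1 - xi t) ^+ 2) * dot (a t) (a t)
  <= t.+1%:R `^ (th1 - 1) * (Ff ^+ 2 / (4 * m%:R * Fg ^+ 2) + 5 / 8 * dot (s t) (s t)).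
Proof.
move=> /andP[t1 tT].
have aa : dot (a t) (a t) = (k%:R / de t) ^+ 2 * phi t (x t) ^+ 2.
  by rewrite aE // dotZl dotZr -sqr_enorm u1 // expr1n mulr1 -expr2 exprMn.
set D : R := t.+1%:R `^ th3; set Q : R := t.+1%:R `^ th1.
set e : R := t.+1%:R `^ (th1 - 1).
have D0 : 0 < D by exact: p3_gt0.
have Q0 : 0 < Q by exact: p1_gt0.
have DQ : D ^+ 2 = e * Q.
  rewrite /D /Q /e -powRD ?pnatr_eq0 ?implybT // expr2 -powRD ?pnatr_eq0 ?implybT //.
  by congr (_ `^ _); rewrite hth3; field.
have e0 : 0 <= e by exact: powR_ge0.
have QT : Q <= 2 * T%:R `^ th1.
  by apply: powR_natS_double => //; case/andP: hth1 => h1 h2; apply/andP; split; lra.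
have c2 : (1 - xi t) ^+ 2 <= 1.
  have /andP[x0 x1] := shrinkage_range t1.
  by rewrite expr_le1 // ?subr_ge0 ?(ltW x1) // gerBl ltW.
have w1 : noise_weight * (k%:R / de t) ^+ 2 <= 3 / 56 * e / (m%:R * Fg ^+ 2).
  have -> : noise_weight * (k%:R / de t) ^+ 2
     = 3 / 112 * (e * Q) / (m%:R * Fg ^+ 2 * T%:R `^ th1).
    by rewrite -DQ /noise_weight /de -/D; field; rewrite !gt_eqF.
  rewrite ler_pdivrMr; last by rewrite !mulr_gt0 // exprn_gt0.
  have -> : 3 / 56 * e / (m%:R * Fg ^+ 2) * (m%:R * Fg ^+ 2 * T%:R `^ th1)
     = 3 / 112 * (e * (2 * T%:R `^ th1)) by field; rewrite !gt_eqF.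
  by rewrite ler_pM2l ?ler_wpM2l //; lra.
have w2 : al t.+1 / 2 * (k%:R / de t) ^+ 2 = e / (8 * m%:R * Fg ^+ 2).
  rewrite /al /de -/D -/Q.
  have -> : e = D ^+ 2 / Q by rewrite DQ mulfK // gt_eqF.
  by field; rewrite !gt_eqF.
have wc : (al t.+1 / 2 + noise_weight * (1 - xi t) ^+ 2) * (k%:R / de t) ^+ 2
    <= 5 / 28 * e / (m%:R * Fg ^+ 2).
  rewrite mulrDl w2.
  have : noise_weight * (1 - xi t) ^+ 2 * (k%:R / de t) ^+ 2
      <= noise_weight * (k%:R / de t) ^+ 2.
    by rewrite ler_wpM2r ?sqr_ge0 // ler_piMr // ltW.
  have -> : e / (8 * m%:R * Fg ^+ 2) = 1 / 8 * e / (m%:R * Fg ^+ 2).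
    by field; rewrite !gt_eqF.
  move: w1; lra.
rewrite aa mulrA; apply: le_trans (ler_wpM2r (sqr_ge0 _) wc) _.
have c0 : 0 <= 5 / 28 * e / (m%:R * Fg ^+ 2).
  by rewrite divr_ge0 ?mulr_ge0 ?exprn_ge0 ?(ltW Fg0) //; lra.
apply: le_trans (ler_wpM2l c0 (phi_sqr t1)) _.
by rewrite le_eqVlt; apply/orP; left; apply/eqP; field; rewrite !gt_eqF.
Qed.

(** Moving from [x] to [z] costs [delta], the comparison of [v] with a slope costs
    [delta] again, and shrinking the comparator costs [xi * Rad]. *)
Lemma round_regret t y : (1 <= t)%N -> X y ->
  phi t (x t) - phi t y
  <= dot (v t) (z t - (1 - xi t) *: y) + slope t * ((2 * r + Rad) / t.+1%:R `^ th3).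
Proof.
move=> t1 Xy; have /andP[x0 x1] := shrinkage_range t1.
have zX : X (z t).
  by have := decision_feasible (b := 0) t1; rewrite scaler0 addr0 enorm0; apply.
have h1 := phi_lip t1 (x_feasible t1) zX.
have h2 := phi_lip t1 (shrunk_feasible t1 Xy) Xy.
have h3 := vP t1 Xy.
have d0 : 0 < de t by rewrite /de divr_gt0.
have e1 : enorm (x t - z t) = de t.
  by rewrite xE // addrAC subrr add0r enormZ u1 // mulr1 gtr0_norm.
have e2 : enorm ((1 - xi t) *: y - y) <= xi t * Rad.
  have -> : (1 - xi t) *: y - y = (- xi t) *: y.
    by rewrite scalerBl scale1r addrAC subrr add0r scaleNr.
  by rewrite enormZ normrN gtr0_norm // ler_pM2l //; exact: Xout.
rewrite e1 in h1; have h4 := ler_wpM2l (slope_ge0 t1) e2.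
have -> : (2 * r + Rad) / t.+1%:R `^ th3 = 2 * de t + xi t * Rad.
  by rewrite /de /xi; field; rewrite gt_eqF.
lra.
Qed.

Lemma learner_regret y : X y ->
  \sum_(1 <= t < T.+1) (phi t (x t) - phi t y)
  <= 24 * A2 * T%:R `^ th1
   + \sum_(1 <= t < T.+1) t.+1%:R `^ (th1 - 1)
       * (Ff ^+ 2 / (4 * m%:R * Fg ^+ 2) + 5 / 8 * dot (s t) (s t))
   + \sum_(1 <= t < T.+1) slope t * ((2 * r + Rad) / t.+1%:R `^ th3)
   + \sum_(1 <= t < T.+1) dot (noise_direction t) (a t - v t).
Proof.
move=> Xy.
have h1 : \sum_(1 <= t < T.+1) (phi t (x t) - phi t y) <=
   \sum_(1 <= t < T.+1) dot (v t) (z t - (1 - xi t) *: y)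
   + \sum_(1 <= t < T.+1) slope t * ((2 * r + Rad) / t.+1%:R `^ th3).
  by rewrite -big_split /= big_nat [leRHS]big_nat; apply: ler_sum => t /andP[t1 _]; exact: round_regret.
apply: le_trans h1 _.
have -> : \sum_(1 <= t < T.+1) dot (v t) (z t - (1 - xi t) *: y)
  = \sum_(1 <= t < T.+1) dot (a t) (z t - (1 - xi t) *: y)
    + \sum_(1 <= t < T.+1) dot (a t - v t) ((1 - xi t) *: y)
    - \sum_(1 <= t < T.+1) dot (a t - v t) (z t).
  rewrite -sumrN -!big_split /=; apply: eq_bigr => t _.
  by rewrite !(dotBl, dotBr); ring.
have h2 := descent_sum Xy; have h3 := noise_against_comparator Xy.
have h4 := sqr_norm_noise_sum (fun t => 1 - xi t) a v T.
have {}h4 := ler_wpM2l (ltW weight_gt0) h4.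
have h5 : \sum_(1 <= t < T.+1) (al t.+1 / 2 + noise_weight * (1 - xi t) ^+ 2) * dot (a t) (a t)
  <= \sum_(1 <= t < T.+1) t.+1%:R `^ (th1 - 1)
       * (Ff ^+ 2 / (4 * m%:R * Fg ^+ 2) + 5 / 8 * dot (s t) (s t)).
  by rewrite big_nat [leRHS]big_nat; apply: ler_sum => t tT; exact: second_moment.
have E1 : \sum_(1 <= t < T.+1) (al t.+1 / 2 + noise_weight * (1 - xi t) ^+ 2) * dot (a t) (a t)
  = \sum_(1 <= t < T.+1) al t.+1 / 2 * dot (a t) (a t)
    + noise_weight * \sum_(1 <= t < T.+1) (1 - xi t) ^+ 2 * dot (a t) (a t).
  by rewrite mulr_sumr -big_split /=; apply: eq_bigr => t _; ring.
have E2 : \sum_(1 <= t < T.+1) dot (noise_direction t) (a t - v t)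
  = noise_weight * (\sum_(1 <= t < T.+1)
      dot ((2 * (1 - xi t)) *: noise_sum (fun t => 1 - xi t) a v t
           - (2 * (1 - xi t) ^+ 2) *: v t) (a t - v t))
    - \sum_(1 <= t < T.+1) dot (a t - v t) (z t).
  rewrite mulr_sumr -sumrN -big_split /=; apply: eq_bigr => t _.
  by rewrite /noise_direction [LHS]dotBl dotZl (dotC (z t)).
rewrite mulrDr in h4; move: h2 h3 h4 h5; rewrite E1 E2; lra.
Qed.

End Learner.

(** * The pathwise primal-dual inequality *)

Section Play.
Context {R : realType} {n m : nat} (p : 'I_n -> nat).
Hypotheses (n_gt0 : (0 < n)%N) (m_gt0 : (0 < m)%N) (p_gt0 : forall i, (0 < p i)%N).
Variables (E : nat -> rel 'I_n) (W : nat -> 'M[R]_n) (w : R) (iota : nat).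
Unset Implicit Arguments.
Variables (X : forall i : 'I_n, set 'cV[R]_(p i)) (r Rad Ff Fg Gf Gg : 'I_n -> R).
Variables (f : @losses R n p) (g : @constraints R n m p) (u z x : @play R n p).
Set Implicit Arguments.
Variables (q : 'I_n -> nat -> 'cV[R]_m) (th1 th2 th3 : R).
Hypotheses (mixW : mixing E W) (hA : assumption_network E W w iota)
  (hX : assumption_sets X r Rad)
  (hfg : assumption_functions X f g Ff Fg Gf Gg)
  (hth1 : 3 / 4 < th1 <= 5 / 6) (hth2 : th2 = 2 * th1 - 3 / 2)
  (hth3 : th3 = th1 - 1 / 2).

Let delta (i : 'I_n) (t : nat) : R := r i / t.+1%:R `^ th3.

Hypothesis halg : algorithm1 p X W
  (fun i t => r i ^+ 2 / (4 * m%:R * (p i)%:R ^+ 2 * Fg i ^+ 2 * t%:R `^ th1))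
  (fun _ t => 2 / t%:R `^ th2)
  (fun _ t => 1 / t%:R `^ (1 - th2))
  (fun _ t => 1 / t.+1%:R `^ th3)
  (fun i t => r i / t.+1%:R `^ th3) f g u z x q.
Hypothesis u1 : forall i t, (1 <= t)%N -> enorm (u i t) = 1.

Let xE i t : (1 <= t)%N -> x i t = z i t + delta i t *: u i t.
Proof. by case: halg => _ _ _ h _; exact: h. Qed.

Let z1 i : shrink (1 / 2%:R `^ th3) (X i) (z i 1%N).
Proof. by case: halg. Qed.

Let q1 i : q i 1%N = 0.
Proof. by case: halg. Qed.

(** The one-point estimators of the losses and of the constraints, weighted by
    the dual variables, add up to the estimator of this Lagrangian. *)
Definition lagrangian (i : 'I_n) (t : nat) (y : 'cV[R]_(p i)) : R :=
  f i t y + dot (g i t y) (qtilde W q i t.+1).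

Definition lagrangian_slope (i : 'I_n) (t : nat) : R :=
  Gf i + Gg i * \sum_j qtilde W q i t.+1 j 0.

Let a i t := direction p W delta f g u z q i t.+1.

Let th2_01 : 0 < th2 <= 1 / 6.
Proof. by case/andP: hth1 => h1 h2; rewrite hth2; apply/andP; split; lra. Qed.

Lemma Fgmax_ge i : Fg i <= Fgmax Fg.
Proof. exact: le_bigmax. Qed.

Lemma Fgmax_ge0 : 0 <= Fgmax Fg.
Proof. exact: bigmax_ge_id. Qed.

Lemma directionE i t : (1 <= t)%N ->
  a i t = ((p i)%:R / delta i t * lagrangian t (x i t)) *: u i t.
Proof.
move=> t1; rewrite /a /direction /est_grad_f /est_grad_g /= /lagrangian xE //.
rewrite mulrDr scalerDl; congr (_ + _).
set G := g i t _; apply/matrixP => l k; rewrite (ord1 k) !mxE /dot.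
rewrite mulr_sumr mulr_suml; apply: eq_bigr => j _.
by rewrite !mxE big_ord_recl big_ord0 addr0 !mxE; ring.
Qed.

Let zS i t : (1 <= t)%N ->
  z i t.+1 = eproj (shrink (1 / t.+2%:R `^ th3) (X i))
    (z i t - (r i ^+ 2 / (4 * m%:R * (p i)%:R ^+ 2 * Fg i ^+ 2 * t.+1%:R `^ th1)) *: a i t).
Proof. by case: halg => _ _ h _ _ t1; rewrite h. Qed.

Let qS i t : (1 <= t)%N ->
  q i t.+1 = pos_part ((1 - 2 / t.+1%:R `^ th2 * (1 / t.+1%:R `^ (1 - th2)))
                         *: qtilde W q i t.+1
                       + (1 / t.+1%:R `^ (1 - th2)) *: g i t (x i t)).
Proof. by case: halg => _ _ _ _ h t1; rewrite h. Qed.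

Lemma center_in_ball i t b : (1 <= t)%N -> enorm b <= 1 -> X i (z i t + delta i t *: b).
Proof.
have [r0 _] := set_radii hX i; move=> t1 b1.
exact: (decision_feasible r0 (set_convex hX (i:=i)) (set_closed hX (i:=i))
  (@set_inner_ball _ _ _ _ _ _ hX i) (@set_outer_ball _ _ _ _ _ _ hX i)
  hth1 hth3 (z1 i) (zS i) t1 b1).
Qed.

Lemma played_feasible i t : (1 <= t)%N -> X i (x i t).
Proof. by move=> t1; rewrite xE //; apply: center_in_ball; rewrite ?u1. Qed.

Lemma observed_bound i t j : (1 <= t)%N -> `|g i t (x i t) j 0| <= Fgmax Fg.
Proof.
move=> t1; apply: le_trans (Fgmax_ge i).
by apply: (constraint_bound hfg) => //; exact: played_feasible.
Qed.

Lemma qtilde_bounds i t j : (1 <= t)%N ->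
  0 <= qtilde W q i t.+1 j 0 <= Fgmax Fg / 2 * t%:R `^ th2.
Proof.
move=> t1; exact: (mixed_dual_bounds hA Fgmax_ge0 th2_01 observed_bound q1 qS t1).
Qed.

Lemma lagrangian_lipschitz i t : (1 <= t)%N ->
  lipschitz_on (X i) (lagrangian_slope i t) (lagrangian t).
Proof.
move=> t1 y y' Xy Xy'; rewrite /lagrangian /lagrangian_slope opprD addrACA mulrDl.
have lf := gradient_lipschitz (set_convex hX (i:=i)) (loss_convex hfg (i:=i) t1)
  (fun y0 Xy0 => loss_gradient hfg t1 Xy0).
apply: lerD; first exact: lf.
rewrite -dotBl mulr_sumr mulr_suml; apply: ler_sum => j _.
have lg := gradient_lipschitz (set_convex hX (i:=i)) (constraint_convex hfg (i:=i) j t1)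
  (fun y0 Xy0 => constraint_gradient hfg j t1 Xy0).
have /andP[s0 _] := qtilde_bounds i j t1.
by rewrite !mxE mulrAC ler_wpM2r // lg.
Qed.

Lemma lagrangian_convex i t : (1 <= t)%N -> convex_function (X i) (lagrangian (i:=i) t).
Proof.
move=> t1; apply: convex_functionI => y y' l Xy Xy' l01; rewrite /lagrangian.
have hf := convex_functionE (loss_convex hfg (i:=i) t1) Xy Xy' l01.
have hg j := convex_functionE (constraint_convex hfg (i:=i) j t1) Xy Xy' l01.
apply: (@le_trans _ _ (l * f i t y + (1 - l) * f i t y'
  + (l * dot (g i t y) (qtilde W q i t.+1)
     + (1 - l) * dot (g i t y') (qtilde W q i t.+1)))); last first.
  by rewrite le_eqVlt; apply/orP; left; apply/eqP; ring.
apply: lerD; first exact: hf.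
rewrite /dot !mulr_sumr -big_split; apply: ler_sum => j _ /=.
have /andP[s0 _] := qtilde_bounds i j t1.
by rewrite !mulrA -mulrDl ler_wpM2r // hg.
Qed.

Unset Implicit Arguments.
Variables (v : @play R n p) (T : nat).
Set Implicit Arguments.
Hypothesis T1 : (1 <= T)%N.
Hypothesis vP : forall i t y, (1 <= t)%N -> X i y ->
  lagrangian t (z i t) - lagrangian t ((1 - 1 / t.+1%:R `^ th3) *: y)
    - lagrangian_slope i t * (r i / t.+1%:R `^ th3)
  <= dot (v i t) (z i t - (1 - 1 / t.+1%:R `^ th3) *: y).

Let noise_term i t :=
  dot (@noise_direction R (p i) m (r i) (Fg i) th1 th3 (z i) (a i) (v i) T t) (a i t - v i t).

Let s i t := qtilde W q i t.+1.

(** The squared dual variables left on the right are to be paid for by the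
    regularisation in the dual update. *)
Lemma learner_budget i y : X i y ->
  \sum_(1 <= t < T.+1) (lagrangian t (x i t) - lagrangian t y)
  <= (m%:R * Fgmax Fg * Gg i * (2 * r i + Rad i) / (1 - th3 + th2)
     + Gf i * (2 * r i + Rad i) / (1 - th3)
     + 8 * m%:R * (p i)%:R ^+ 2 * Fg i ^+ 2 * Rad i ^+ 2 / r i ^+ 2
     + Ff i ^+ 2 / (4 * m%:R * Fg i ^+ 2 * (1 - th1 + 2 * th3))
     + 16 * m%:R * (p i)%:R ^+ 2 * Fg i ^+ 2 * Rad i ^+ 2 / r i ^+ 2) * T%:R `^ th1
   + \sum_(1 <= t < T.+1) 5 / 8 / t.+1%:R `^ th2 * dot (s i t) (s i t)
   + \sum_(1 <= t < T.+1) noise_term i t.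
Proof.
move=> Xy; have [r0 Rad0] := set_radii hX i.
have [Ff0 Fg0 Gf0 Gg0] := fun_consts hfg i.
case/andP: (hth1) => h1 h2.
have mp : 0 < m%:R :> R by rewrite ltr0n.
have := learner_regret (p_gt0 i) m_gt0 r0 Rad0 Ff0 Fg0 Gf0 Gg0
  (set_convex hX (i:=i)) (set_closed hX (i:=i))
  (@set_inner_ball _ _ _ _ _ _ hX i) (@set_outer_ball _ _ _ _ _ _ hX i) hth1 hth3
  T1 (z1 i) (zS i) (xE i) (u1 i) (@directionE i)
  (fun t j => @qtilde_bounds i t j) (fun t y0 => @loss_bound _ _ _ _ _ _ _ _ _ _ _ hfg i t y0)
  (fun t y0 j => @constraint_bound _ _ _ _ _ _ _ _ _ _ _ hfg i t j y0)
  (@lagrangian_lipschitz i) (fun t y0 => @vP i t y0) Xy.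
move/le_trans; apply; rewrite -/(noise_term i _).
rewrite lerD2r.
have e1 : th1 - 1 = th1 - 1 by [].
have th1_01 : 0 < th1 <= 1 by apply/andP; split; lra.
have th3_01 : 0 < 1 - th3 <= 1 by rewrite hth3; apply/andP; split; lra.
have S1 := sum_powR T1 th1_01; have S3 := sum_powR T1 th3_01.
have E3 : 1 - th3 - 1 = - th3 by ring.
rewrite E3 in S3.
have T31 : T%:R `^ (1 - th3) <= T%:R `^ th1 by rewrite ler_powR ?ler1n // hth3; lra.
have second : \sum_(1 <= t < T.+1) t.+1%:R `^ (th1 - 1)
     * (Ff i ^+ 2 / (4 * m%:R * Fg i ^+ 2) + 5 / 8 * dot (s i t) (s i t))
  <= Ff i ^+ 2 / (4 * m%:R * Fg i ^+ 2 * (1 - th1 + 2 * th3)) * T%:R `^ th1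
     + \sum_(1 <= t < T.+1) 5 / 8 / t.+1%:R `^ th2 * dot (s i t) (s i t).
  have -> : 1 - th1 + 2 * th3 = th1 by rewrite hth3; field.
  have B0 : 0 <= Ff i ^+ 2 / (4 * m%:R * Fg i ^+ 2).
    by rewrite divr_ge0 ?exprn_ge0 ?mulr_ge0 ?exprn_ge0 ?ler0n ?(ltW Fg0) ?(ltW Ff0).
  have -> : Ff i ^+ 2 / (4 * m%:R * Fg i ^+ 2 * th1) * T%:R `^ th1
      = Ff i ^+ 2 / (4 * m%:R * Fg i ^+ 2) * (T%:R `^ th1 / th1).
    by field; rewrite !gt_eqF //; lra.
  apply: le_trans (lerD (ler_wpM2l B0 S1) (lexx _)).
  rewrite mulr_sumr -big_split /=; apply: ler_sum => t _.
  rewrite mulrDr [X in X + _ <= _]mulrC lerD2l mulrA ler_wpM2r ?dot_ge0 //.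
  rewrite mulrC ler_pM2l; last by lra.
  rewrite -powRN ler_powR ?ler1n // hth2; lra.
have errs : \sum_(1 <= t < T.+1) lagrangian_slope i t * ((2 * r i + Rad i) / t.+1%:R `^ th3)
  <= (m%:R * Fgmax Fg * Gg i * (2 * r i + Rad i) / (1 - th3 + th2)
     + Gf i * (2 * r i + Rad i) / (1 - th3)) * T%:R `^ th1.
  have -> : 1 - th3 + th2 = th1 by rewrite hth3 hth2; field.
  have K0 : 0 <= 2 * r i + Rad i by lra.
  have term t : (1 <= t)%N -> lagrangian_slope i t * ((2 * r i + Rad i) / t.+1%:R `^ th3)
    <= m%:R * Fgmax Fg * Gg i * (2 * r i + Rad i) * t.+1%:R `^ (th1 - 1)
       + Gf i * (2 * r i + Rad i) * t.+1%:R `^ (- th3).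
    move=> t1; rewrite /lagrangian_slope powRN mulrDl addrC.
    apply: lerD; last by rewrite mulrA.
    have : \sum_j qtilde W q i t.+1 j 0 <= m%:R * (Fgmax Fg * t.+1%:R `^ th2).
      rewrite mulr_natl -[X in _ *+ X]card_ord -sumr_const; apply: ler_sum => j _.
      have /andP[_ /le_trans] := qtilde_bounds i j t1; apply.
      apply: ler_pM; rewrite ?divr_ge0 ?Fgmax_ge0 ?powR_ge0 //.
        by have := Fgmax_ge0; lra.
      rewrite ge0_ler_powR ?nnegrE ?ler0n ?ler_nat //.
      by case/andP: th2_01 => /ltW.
    set S := \sum_j _ => hS.
    have D0 : 0 <= Gg i * ((2 * r i + Rad i) / t.+1%:R `^ th3).
      by rewrite mulr_ge0 ?divr_ge0 ?powR_ge0 // ltW.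
    have := ler_wpM2l D0 hS.
    have -> : Gg i * ((2 * r i + Rad i) / t.+1%:R `^ th3) * (m%:R * (Fgmax Fg * t.+1%:R `^ th2))
      = m%:R * Fgmax Fg * Gg i * (2 * r i + Rad i) * t.+1%:R `^ (th1 - 1).
      have -> : th1 - 1 = th2 - th3 by rewrite hth2 hth3; field.
      by rewrite powRB ?pnatr_eq0 ?implybT //; ring.
    by move/(le_trans _); apply; rewrite le_eqVlt; apply/orP; left; apply/eqP; ring.
  have c1 : 0 <= m%:R * Fgmax Fg * Gg i * (2 * r i + Rad i).
    by rewrite !mulr_ge0 ?ler0n ?Fgmax_ge0 ?(ltW Gg0).
  have c2 : 0 <= Gf i * (2 * r i + Rad i) by rewrite mulr_ge0 ?(ltW Gf0).
  apply: (@le_trans _ _ (m%:R * Fgmax Fg * Gg i * (2 * r i + Rad i) * (T%:R `^ th1 / th1)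
     + Gf i * (2 * r i + Rad i) * (T%:R `^ (1 - th3) / (1 - th3)))).
    apply: le_trans (lerD (ler_wpM2l c1 S1) (ler_wpM2l c2 S3)).
    rewrite !mulr_sumr -big_split /= big_nat [leRHS]big_nat; apply: ler_sum => t /andP[t1 _].
    exact: term.
  have i3 : 0 <= (1 - th3)^-1 by rewrite invr_ge0; lra.
  have := ler_wpM2l c2 (ler_wpM2r i3 T31); lra.
have -> : forall A B C D H : R, (A + B + C + D + H) * T%:R `^ th1
   = (A + B) * T%:R `^ th1 + D * T%:R `^ th1 + (C + H) * T%:R `^ th1 by move=> *; ring.
set M := \sum_(1 <= t < T.+1) 5 / 8 / _ * _ in second *.
have -> : 8 * m%:R * (p i)%:R ^+ 2 * Fg i ^+ 2 * Rad i ^+ 2 / r i ^+ 2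
   + 16 * m%:R * (p i)%:R ^+ 2 * Fg i ^+ 2 * Rad i ^+ 2 / r i ^+ 2
   = 24 * (m%:R * (p i)%:R ^+ 2 * Fg i ^+ 2 * Rad i ^+ 2 / r i ^+ 2) by ring.
move: second errs; lra.
Qed.

(** Pathwise primal-dual inequality: against every fixed feasible comparator, the
    regret and the dual potential are paid for by the constant, up to noise
    terms in which the direction is known before the perturbation is drawn. *)
Theorem pathwise_regret y : static_feasible X g T y ->
  Reg f T x (constant_play y) + dual_potential W q th2 T
  <= C1 m p r Rad Ff Fg Gf Gg w iota th1 th2 th3 * T%:R `^ th1
     + \sum_i \sum_(1 <= t < T.+1) noise_term i t.
Proof.
move=> fy.
have Xy i : X i (y i) by have [h _] := fy T (introT andP (conj T1 (leqnn T))); exact: h.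
pose F := Fgmax Fg.
have feasd := @feasible_dual_sum _ _ _ E W w iota n_gt0 mixW hA q (fun i t => g i t (x i t)) F th2
  Fgmax_ge0 th2_01 observed_bound q1 qS (fun i t => g i t (y i)) T.
have {}feasd : \sum_(1 <= t < T.+1) \sum_i dot (g i t (y i)) (s i t)
  <= 4 * m%:R * n%:R * F ^+ 2 * tau n w / (1 - lambda n w iota)
     * \sum_(1 <= t < T.+1) (t.+1%:R `^ (1 - th2))^-1.
  apply: feasd => [i t j /andP[t1 _]|t j tT].
    by apply: le_trans (Fgmax_ge i); apply: (constraint_bound hfg).
  by have [_ h] := fy t tT; have := h j; rewrite /total_constraint summxE.
have duals := @dual_sum _ _ _ E W w iota hA q (fun i t => g i t (x i t)) F th2
  Fgmax_ge0 th2_01 observed_bound q1 qS T.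
rewrite -/(s _ _) in duals.
have regE : Reg f T x (constant_play y)
   = \sum_i \sum_(1 <= t < T.+1) (lagrangian t (x i t) - lagrangian t (y i))
     + \sum_(1 <= t < T.+1) \sum_i - dot (g i t (x i t)) (s i t)
     + \sum_(1 <= t < T.+1) \sum_i dot (g i t (y i)) (s i t).
  rewrite /Reg [X in _ = X + _ + _]exchange_big /= -sumrB -!big_split /=.
  apply: eq_bigr => t _; rewrite /total_loss /at_round /constant_play.
  rewrite -sumrB -!big_split /=.
  by apply: eq_bigr => i _; rewrite /lagrangian -/(s i t); ring.
have learners : \sum_i \sum_(1 <= t < T.+1) (lagrangian t (x i t) - lagrangian t (y i))
   <= (C1 m p r Rad Ff Fg Gf Gg w iota th1 th2 th3 - C0 m Fg w iota / th2) * T%:R `^ th1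
    + \sum_(1 <= t < T.+1) \sum_i 5 / 8 / t.+1%:R `^ th2 * dot (s i t) (s i t)
    + \sum_i \sum_(1 <= t < T.+1) noise_term i t.
  apply: le_trans (ler_sum _ (fun i _ => learner_budget (Xy i))) _.
  by rewrite !big_split /= -mulr_suml /C1 addrK exchange_big.
set G := \sum_(1 <= t < T.+1) (t.+1%:R `^ (1 - th2))^-1 in feasd duals.
have /andP[t20 t21] := th2_01.
have GT : G <= T%:R `^ th2 / th2.
  have b : 0 < th2 <= 1 by apply/andP; split; lra.
  apply: le_trans (sum_powR T1 b); rewrite le_eqVlt; apply/orP; left; apply/eqP.
  by apply: eq_bigr => t _; rewrite -powRN opprB.
have T21 : T%:R `^ th2 <= T%:R `^ th1.
  by case/andP: hth1 => h1 h2; rewrite ler_powR ?ler1n // hth2; lra.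
have G0 : 0 <= G by apply: sumr_ge0 => t _; rewrite invr_ge0 powR_ge0.
have TG : G <= T%:R `^ th1 / th2.
  by apply: le_trans GT _; rewrite ler_pM2r ?invr_gt0.
have np : 1 <= n%:R :> R by rewrite ler1n.
have tl0 := disagreement_constant_ge0 n_gt0 hA.
have C0G : 4 * m%:R * n%:R * F ^+ 2 * tau n w / (1 - lambda n w iota) * G
    + 2 * m%:R * n%:R * F ^+ 2 * G <= C0 m Fg w iota / th2 * T%:R `^ th1.
  have -> : C0 m Fg w iota / th2 * T%:R `^ th1 = C0 m Fg w iota * (T%:R `^ th1 / th2) by ring.
  set U := T%:R `^ th1 / th2 in TG *.
  have mF : 0 <= m%:R * n%:R * F ^+ 2 by rewrite !mulr_ge0 ?ler0n ?exprn_ge0 // Fgmax_ge0.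
  have h1 : 2 * (m%:R * n%:R * F ^+ 2) * G <= 2 * (m%:R * n%:R * F ^+ 2) * U.
    by rewrite ler_wpM2l // mulr_ge0.
  have U0 : 0 <= U by exact: le_trans TG.
  set L := tau n w / (1 - lambda n w iota) in tl0.
  have h2 : 4 * (m%:R * n%:R * F ^+ 2) * L * G <= 4 * (m%:R * n%:R * F ^+ 2) * L * U.
    by apply: ler_wpM2l => //; apply: mulr_ge0 => //; apply: mulr_ge0.
  have h3 : 4 * (m%:R * n%:R * F ^+ 2) * L * U <= 6 * n%:R * (m%:R * n%:R * F ^+ 2) * L * U.
    by do 3 apply: ler_wpM2r => //; lra.
  rewrite /C0 -/F expr2.
  have -> : 4 * m%:R * n%:R * F ^+ 2 * tau n w / (1 - lambda n w iota) * G
    = 4 * (m%:R * n%:R * F ^+ 2) * L * G by rewrite /L; ring.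
  have -> : (6 * m%:R * (n%:R * n%:R) * (F * F) * tau n w / (1 - lambda n w iota) + 2 * m%:R * n%:R * (F * F)) * U
    = 6 * n%:R * (m%:R * n%:R * F ^+ 2) * L * U + 2 * (m%:R * n%:R * F ^+ 2) * U by rewrite /L; ring.
  lra.
(* 11/8 = 2 - 5/8 is what is left of the regularisation *)
have sumE : \sum_(1 <= t < T.+1) \sum_i
      (11 / 8 / t.+1%:R `^ th2 - (t.+1%:R `^ (1 - th2) - t%:R `^ (1 - th2)) / 2) * dot (s i t) (s i t)
   + \sum_(1 <= t < T.+1) \sum_i 5 / 8 / t.+1%:R `^ th2 * dot (s i t) (s i t)
   + \sum_(1 <= t < T.+1) \sum_i
       ((t.+1%:R `^ (1 - th2) - t%:R `^ (1 - th2)) / 2 - 2 / t.+1%:R `^ th2) * dot (s i t) (s i t) = 0.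
  rewrite -!big_split /=; apply: big1 => t _; rewrite -!big_split /=; apply: big1 => i _.
  by field; rewrite gt_eqF // powR_gt0 // ltr0n.
rewrite regE /dual_potential -/(s _ _).
move: learners duals feasd C0G sumE; lra.
Qed.

Lemma regret_ge y : static_feasible X g T y ->
  - (2 * T%:R * \sum_i Ff i) <= Reg f T x (constant_play y).
Proof.
move=> fy.
have Xy i : X i (y i) by have [h _] := fy T (introT andP (conj T1 (leqnn T))); exact: h.
rewrite /Reg -sumrB.
have -> : - (2 * T%:R * \sum_i Ff i) = \sum_(1 <= t < T.+1) - (2 * \sum_i Ff i).
  by rewrite sumr_const_nat subn1 /= -mulr_natl; ring.
rewrite big_nat [leRHS]big_nat; apply: ler_sum => t /andP[t1 _].
rewrite /total_loss /at_round /constant_play -sumrB mulr_sumr -sumrN; apply: ler_sum => i _.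
have := loss_bound hfg t1 (played_feasible i t1); have := loss_bound hfg t1 (Xy i).
by rewrite !ler_norml => /andP[a1 a2] /andP[b1 b2]; lra.
Qed.

Lemma play_violation (rho : R) : 0 < rho ->
  enorm (pos_part (\sum_(1 <= t < T.+1) total_constraint g t (at_round x t)))
  <= rho * dual_potential W q th2 T
     + n%:R / (2 * rho) * (1 + (1 - th2)^-1) * T%:R `^ (1 - th2).
Proof.
exact: (@violation_le_potential _ _ _ E W w iota hA q (fun i t => g i t (x i t))
  (Fgmax Fg) th2 Fgmax_ge0 th2_01 observed_bound q1 qS T rho T1).
Qed.

End Play.

(** * Bounded functions and independence *)

Section BoundedIntegrals.
Context {R : realType}.

Definition bounded_measurable d (T : measurableType d) (f : T -> R) :=
  measurable_fun setT f /\ exists M, forall x, `|f x| <= M.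

Lemma bounded_measurable_integrable d (T : measurableType d)
    (P : probability T R) (f : T -> R) :
  bounded_measurable f -> P.-integrable setT (EFin \o f).
Proof.
move=> [mf [M fM]]; apply: measurable_bounded_integrable => //.
  by rewrite (le_lt_trans (probability_le1 _ _)) // ltry.
exists M; split; first exact: num_real.
by move=> x Mx y _ /=; apply: le_trans (fM y) _; exact: ltW.
Qed.

Lemma bounded_measurable_cst d (T : measurableType d) (c : R) :
  bounded_measurable (fun _ : T => c).
Proof. by split; [exact: measurable_cst | exists `|c|]. Qed.

Lemma bounded_measurableD d (T : measurableType d) (f g : T -> R) :
  bounded_measurable f -> bounded_measurable g ->
  bounded_measurable (fun x => f x + g x).
Proof.
move=> [mf [M fM]] [mg [N gN]]; split; first exact: measurable_funD.
exists (M + N) => x; apply: le_trans (ler_normD _ _) _; exact: lerD.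
Qed.

Lemma bounded_measurableM d (T : measurableType d) (f g : T -> R) :
  bounded_measurable f -> bounded_measurable g ->
  bounded_measurable (fun x => f x * g x).
Proof.
move=> [mf [M fM]] [mg [N gN]]; split; first exact: measurable_funM.
by exists (M * N) => x; rewrite normrM ler_pM.
Qed.

Lemma bounded_measurableB d (T : measurableType d) (f g : T -> R) :
  bounded_measurable f -> bounded_measurable g ->
  bounded_measurable (fun x => f x - g x).
Proof.
move=> bf bg; have := bounded_measurableD bf (bounded_measurableM (bounded_measurable_cst T (-1)) bg).
by under eq_fun do rewrite mulN1r.
Qed.

Lemma bounded_measurable_sum d (T : measurableType d) (I : Type) (s : seq I)
    (Q : pred I) (F : I -> T -> R) :
  (forall i, Q i -> bounded_measurable (F i)) ->
  bounded_measurable (fun x => \sum_(i <- s | Q i) F i x).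
Proof.
move=> bF; elim: s => [|i s IH].
  by under eq_fun do rewrite big_nil; exact: bounded_measurable_cst.
under eq_fun do rewrite big_cons; case: (boolP (Q i)) => // Qi.
by apply: bounded_measurableD => //; exact: bF.
Qed.

Lemma average_sum d (T : measurableType d) (P : probability T R) (I : Type)
    (s : seq I) (F : I -> T -> R) :
  (forall i, bounded_measurable (F i)) ->
  \int[P]_x (\sum_(i <- s) F i x) = \sum_(i <- s) \int[P]_x F i x.
Proof.
move=> bF; elim: s => [|i s IH].
  by rewrite big_nil; under eq_Rintegral do rewrite big_nil; rewrite Rintegral_cst // mul0r.
rewrite big_cons -IH -RintegralD //; last 2 first.
- exact: bounded_measurable_integrable.
- by apply: bounded_measurable_integrable; exact: bounded_measurable_sum.
by apply: eq_Rintegral => x _; rewrite big_cons.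
Qed.

Lemma bounded_measurable_comp d (T : measurableType d) d' (T' : measurableType d')
    (f : T' -> R) (X : T -> T') :
  measurable_fun setT X -> bounded_measurable f -> bounded_measurable (f \o X).
Proof.
move=> mX [mf [M fM]]; split; first exact: measurableT_comp.
by exists M => x; exact: fM.
Qed.

(** The integral of a function that is not assumed measurable is a difference of
    lower integrals, hence still monotone. *)
Lemma integral_le_dominated d (T : measurableType d) (mu : {measure set T -> \bar R})
    (f g : T -> \bar R) :
  (forall x, (f x <= g x)%E) -> (\int[mu]_x f x <= \int[mu]_x g x)%E.
Proof.
move=> fg; rewrite integralE [leRHS]integralE.
have mono (h k : T -> \bar R) : (forall x, (0 <= h x)%E) -> (forall x, (h x <= k x)%E) ->
    (\int[mu]_x h x <= \int[mu]_x k x)%E.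
  move=> h0 hk; have k0 x : (0 <= k x)%E by exact: le_trans (hk x).
  rewrite !ge0_integralTE //; apply: le_ereal_sup => _ [s sh <-].
  by exists s => // x; exact: le_trans (sh x) (hk x).
apply: leeB; apply: mono => x.
- exact: funepos_ge0.
- by rewrite !funeposE ge_max !le_max lexx fg orbT.
- exact: funeneg_ge0.
- by rewrite !funenegE ge_max !le_max lexx leeN2 fg orbT.
Qed.

(** Independence turns an expectation into an iterated integral: average first
    over the independent variable, the other one being fixed. *)
Lemma independent_average d (T : measurableType d) (P : probability T R)
    d1 (T1 : measurableType d1) d2 (T2 : measurableType d2)
    (X1 : {mfun T >-> T1}) (X2 : {mfun T >-> T2}) (Phi : T1 * T2 -> R) :
  (forall A B, measurable A -> measurable B ->
     P (X1 @^-1` A `&` X2 @^-1` B) = (P (X1 @^-1` A) * P (X2 @^-1` B))%E) ->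
  bounded_measurable Phi ->
  let avg x := \int[distribution P X2]_y Phi (x, y) in
  bounded_measurable avg /\
  \int[P]_x Phi (X1 x, X2 x) = \int[P]_x avg (X1 x).
Proof.
move=> ind bPhi avg; have [mPhi [M PhiM]] := bPhi.
pose P1 : probability T1 R := distribution P X1.
pose P2 : probability T2 R := distribution P X2.
have mX : measurable_fun setT (fun x => (X1 x, X2 x)).
  by apply: measurable_fun_pair; exact: measurable_funP.
pose X12 : {mfun T >-> (T1 * T2)%type} := mfun_Sub (mem_set mX).
have prodE A : measurable A -> (P1 \x P2)%E A = distribution P X12 A.
  by apply: product_measure_unique => A' B' mA mB; rewrite -ind.
have intPhi : (P1 \x P2)%E.-integrable setT (EFin \o Phi).
  exact: (@bounded_measurable_integrable _ _ (P1 \x P2)%E).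
have b2 x : bounded_measurable (fun y => Phi (x, y)).
  split; first exact: (measurable_fun_pair2 (f := Phi)).
  by exists M => y.
have i2 x : P2.-integrable setT (EFin \o (fun y => Phi (x, y))).
  exact: bounded_measurable_integrable.
have avgE x : (avg x)%:E = (\int[P2]_y (Phi (x, y))%:E)%E.
  rewrite /avg /Rintegral fineK //.
  exact: (integrable_fin_num measurableT (i2 x)).
have bavg : bounded_measurable avg.
  split.
    apply/measurable_EFinP; rewrite (_ : EFin \o avg = fubini_F P2 (EFin \o Phi)).
      exact: (measurable_fubini_F (m1 := P1) intPhi).
    by apply/funext => x; rewrite /= avgE.
  exists M => x; rewrite -lee_fin EFin_normr_Rintegral //.
  apply: le_trans (le_abse_integral _ _ _) _ => //.
    by apply/measurable_EFinP; case: (b2 x).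
  apply: le_trans (integral_le_dominated _ (g := fun=> M%:E) _) _.
    by move=> y /=; rewrite lee_fin.
  by rewrite integral_cst // [X in (_ * X)%E](@probability_setT _ _ _ P2) mule1.
split=> //; rewrite /Rintegral; congr fine.
transitivity (\int[distribution P X12]_z (EFin \o Phi) z)%E.
  rewrite integral_pushforward //; [exact/measurable_EFinP|].
  apply: (@bounded_measurable_integrable _ _ P (Phi \o X12)).
  exact: bounded_measurable_comp.
transitivity (\int[(P1 \x P2)%E]_z (EFin \o Phi) z)%E.
  by apply: eq_measure_integral => A mA _; exact/esym/prodE.
rewrite -integral12_prod_meas1 //.
transitivity (\int[P1]_x (EFin \o avg) x)%E.
  by apply: eq_integral => x _; rewrite /= avgE.
have [mavg _] := bavg.
rewrite integral_pushforward //; first exact/measurable_EFinP.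
apply: (@bounded_measurable_integrable _ _ P (avg \o X1)).
by apply: bounded_measurable_comp => //; exact: measurable_funP.
Qed.

End BoundedIntegrals.

(** * Measurability of vector-valued functions *)

Section VectorMeasurability.
Context {R : realType}.

Lemma rational_approximation k (v : 'cV[R]_k) (e : R) : 0 < e ->
  exists c : 'cV[rat]_k, enorm (v - map_mx ratr c) < e.
Proof.
move=> e0; pose e' := e / k.+1%:R; have e'0 : 0 < e' by rewrite divr_gt0 ?ltr0n.
have h j : exists q : rat, `|v j 0 - ratr q| < e'.
  have [|q] := @rat_in_itvoo R (v j 0 - e') (v j 0 + e'); first by lra.
  rewrite in_itv /= => /andP[h1 h2]; exists q; rewrite ltr_norml; apply/andP; split; lra.
exists (\col_j xchoose (h j)).
set y := v - _; have yle j : `|y j 0| <= e' by rewrite !mxE ltW // (xchooseP (h j)).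
have K : k%:R < k.+1%:R :> R by rewrite ltr_nat.
have y_le : enorm y <= k%:R * e'.
  rewrite enorm_le; last by apply: mulr_ge0 => //; exact: ltW.
  apply: le_trans (enorm_le_coord (ltW e'0) yle) _.
  rewrite [leRHS]exprMn ler_wpM2r ?exprn_ge0 ?(ltW e'0) // -natrX ler_nat.
  by case: (k) => // k'; rewrite leq_pmull.
apply: le_lt_trans y_le _.
by rewrite /e' mulrCA gtr_pMr // ltr_pdivrMr ?ltr0n // mul1r.
Qed.

(** Every nonempty set of vectors is separable: pick one of its points in each
    small ball with rational centre that meets it. *)
Lemma dense_sequence k (K : set 'cV[R]_k) : K !=set0 ->
  exists y : nat -> 'cV[R]_k, (forall l, K (y l)) /\
    forall v, K v -> forall e : R, 0 < e -> exists l, enorm (v - y l) < e.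
Proof.
move=> [x0 Kx0].
pose near_pt (c : 'cV[rat]_k * nat) :=
  [set v | K v /\ enorm (v - map_mx ratr c.1) < c.2.+1%:R^-1].
pose pt c := if pselect (near_pt c !=set0) then xget x0 (near_pt c) else x0.
have Kpt c : K (pt c).
  by rewrite /pt; case: pselect => // -[v hv]; case: xgetP => // w _ [].
exists (fun l => if unpickle l is Some c then pt c else x0); split.
  by move=> l; case: unpickle.
move=> v Kv e e0.
have [j je] : exists j : nat, j.+1%:R^-1 < e / 2.
  exists (Num.truncn (e / 2)^-1); rewrite invf_plt ?posrE ?ltr0n ?divr_gt0 //.
  exact: truncnS_gt.
have [c vc] := @rational_approximation _ v j.+1%:R^-1 (ltac:(by rewrite invr_gt0 ltr0n)).
exists (pickle (c, j)); rewrite pickleK /pt; case: pselect => [ne|[]]; last by exists v.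
case: xgetP => [w _ [_ /= wc]|/(_ v)[]//].
have := enormB (v - map_mx ratr c) (w - map_mx ratr c).
by rewrite opprB addrA subrK => h; apply: (le_lt_trans h); apply: (lt_trans (ltrD vc wc)); rewrite [ltRHS]splitr; exact: ltrD.
Qed.

Lemma open_contains_ball k (A : set 'cV[R]_k) v : open A -> A v ->
  exists2 e, 0 < e & forall w, enorm (v - w) < e -> A w.
Proof.
move=> oA Av; have /nbhs_ballP[e /= e0 eA] : nbhs v A by exact: open_nbhs_nbhs.
exists e => // w vw; apply: eA; rewrite -ball_normE /=.
exact: le_lt_trans (sup_enorm _) vw.
Qed.

(** The Borel space of column vectors. *)
Definition borel_space k := g_sigma_algebraType (@open 'cV[R]_k).

Definition coord_measurable d (T : measurableType d) k (F : T -> 'cV[R]_k) :=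
  forall j, measurable_fun setT (fun x => F x j 0).

Lemma continuous_borel_measurable k (h : 'cV[R]_k -> R) : continuous h ->
  measurable_fun setT (h : borel_space k -> R).
Proof.
move=> /continuousP ch; apply: (measurability _ (RGenInftyO.measurableE R)) => //.
move=> _ [_ [c ->] <-]; rewrite setTI; apply: sub_sigma_algebra.
by apply: ch; exact: interval_open.
Qed.

Lemma coord_measurable_id k : @coord_measurable _ (borel_space k) k id.
Proof. by move=> j; apply: (continuous_borel_measurable (h := fun y => y j 0)); exact: coord_continuous. Qed.

Section Coordinates.
Context d (T : measurableType d).

Lemma measurable_lt (h : T -> R) :
  (forall c, measurable [set x | h x < c]) -> measurable_fun setT h.
Proof.
move=> hc; apply: (measurability _ (RGenInftyO.measurableE R)) => //.
move=> _ [_ [c ->] <-]; rewrite setTI.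
rewrite (_ : _ @^-1` _ = [set x | h x < c]) //.
Qed.

Lemma lt_measurable (h : T -> R) c : measurable_fun setT h -> measurable [set x | h x < c].
Proof.
move=> mh; have := mh measurableT [set` `]-oo, c[] (measurable_itv _); rewrite setTI; exact.
Qed.

Lemma coord_measurable_cst k (v : 'cV[R]_k) : coord_measurable (fun _ : T => v).
Proof. by move=> j; exact: measurable_cst. Qed.

Lemma coord_measurableD k (F G : T -> 'cV[R]_k) :
  coord_measurable F -> coord_measurable G -> coord_measurable (fun x => F x + G x).
Proof. by move=> mF mG j; under eq_fun do rewrite mxE; exact: measurable_funD. Qed.

Lemma coord_measurableZ k (h : T -> R) (F : T -> 'cV[R]_k) :
  measurable_fun setT h -> coord_measurable F -> coord_measurable (fun x => h x *: F x).
Proof. by move=> mh mF j; under eq_fun do rewrite mxE; exact: measurable_funM. Qed.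

Lemma coord_measurableB k (F G : T -> 'cV[R]_k) :
  coord_measurable F -> coord_measurable G -> coord_measurable (fun x => F x - G x).
Proof. by move=> mF mG j; under eq_fun do rewrite !mxE; exact: measurable_funB. Qed.

Lemma coord_measurable_sum k (I : Type) (s : seq I) (F : I -> T -> 'cV[R]_k) :
  (forall i, coord_measurable (F i)) -> coord_measurable (fun x => \sum_(i <- s) F i x).
Proof.
move=> mF; elim: s => [|i s IH].
  by under eq_fun do rewrite big_nil; exact: coord_measurable_cst.
by under eq_fun do rewrite big_cons; exact: coord_measurableD.
Qed.

Lemma measurable_dot k (F G : T -> 'cV[R]_k) :
  coord_measurable F -> coord_measurable G -> measurable_fun setT (fun x => dot (F x) (G x)).
Proof. by move=> mF mG; apply: measurable_sum => j; exact: measurable_funM. Qed.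

Lemma measurable_enorm k (F : T -> 'cV[R]_k) :
  coord_measurable F -> measurable_fun setT (fun x => enorm (F x)).
Proof.
move=> mF; apply: measurable_lt => c; have [c0|c0] := ltP 0 c.
  rewrite (_ : [set _ | _] = [set x | dot (F x) (F x) < c ^+ 2]).
    by apply: lt_measurable; exact: measurable_dot.
  apply/seteqP; split=> x /=; rewrite -sqr_enorm ltr_pXn2r ?nnegrE ?enorm_ge0 ?(ltW c0) //.
rewrite (_ : [set _ | _] = set0) //; apply/seteqP; split=> x //=.
by rewrite ltNge (le_trans c0) // enorm_ge0.
Qed.

Lemma coord_measurable_borel k (F : T -> 'cV[R]_k) :
  coord_measurable F -> measurable_fun setT (F : T -> borel_space k).
Proof.
move=> mF; apply: (@measurability _ _ T (borel_space k) setT F (@open _) erefl) => _ [A oA <-]; rewrite setTI.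
have [[a Aa]|A0] := pselect (A !=set0); last first.
  rewrite (_ : _ @^-1` _ = set0) //; apply/seteqP; split=> x //= Ax.
  by apply: A0; exists (F x).
have [y [Ay dense]] := dense_sequence (ex_intro _ a Aa).
pose inA (c : nat * nat) := forall w, enorm (y c.1 - w) < c.2.+1%:R^-1 -> A w.
rewrite (_ : _ @^-1` _ = \bigcup_(l : nat) \bigcup_(j : nat)
   (if `[< inA (l, j) >] then [set x | enorm (F x - y l) < j.+1%:R^-1] else set0)).
  apply: bigcup_measurable => l _; apply: bigcup_measurable => j _.
  case: ifP => // _; apply: lt_measurable; apply: measurable_enorm.
  by apply: coord_measurableB => //; exact: coord_measurable_cst.
apply/seteqP; split=> x /=; last first.
  move=> [l _ [j _]]; case: asboolP => //= h hx; apply: h; by rewrite enormC.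
move=> AFx; have [e e0 eA] := open_contains_ball oA AFx.
have [j je] : exists j : nat, j.+1%:R^-1 < e / 2.
  exists (Num.truncn (e / 2)^-1); rewrite invf_plt ?posrE ?ltr0n ?divr_gt0 //.
  exact: truncnS_gt.
have [l hl] := dense _ AFx j.+1%:R^-1 (ltac:(by rewrite invr_gt0 ltr0n)).
exists l => //; exists j => //; case: asboolP => //= -[] w /= yw; apply: eA.
have := enormD (F x - y l) (y l - w); rewrite addrA subrK => h; apply: (le_lt_trans h); apply: (lt_trans (ltrD hl yw)); rewrite [ltRHS]splitr; exact: ltrD.
Qed.

(** A function that is measurable in a parameter and Lipschitz in a vector is
    jointly measurable (Caratheodory): below any level it is a countable union,
    over a dense sequence, of conditions in which the vector is frozen. *)
Lemma caratheodory_measurable k (K : set 'cV[R]_k) G (phi : T -> 'cV[R]_k -> R)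
    (Y : T -> 'cV[R]_k) :
  0 <= G -> (forall x, lipschitz_on K G (phi x)) ->
  (forall y, K y -> measurable_fun setT (phi^~ y)) ->
  coord_measurable Y -> (forall x, K (Y x)) -> measurable_fun setT (fun x => phi x (Y x)).
Proof.
move=> G0 lphi mphi mY KY; apply: measurable_lt => c.
have [[x0]|T0] := pselect ([set: T] !=set0); last first.
  rewrite (_ : [set _ | _] = set0) //; apply/seteqP; split=> x //= _.
  by apply: T0; exists x.
move=> _; have [y [Ky dense]] := dense_sequence (ex_intro _ (Y x0) (KY x0)).
rewrite (_ : [set _ | _] = \bigcup_(l : nat) [set x | phi x (y l) + G * enorm (Y x - y l) < c]).
  apply: bigcup_measurable => l _; apply: lt_measurable.
  apply: measurable_funD; first exact: mphi.
  apply: measurable_funM; first exact: measurable_cst.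
  apply: measurable_enorm; apply: coord_measurableB => //.
apply/seteqP; split=> x /=; last first.
  by move=> [l _ /=]; have := lphi x _ _ (KY x) (Ky l); lra.
move=> hc; have e0 : 0 < (c - phi x (Y x)) / (2 * (G + 1)).
  by rewrite divr_gt0 ?mulr_gt0 // ?subr_gt0 //; lra.
have [l hl] := dense _ (KY x) _ e0; exists l => //=.
have := lphi x _ _ (Ky l) (KY x); rewrite (enormC (y l)).
move: hl; rewrite ltr_pdivlMr; last by lra.
have := enorm_ge0 (Y x - y l); nra.
Qed.

End Coordinates.

Lemma coord_measurable_comp d (T : measurableType d) d' (T' : measurableType d') k
   (F : T' -> 'cV[R]_k) (X : T -> T') :
  measurable_fun setT X -> coord_measurable F -> coord_measurable (F \o X).
Proof. by move=> mX mF j; have := measurableT_comp (mF j) mX; exact. Qed.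

Lemma borel_coord_measurable d (T : measurableType d) k (F : T -> 'cV[R]_k) :
  measurable_fun setT (F : T -> borel_space k) -> coord_measurable F.
Proof. by move=> mF; exact: (@coord_measurable_comp _ T _ (borel_space k) k id F mF (@coord_measurable_id k)). Qed.

End VectorMeasurability.

(** * The perturbations revealed before a round *)

Section Information.
Context {R : realType} d {Omega : measurableType d} (P : probability Omega R).
Context {n : nat} {p : 'I_n -> nat} (u : Omega -> @play R n p).
Hypothesis mu : forall i t B, (1 <= t)%N -> borel B ->
  measurable [set x | B (u x i t)].
Hypothesis indep : independent P u.

Lemma borelI k (A B : set 'cV[R]_k) : borel A -> borel B -> borel (A `&` B).
Proof. exact: (@measurableI _ (borel_space k)). Qed.

Lemma borelT k : borel [set: 'cV[R]_k].
Proof. exact: (@measurableT _ (borel_space k)). Qed.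

(** The product of [B] in position [(i, s)] and of the whole space elsewhere. *)
Definition only_at i (s : nat) (B : set 'cV[R]_(p i)) : forall j, nat -> set 'cV[R]_(p j) :=
  fun j s' => if s' == s then
    (if pselect (i = j) is left e then eq_rect i (fun j => set 'cV[R]_(p j)) B j e else setT)
    else setT.

Lemma only_atE i s B : @only_at i s B i s = B.
Proof.
rewrite /only_at eqxx; case: pselect => // e.
by rewrite (eq_irrelevance e (erefl i)).
Qed.

Lemma only_at_other i s B j s' : (j, s') != (i, s) -> @only_at i s B j s' = setT.
Proof.
rewrite /only_at; have [->|] := eqVneq s' s => //; case: pselect => // e; subst j.
by rewrite eqxx.
Qed.

Lemma only_at_borel i s B j s' : borel B -> borel (@only_at i s B j s').
Proof.
have [[-> ->]|ne] := eqVneq (j, s') (i, s); first by rewrite only_atE.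
by rewrite only_at_other // => _; exact: borelT.
Qed.

(** Events described by the perturbations of the rounds before [t]. *)
Definition revealed t : set (set Omega) :=
  [set A | exists B : forall i, nat -> set 'cV[R]_(p i), (forall i s, borel (B i s)) /\
     A = [set x | forall i s, (1 <= s < t)%N -> B i s (u x i s)]].

(** The sample space, with only these events measurable. *)
Definition information t := g_sigma_algebraType (revealed t).

Let before t := [seq (i, s) | i <- enum 'I_n, s <- iota 1 t.-1].

Let mem_before t i s : ((i, s) \in before t) = (1 <= s < t)%N.
Proof.
have -> : (1 <= s < t)%N = (s \in iota 1 t.-1) by rewrite mem_iota; lia.
apply/allpairsP/idP => [[[a b] /= [_ bs [_ ->]]] //|hs].
by exists (i, s); rewrite /= mem_enum.
Qed.

Let before_uniq t : uniq (before t).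
Proof. by apply: allpairs_uniq; rewrite ?enum_uniq ?iota_uniq // => -[? ?] [? ?]. Qed.

Let revealedE t (B : forall i, nat -> set 'cV[R]_(p i)) :
  [set x | forall i s, (1 <= s < t)%N -> B i s (u x i s)]
  = [set x | forall k, k \in before t -> B k.1 k.2 (u x k.1 k.2)].
Proof.
apply/seteqP; split=> x /= h; first by move=> [i s]; rewrite mem_before => hs; exact: h.
by move=> i s hs; apply: (h (i, s)); rewrite mem_before.
Qed.

Lemma revealed_measurable t : revealed t `<=` measurable.
Proof.
move=> _ [B [bB ->]]; rewrite revealedE.
have : forall k, k \in before t -> (1 <= k.2)%N by move=> [i s]; rewrite mem_before => /andP[].
elim: (before t) => [|k J IH] J1.
  by rewrite (_ : [set _ | _] = setT) //; apply/seteqP; split.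
rewrite (_ : [set _ | _] = [set x | B k.1 k.2 (u x k.1 k.2)] `&`
   [set x | forall k, k \in J -> B k.1 k.2 (u x k.1 k.2)]).
  apply: measurableI; first by apply: mu => //; apply: J1; rewrite mem_head.
  by apply: IH => l lJ; apply: J1; rewrite inE lJ orbT.
apply/seteqP; split=> x /= h.
  by split; [apply: h; rewrite mem_head | move=> l lJ; apply: h; rewrite inE lJ orbT].
by move=> l; rewrite inE => /predU1P[->|]; [exact: h.1|exact: h.2].
Qed.

Lemma information_measurable t (A : set (information t)) :
  measurable A -> measurable (A : set Omega).
Proof. by apply: smallest_sub; [exact: sigma_algebra_measurable|exact: revealed_measurable]. Qed.

Lemma measurable_information t :
  measurable_fun setT (id : Omega -> information t).
Proof. by move=> _ A mA; rewrite setTI; exact: (information_measurable mA). Qed.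

Lemma perturbation_revealed t i s : (1 <= s < t)%N ->
  measurable_fun setT (fun x : information t => u x i s : borel_space (p i)).
Proof.
move=> st _ B mB; rewrite setTI; apply: sub_sigma_algebra.
exists (only_at s B); split; first by move=> j s'; exact: only_at_borel.
apply/seteqP; split=> x /= h; last by have := h i s st; rewrite only_atE.
move=> j s' _; have [[-> ->]|ne] := eqVneq (j, s') (i, s); first by rewrite only_atE.
by rewrite only_at_other.
Qed.

(** The perturbation of round [t] is independent of the earlier rounds: the
    product rule on cylinders extends to the sigma-algebra they generate. *)
Lemma information_independent t i (A : set (information t)) B : (1 <= t)%N ->
  measurable A -> borel B ->
  P (A `&` [set x | B (u x i t)]) = (P A * P [set x | B (u x i t)])%E.
Proof.
move=> t1 mA bB; set Bt := [set x | _]; have mBt : measurable Bt by exact: mu.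
have PB : P Bt = (fine (P Bt))%:E by rewrite fineK // fin_num_measure.
have c0 : 0 <= fine (P Bt) by exact: fine_ge0.
pose c := NngNum c0.
pose m1 := mrestr P mBt; pose m2 := mscale c P.
suff : m1 A = m2 A by rewrite /m1 /m2 /mrestr /mscale /= => ->; rewrite -PB muleC.
apply: (g_sigma_algebra_measure_unique (revealed t) (@revealed_measurable t) (fun _ => setT)) => //.
- move=> _; exists (fun _ _ => setT); split; first by move=> *; exact: borelT.
  by apply/seteqP; split.
- by apply/seteqP; split=> // x _; exists 0.
- move=> _ _ [C [bC ->]] [D [bD ->]]; exists (fun i s => C i s `&` D i s).
  split; first by move=> j s; exact: borelI.
  apply/seteqP; split=> x /=; first by move=> [h1 h2] j s js; split; [exact: h1|exact: h2].
  by move=> h; split=> j s js; case: (h j s js).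
- move=> _ [C [bC ->]]; rewrite revealedE; set A0 := [set x | _].
  change (P (A0 `&` Bt) = ((fine (P Bt))%:E * P A0)%E); rewrite -PB /A0.
  pose C' j s := if s == t then @only_at i t B j s else C j s.
  have C'E k : k \in before t -> C' k.1 k.2 = C k.1 k.2.
    by case: k => j s; rewrite mem_before /C' /= => /andP[_ st]; rewrite ltn_eqF.
  have C'i : C' i t = B by rewrite /C' eqxx only_atE.
  have bC' j s : borel (C' j s) by rewrite /C'; case: ifP => // _; exact: only_at_borel.
  have prod J := @indep J C'.
  have U : uniq ((i, t) :: before t) by rewrite /= mem_before ltnn andbF before_uniq.
  have J1 k : k \in before t -> (1 <= k.2)%N by case: k => j s; rewrite mem_before => /andP[].
  have := prod _ U _ bC'; rewrite big_cons /= C'i => e1.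
  have := prod _ (before_uniq t) J1 bC' => e2.
  rewrite (_ : _ `&` _ = [set omega | forall k, k \in (i, t) :: before t -> C' k.1 k.2 (u omega k.1 k.2)]).
    rewrite e1; last by move=> k; rewrite inE => /predU1P[->//|]; exact: J1.
    rewrite -e2; congr (_ * P _)%E; apply/seteqP; split=> x /= h k kb.
      by rewrite -C'E //; exact: h.
    by rewrite C'E //; exact: h.
  apply/seteqP; split=> x /=.
    by move=> [h hB] k; rewrite inE => /predU1P[->/=|kb]; rewrite ?C'i // C'E //; exact: h.
  move=> h; split; last by have := h (i, t) (mem_head _ _); rewrite /= C'i.
  by move=> k kb; rewrite -C'E //; apply: h; rewrite inE kb orbT.
- move=> _; change (P (setT `&` Bt) < +oo)%E; by rewrite setTI PB ltry.
Qed.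

End Information.

(** * Averages over the sphere *)

Section SphereAverages.
Context {R : realType} d {Omega : measurableType d} (P : probability Omega R) {k : nat}.

Local Notation Eu := (borel_space (R := R) k).

Definition householder (v : 'cV[R]_k) : 'M[R]_k := 1%:M - (2 / dot v v) *: (v *m v^T).

Lemma trmx_mul_dot (v w : 'cV[R]_k) : v^T *m w = (dot w v)%:M.
Proof.
apply/matrixP => a b; rewrite !mxE !(ord1 a) !(ord1 b) eqxx mulr1n /dot.
by apply: eq_bigr => l _; rewrite !mxE mulrC.
Qed.

Lemma householderE v w : householder v *m w = reflect_along v w.
Proof.
rewrite /householder mulmxBl mul1mx -scalemxAl -mulmxA trmx_mul_dot mul_mx_scalar scalerA.
by rewrite /reflect_along; congr (_ - _ *: _); rewrite mulrAC.
Qed.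

Lemma householder_orthogonal v : dot v v != 0 -> householder v *m (householder v)^T = 1%:M.
Proof.
move=> v0; have -> : (householder v)^T = householder v.
  by rewrite /householder linearB /= linearZ /= trmx1 trmx_mul trmxK.
rewrite {2}/householder mulmxBr mulmx1 -scalemxAr mulmxA householderE.
rewrite (_ : reflect_along v v = - v); last first.
  by rewrite /reflect_along mulfK // scaler_nat mulr2n opprD addrA subrr sub0r.
by rewrite mulNmx scalerN opprK /householder subrK.
Qed.

Lemma dot_mulmx (Q : 'M[R]_k) (v w : 'cV[R]_k) : dot (Q *m v) w = dot v (Q^T *m w).
Proof.
have e (a b : 'cV[R]_k) : dot a b = (b^T *m a) 0 0 by rewrite trmx_mul_dot mxE eqxx mulr1n.
by rewrite !e trmx_mul trmxK mulmxA.
Qed.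

Lemma coord_measurable_mulmx d' (T : measurableType d') (Q : 'M[R]_k) (F : T -> 'cV[R]_k) :
  coord_measurable F -> coord_measurable (fun x => Q *m F x).
Proof.
move=> mF j; under eq_fun do rewrite mxE.
by apply: measurable_sum => l; apply: measurable_funM; [exact: measurable_cst|exact: mF].
Qed.

Variable U : {mfun Omega >-> Eu}.

Lemma average_law (h : Eu -> R) : bounded_measurable h ->
  \int[distribution P U]_e h e = \int[P]_o h (U o).
Proof.
move=> bh; rewrite /Rintegral integral_pushforward //.
  by apply/measurable_EFinP; case: bh.
apply: (@bounded_measurable_integrable _ _ _ P (h \o U)).
exact: bounded_measurable_comp.
Qed.

Hypothesis unifU : uniform_on_sphere P (U : Omega -> 'cV[R]_k).

(** Orthogonal invariance, passed from events to integrals. *)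
Lemma sphere_invariance (Q : 'M[R]_k) (h : Eu -> R) : Q *m Q^T = 1%:M ->
  bounded_measurable h ->
  \int[distribution P U]_e h (Q *m e) = \int[distribution P U]_e h e.
Proof.
move=> oQ bh; have [_ _ inv] := unifU.
have mQ : measurable_fun setT (fun e : Eu => Q *m e : Eu).
  by apply: coord_measurable_borel; apply: coord_measurable_mulmx; exact: coord_measurable_id.
pose QU := (fun e : Eu => Q *m e : Eu) \o U.
have mQU : measurable_fun setT QU by exact: measurableT_comp.
pose V : {mfun Omega >-> Eu} := mfun_Sub (mem_set mQU).
have bQ : bounded_measurable (fun e : Eu => h (Q *m e)) by exact: (bounded_measurable_comp mQ bh).
rewrite average_law // /Rintegral; congr fine.
transitivity (\int[distribution P V]_e (h e)%:E)%E.
  rewrite integral_pushforward //; first by apply/measurable_EFinP; case: bh.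
  apply: (@bounded_measurable_integrable _ _ _ P (h \o QU)).
  exact: bounded_measurable_comp.
apply: eq_measure_integral => A mA _; exact: inv.
Qed.

Lemma dot_bounded_measurable d' (T : measurableType d') (b : 'cV[R]_k) M (F : T -> 'cV[R]_k) :
  coord_measurable F -> (forall e, enorm (F e) <= M) -> bounded_measurable (fun e => dot (F e) b).
Proof.
move=> mF FM; split; first by apply: measurable_dot => // j; exact: measurable_cst.
exists (M * enorm b) => e; apply: le_trans (normr_dot _ _) _.
by rewrite ler_wpM2r ?enorm_ge0.
Qed.

(** Radial retraction onto the unit ball: it does not move the sphere, and makes
    every expression in a perturbation bounded. *)
Definition clip (e : 'cV[R]_k) : 'cV[R]_k := (Num.max 1 (enorm e))^-1 *: e.

Lemma clip_le1 e : enorm (clip e) <= 1.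
Proof.
have M1 : 0 < Num.max 1 (enorm e) by rewrite lt_max ltr01.
rewrite /clip enormZ ger0_norm ?invr_ge0 ?(ltW M1) // mulrC ler_pdivrMr // mul1r.
by rewrite le_max lexx orbT.
Qed.

Lemma clip_id e : enorm e = 1 -> clip e = e.
Proof. by rewrite /clip => ->; rewrite maxxx invr1 scale1r. Qed.

Lemma clip_coord_measurable : coord_measurable (clip : Eu -> _).
Proof.
have mid := @coord_measurable_id R k.
apply: coord_measurableZ => //.
have mm : measurable_fun setT (fun e : Eu => Num.max 1 (enorm (e : 'cV[R]_k))).
  by apply: measurable_maxr; [exact: measurable_cst|exact: measurable_enorm].
apply: measurable_lt => c; have [c0|c0] := ltP 0 c; last first.
  rewrite (_ : [set _ | _] = set0) //; apply/seteqP; split=> e //=.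
  by rewrite ltNge (le_trans c0) // invr_ge0 le_max ler01.
rewrite (_ : [set _ | _] = [set e | - Num.max 1 (enorm (e : 'cV[R]_k)) < - c^-1]).
  by apply: lt_measurable; apply: measurableT_comp => //; exact: measurable_oppr.
apply/seteqP; split=> e /=; rewrite ltrN2 invf_plt ?posrE ?lt_max ?ltr01 //.
Qed.

Lemma clip_reflect v e : clip (reflect_along v e) = reflect_along v (clip e).
Proof.
rewrite /clip reflect_norm /reflect_along scalerBr dotZl; congr (_ - _).
by rewrite scalerA; congr (_ *: _); ring.
Qed.

Lemma clipN e : clip (- e) = - clip e.
Proof. by rewrite /clip enormN scalerN. Qed.

(** The coordinates of a uniform point of the sphere all have the same second
    moment, in every direction, because a reflection maps any vector to any
    other one of the same norm. *)
Lemma sphere_second_moment (b : 'cV[R]_k) :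
  k%:R * \int[distribution P U]_e dot (clip e) b ^+ 2 = dot b b.
Proof.
have [_ U1 _] := unifU.
have bm (c : 'cV[R]_k) : bounded_measurable (fun e : Eu => dot (clip e) c ^+ 2).
  have := dot_bounded_measurable c clip_coord_measurable clip_le1.
  by move=> h; have := bounded_measurableM h h.
have same (c : 'cV[R]_k) : enorm c = enorm b ->
    \int[distribution P U]_e dot (clip e) c ^+ 2 = \int[distribution P U]_e dot (clip e) b ^+ 2.
  move=> cb; have [->//|cnb] := eqVneq c b.
  have v0 : dot (b - c) (b - c) != 0.
    by apply: contra_neq cnb => /dot_eq0/eqP; rewrite subr_eq0 => /eqP.
  have cc : dot c c = dot b b by rewrite -!sqr_enorm cb.
  rewrite -(sphere_invariance (householder_orthogonal v0) (bm c)); apply: eq_Rintegral => e _.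
  rewrite householderE clip_reflect; congr (_ ^+ 2).
  rewrite -householderE dot_mulmx; congr (dot _ _).
  have -> : (householder (b - c))^T = householder (b - c).
    by rewrite /householder linearB /= linearZ /= trmx1 trmx_mul trmxK.
  rewrite householderE /reflect_along.
  have -> : 2 * dot c (b - c) / dot (b - c) (b - c) = - 1.
    apply: (mulIf v0); rewrite divfK // !dotE cc (dotC c b); ring.
  by rewrite scaleN1r opprK addrC subrK.
pose bj j : 'cV[R]_k := enorm b *: delta_mx j 0.
have dbj j (e : 'cV[R]_k) : dot e (bj j) = enorm b * e j 0.
  rewrite /bj dotZr; congr (_ * _); rewrite /dot (bigD1 j) //= big1 ?addr0.
    by rewrite mxE !eqxx mulr1.
  by move=> l lj; rewrite mxE (negPf lj) mulr0.
have nbj j : enorm (bj j) = enorm b.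
  apply/eqP; rewrite -(eqrXn2 (n := 2)) ?enorm_ge0 // !sqr_enorm dbj !mxE !eqxx mulr1 -expr2.
  by rewrite sqr_enorm.
have -> : k%:R * \int[distribution P U]_e dot (clip e) b ^+ 2
   = \sum_(j < k) \int[distribution P U]_e dot (clip e) (bj j) ^+ 2.
  under eq_bigr do rewrite same //.
  by rewrite sumr_const card_ord mulr_natl.
have bint (c : 'cV[R]_k) : (distribution P U).-integrable setT (EFin \o (fun e : Eu => dot (clip e) c ^+ 2)).
  exact: bounded_measurable_integrable.
have -> : \sum_(j < k) \int[distribution P U]_e dot (clip e) (bj j) ^+ 2
   = \int[distribution P U]_e \sum_(j < k) dot (clip e) (bj j) ^+ 2.
  by rewrite average_sum.
have E (e : Eu) : \sum_(j < k) dot (clip e) (bj j) ^+ 2 = dot b b * dot (clip e) (clip e).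
  rewrite [X in _ * X]/dot mulr_sumr; apply: eq_bigr => j _.
  by rewrite dbj exprMn sqr_enorm expr2.
under eq_Rintegral do rewrite E.
rewrite average_law; last first.
  have := bounded_measurable_sum (index_enum 'I_k) (Q := xpredT) (fun j _ => bm (bj j)).
  by under eq_fun do rewrite E.
have E2 o : dot (clip (U o)) (clip (U o)) = 1 by rewrite clip_id // -sqr_enorm U1 expr1n.
under eq_Rintegral do rewrite E2 mulr1.
by rewrite Rintegral_cst // [X in _ * fine X](@probability_setT _ _ _ P) mulr1.
Qed.

Lemma bounded_measurable_mulmx (Q : 'M[R]_k) (h : Eu -> R) :
  bounded_measurable h -> bounded_measurable (fun e : Eu => h (Q *m e)).
Proof.
have mQ : measurable_fun setT (fun e : Eu => Q *m e : Eu).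
  by apply: coord_measurable_borel; apply: coord_measurable_mulmx; exact: coord_measurable_id.
by move=> bh; exact: (bounded_measurable_comp mQ bh).
Qed.

(** The one-point estimate points, on average, at least as much towards a
    comparator as convexity allows, up to the width of the perturbation. Averaging
    over the orbit of [e] under sign change and reflection along [z - y] reduces
    this to [reflection_average]; the weights average to [|z - y|^2 / k]. *)
Lemma smoothed_slope (K : set 'cV[R]_k) phi G dl z y : (0 < k)%N ->
  convex_set K -> convex_function K phi -> 0 <= G -> lipschitz_on K G phi -> 0 < dl ->
  (forall b, enorm b <= 1 -> K (z + dl *: b)) -> (forall b, enorm b <= 1 -> K (y + dl *: b)) ->
  phi z - phi y - G * dl
  <= k%:R / dl * \int[distribution P U]_e (phi (z + dl *: clip e) * dot (clip e) (z - y)).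
Proof.
move=> k0 vK cphi G0 lphi dl0 Kz Ky.
have kp : 0 < k%:R :> R by rewrite ltr0n.
have Kz0 : K z by have := Kz 0; rewrite scaler0 addr0 enorm0 ler01; exact.
have Ky0 : K y by have := Ky 0; rewrite scaler0 addr0 enorm0 ler01; exact.
set h := fun e : Eu => phi (z + dl *: clip e) * dot (clip e) (z - y).
have [v0|v0] := eqVneq (dot (z - y) (z - y)) 0.
  have zy := dot_eq0 v0; have E : z = y by apply/eqP; rewrite -subr_eq0 zy.
  rewrite (_ : \int[_]_e _ = 0) ?mulr0.
    by rewrite E subrr sub0r oppr_le0 mulr_ge0 // ltW.
  under eq_Rintegral do rewrite zy dotC dot0l mulr0.
  by rewrite Rintegral_cst // mul0r.
have N0 : 0 < dot (z - y) (z - y) by rewrite lt_neqAle eq_sym v0 dot_ge0.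
have bphi : bounded_measurable (fun e : Eu => phi (z + dl *: clip e)).
  split.
    apply: (@caratheodory_measurable _ _ Eu k K G (fun _ => phi)) => //.
      apply: coord_measurableD => //; apply: coord_measurableZ; first exact: measurable_cst.
      exact: clip_coord_measurable.
    by move=> e; apply: Kz; exact: clip_le1.
  exists (`|phi z| + G * dl) => e.
  have Ke := Kz _ (clip_le1 e).
  have nd : enorm (dl *: clip e) <= dl.
    by rewrite enormZ ger0_norm ?(ltW dl0) // ger_pMr // clip_le1.
  have := lphi _ _ Ke Kz0; have := lphi _ _ Kz0 Ke.
  rewrite opprD addrA subrr sub0r enormN addrAC subrr add0r.
  have := ler_wpM2l G0 nd; have := ler_norm (phi z); have := ler_norm (- phi z).
  rewrite normrN ler_norml; lra.
have bh : bounded_measurable h.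
  by apply: bounded_measurableM => //; exact: (dot_bounded_measurable _ clip_coord_measurable clip_le1).
pose H := householder (z - y).
have oH : H *m H^T = 1%:M by exact: householder_orthogonal.
have oN : (- 1%:M) *m (- 1%:M)^T = 1%:M :> 'M[R]_k by rewrite linearN /= trmx1 mulNmx mul1mx opprK.
have bN := bounded_measurable_mulmx (- 1%:M) bh.
have bH := bounded_measurable_mulmx H bh.
have bHN := bounded_measurable_mulmx H bN.
have iN := sphere_invariance oN bh.
have iH := sphere_invariance oH bh.
have iHN := sphere_invariance oH bN.
have bsum := bounded_measurableD (bounded_measurableD (bounded_measurableD bh bN) bH) bHN.
pose c := 4 * dl * (phi z - phi y - G * dl) / dot (z - y) (z - y).
have bsq : bounded_measurable (fun e : Eu => c * dot (clip e) (z - y) ^+ 2).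
  apply: bounded_measurableM; first exact: bounded_measurable_cst.
  have b1 := dot_bounded_measurable (z - y) clip_coord_measurable clip_le1.
  exact: (bounded_measurableM b1 b1).
have key : \int[distribution P U]_e (c * dot (clip e) (z - y) ^+ 2)
    <= 4 * \int[distribution P U]_e h e.
  have -> : 4 * \int[distribution P U]_e h e = \int[distribution P U]_e
     (h e + h (- 1%:M *m e) + h (H *m e) + h (- 1%:M *m (H *m e))).
    rewrite !RintegralD //; try by apply: bounded_measurable_integrable;
      do ?apply: bounded_measurableD.
    rewrite iHN iN iH; ring.
  apply: le_Rintegral => //; try exact: bounded_measurable_integrable.
  move=> e _; rewrite !mulNmx !mul1mx /H !householderE /h !clipN clip_reflect.
  have := reflection_average vK cphi G0 lphi (ltW dl0) Kz Ky v0 (clip_le1 e).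
  set e' := clip e; set e'' := reflect_along _ _.
  have re : dot e'' (z - y) = - dot e' (z - y) by rewrite /e'' reflect_dot.
  rewrite !dotNl re !scalerN => hav.
  rewrite -(ler_pM2r N0); apply: le_trans (le_trans _ hav) _.
    by rewrite le_eqVlt; apply/orP; left; apply/eqP; rewrite /c; field.
  by rewrite le_eqVlt; apply/orP; left; apply/eqP; ring.
have m2 := sphere_second_moment (z - y).
move: key; rewrite RintegralZl //; last first.
  apply: bounded_measurable_integrable.
  have b1 := dot_bounded_measurable (z - y) clip_coord_measurable clip_le1.
  exact: (bounded_measurableM b1 b1).
set S := \int[_]_e _ in m2 *; set J := \int[_]_e _ => key.
have -> : phi z - phi y - G * dl = k%:R / dl * (c * S / 4).
  have -> : k%:R / dl * (c * S / 4) = c * (k%:R * S) / (4 * dl) by field; rewrite gt_eqF.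
  by rewrite m2 /c; field; rewrite v0 gt_eqF.
apply: ler_wpM2l; first by rewrite divr_ge0 // ltW.
by move: key; lra.
Qed.

End SphereAverages.

(** * Adaptedness of the play *)

(** The increments of [t `^ (1 - th2)] are at most [2 * t.+1 `^ (- th2)], so the
    weight 11/8 exceeds what half of them takes away. *)
Lemma dual_potential_ge0 (R : realType) n m (W : nat -> 'M[R]_n)
    (q : 'I_n -> nat -> 'cV[R]_m) (th2 : R) T :
  0 < th2 <= 1 / 6 -> 0 <= dual_potential W q th2 T.
Proof.
move=> /andP[h0 h6]; rewrite addr_ge0 //.
  by rewrite mulr_ge0 ?divr_ge0 ?powR_ge0 ?sumr_ge0 // => i _; exact: dot_ge0.
rewrite big_nat sumr_ge0 // => t /andP[t1 _]; rewrite sumr_ge0 // => i _.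
rewrite mulr_ge0 ?dot_ge0 // -powRN.
have k01 : 1 / 2 <= 1 - th2 <= 1 by apply/andP; split; lra.
have /andP[_] := powR_natS_increment t1 k01.
rewrite (_ : 1 - th2 - 1 = - th2); last by ring.
have := powR_ge0 (t.+1%:R : R) (- th2); lra.
Qed.

Section RandomPlay.
Context {R : realType} {d : measure_display} {Omega : measurableType d}.
Variable P : probability Omega R.
Context {n m : nat} (p : 'I_n -> nat).
Hypotheses (n_gt0 : (0 < n)%N) (m_gt0 : (0 < m)%N) (p_gt0 : forall i, (0 < p i)%N).
Variables (E : nat -> rel 'I_n) (W : nat -> 'M[R]_n) (w : R) (iota : nat).
Unset Implicit Arguments.
Variables (X : forall i : 'I_n, set 'cV[R]_(p i)) (r Rad Ff Fg Gf Gg : 'I_n -> R).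
Variables (f : @play R n p -> @losses R n p) (g : @play R n p -> @constraints R n m p).
Variables (u z x : Omega -> @play R n p) (z1 : @decision R n p).
Variables (q : Omega -> 'I_n -> nat -> 'cV[R]_m).
Set Implicit Arguments.
Variables (th1 th2 th3 : R).
Hypotheses (mixW : mixing E W) (hA : assumption_network E W w iota)
  (hX : assumption_sets X r Rad) (adv : adversary X f g)
  (hfg : forall o, assumption_functions X (f (x o)) (g (x o)) Ff Fg Gf Gg)
  (unif : forall i t, (1 <= t)%N -> uniform_on_sphere P (fun o => u o i t))
  (indep : independent P u)
  (hth1 : 3 / 4 < th1 <= 5 / 6) (hth2 : th2 = 2 * th1 - 3 / 2)
  (hth3 : th3 = th1 - 1 / 2)
  (hz1 : forall o i, z o i 1%N = z1 i).
Hypothesis halg : forall o, algorithm1 p X W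
  (fun i t => r i ^+ 2 / (4 * m%:R * (p i)%:R ^+ 2 * Fg i ^+ 2 * t%:R `^ th1))
  (fun _ t => 2 / t%:R `^ th2)
  (fun _ t => 1 / t%:R `^ (1 - th2))
  (fun _ t => 1 / t.+1%:R `^ th3)
  (fun i t => r i / t.+1%:R `^ th3) (f (x o)) (g (x o)) (u o) (z o) (x o) (q o).

Local Notation Bor i := (borel_space (R := R) (p i)).

Let delta (i : 'I_n) (t : nat) : R := r i / t.+1%:R `^ th3.
Let a o i t := direction p W delta (f (x o)) (g (x o)) (u o) (z o) (q o) i t.+1.
Let L o i t : 'cV[R]_(p i) -> R := lagrangian W (f (x o)) (g (x o)) (q o) (i := i) t.

Let u1 o i t : (1 <= t)%N -> enorm (u o i t) = 1.
Proof. by move=> t1; have [_ h _] := unif i t1; exact: h. Qed.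

Let mu i t B : (1 <= t)%N -> borel B -> measurable [set o | B (u o i t)].
Proof. by move=> t1; have [h _ _] := unif i t1; exact: h. Qed.

Let xX o i t : (1 <= t)%N -> X i (x o i t).
Proof. exact: (played_feasible hX hth1 hth3 (halg o) (@u1 o)). Qed.

Let ballX o i t b : (1 <= t)%N -> enorm b <= 1 -> X i (z o i t + delta i t *: b).
Proof. exact: (center_in_ball hX hth1 hth3 (halg o)). Qed.

Let aE o i t : (1 <= t)%N ->
  a o i t = ((p i)%:R / delta i t * L o t (x o i t)) *: u o i t.
Proof. exact: (directionE (halg o)). Qed.

Let qtil o i t j : (1 <= t)%N ->
  0 <= qtilde W (q o) i t.+1 j 0 <= Fgmax Fg / 2 * t%:R `^ th2.
Proof. exact: (qtilde_bounds hA hX (hfg o) hth1 hth2 hth3 (halg o) (@u1 o)). Qed.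

Let X0 i : X i 0.
Proof.
apply: (set_inner_ball hX); rewrite /eball /= enorm0.
by have [/ltW] := set_radii hX i.
Qed.

Let F_lip o i t : (1 <= t)%N -> lipschitz_on (X i) (Gf i) (f (x o) i t).
Proof.
move=> t1; apply: (gradient_lipschitz (set_convex hX (i := i)) (loss_convex (hfg o) (i := i) t1)).
by move=> y Xy; exact: (loss_gradient (hfg o)).
Qed.

Let G_lip o i t j : (1 <= t)%N -> lipschitz_on (X i) (Gg i) (fun y => g (x o) i t y j 0).
Proof.
move=> t1; apply: (gradient_lipschitz (set_convex hX (i := i)) (constraint_convex (hfg o) (i := i) j t1)).
by move=> y Xy; exact: (constraint_gradient (hfg o)).
Qed.

Lemma information_mono s t : (s <= t)%N ->
  measurable_fun setT (id : information u t -> information u s).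
Proof.
move=> st; apply: (@measurability _ _ (information u t) (information u s) setT id (revealed u s) erefl).
move=> _ [_ [B [bB ->]] <-]; rewrite setTI; apply: sub_sigma_algebra.
exists (fun i l => if (l < s)%N then B i l else setT); split.
  by move=> i l; case: ifP => // _; exact: borelT.
apply/seteqP; split=> o /= h i l /andP[l1 ls]; first by case: ifP => // ls'; apply: h; rewrite l1.
by have := h i l; rewrite ls l1 (leq_trans ls st); exact.
Qed.

Lemma coord_information_mono s t k (F : Omega -> 'cV[R]_k) : (s <= t)%N ->
  coord_measurable (F : information u s -> _) -> coord_measurable (F : information u t -> _).
Proof. by move=> st; apply: coord_measurable_comp; exact: information_mono. Qed.

Definition adapted t := forall i,
  coord_measurable (fun o : information u t => z o i t) /\
  coord_measurable (fun o : information u t => q o i t).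

Lemma played_information s t i : (1 <= s < t)%N -> adapted s ->
  coord_measurable (fun o : information u t => x o i s).
Proof.
move=> /andP[s1 st] /(_ i)[zs _].
under eq_fun do rewrite (x_step _ _ _ _ _ _ _ _ _ _ _ _ _ _ (halg _)) //.
apply: coord_measurableD; first exact: (coord_information_mono (ltnW st)).
apply: coord_measurableZ; first exact: measurable_cst.
by apply: borel_coord_measurable; apply: perturbation_revealed; rewrite s1.
Qed.

(** The past is generated by the earlier decisions, which are adapted. *)
Lemma past_information t (F : @play R n p -> R) :
  (forall s, (1 <= s < t)%N -> adapted s) -> depends_on_past t F ->
  measurable_fun setT (fun o : information u t => F (x o)).
Proof.
move=> ad dF; set gens := [set C | exists i s B, [/\ (1 <= s < t)%N, borel B & C = [set h : @play R n p | B (h i s)]]].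
have mx : measurable_fun setT (x : information u t -> g_sigma_algebraType gens).
  apply: (@measurability _ _ (information u t) (g_sigma_algebraType gens) setT x gens erefl).
  move=> _ [_ [i [s [B [st bB ->]]]] <-].
  have := coord_measurable_borel (played_information st (ad s st)) measurableT bB.
  by rewrite setTI; exact.
move=> _ B mB; rewrite setTI.
have := mx measurableT (F @^-1` B) (dF B mB); rewrite setTI; exact.
Qed.

Section Observation.
Variables (t : nat) (t1 : (1 <= t)%N) (ad : forall s, (1 <= s < t)%N -> adapted s).
Variables (d' : measure_display) (S : measurableType d') (o_ : S -> Omega) (i : 'I_n).
Variable (Y : S -> 'cV[R]_(p i)).
Hypotheses (mo : measurable_fun setT (o_ : S -> information u t)) (mY : coord_measurable Y)
  (XY : forall s, X i (Y s)).

Lemma loss_measurable : measurable_fun setT (fun s => f (x (o_ s)) i t (Y s)).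
Proof.
have [_ _ Gf0 _] := fun_consts (hfg point) i.
apply: (@caratheodory_measurable _ _ S _ (X i) (Gf i) (fun s => f (x (o_ s)) i t)) => //; first exact: ltW.
  by move=> s; exact: F_lip.
move=> y Xy; have [h _] := adv t1 Xy.
exact: (measurableT_comp (past_information ad h) mo).
Qed.

Lemma constraint_measurable : coord_measurable (fun s => g (x (o_ s)) i t (Y s)).
Proof.
move=> j; have [_ _ _ Gg0] := fun_consts (hfg point) i.
apply: (@caratheodory_measurable _ _ S _ (X i) (Gg i) (fun s y => g (x (o_ s)) i t y j 0)) => //; first exact: ltW.
  by move=> s; exact: G_lip.
move=> y Xy; have [_ h] := adv t1 Xy.
exact: (measurableT_comp (past_information ad (h j)) mo).
Qed.

Lemma lagrangian_measurable : adapted t ->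
  measurable_fun setT (fun s => L (o_ s) t (Y s)).
Proof.
move=> adt; apply: measurable_funD; first exact: loss_measurable.
apply: measurable_dot; first exact: constraint_measurable.
apply: coord_measurable_sum => j; apply: coord_measurableZ; first exact: measurable_cst.
have [_ mq] := adt j; exact: (@coord_measurable_comp _ _ _ _ _ _ _ _ mo mq).
Qed.

End Observation.

Lemma direction_information t i : (1 <= t)%N -> (forall s, (1 <= s <= t)%N -> adapted s) ->
  coord_measurable (fun o : information u t.+1 => a o i t).
Proof.
move=> t1 ad.
have adt : adapted t by apply: ad; rewrite t1 leqnn.
under eq_fun do rewrite aE //.
apply: coord_measurableZ; last first.
  by apply: borel_coord_measurable; apply: perturbation_revealed; rewrite t1 ltnSn.
apply: measurable_funM; first exact: measurable_cst.
apply: (@lagrangian_measurable t t1 _ _ (information u t.+1) id i (fun o => x o i t)) => //.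
- by move=> s /andP[s1 st]; apply: ad; rewrite s1 ltnW.
- exact: information_mono.
- by apply: played_information; rewrite ?t1 ?ltnSn.
- by move=> o; exact: xX.
Qed.

(** Everything computed before round [t] is a Borel function of the
    perturbations of the earlier rounds. *)
Lemma adaptedP t : (1 <= t)%N -> adapted t.
Proof.
elim/ltn_ind: t => -[//|[|t]] IH _ i.
  split; first by under eq_fun do rewrite hz1; exact: coord_measurable_cst.
  have q1 o : q o i 1%N = 0 by case: (halg o).
  by under eq_fun do rewrite q1; exact: coord_measurable_cst.
have ad s : (1 <= s <= t.+1)%N -> adapted s by move=> /andP[s1 st]; exact: IH.
have [mz _] := IH t.+1 (ltnSn _) isT i.
have lift k (F : Omega -> 'cV[R]_k) : coord_measurable (F : information u t.+1 -> _) ->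
    coord_measurable (F : information u t.+2 -> _) by exact: coord_information_mono.
split.
  have zS o : z o i t.+2 = eproj (shrink (1 / t.+3%:R `^ th3) (X i))
    (z o i t.+1 - (r i ^+ 2 / (4 * m%:R * (p i)%:R ^+ 2 * Fg i ^+ 2 * t.+2%:R `^ th1)) *: a o i t.+1).
    by case: (halg o) => _ _ h _ _; rewrite h.
  under eq_fun do rewrite zS.
  move=> j; set K := shrink _ _.
  have /andP[x0 x1] := shrinkage_range hth1 hth3 (isT : 1 <= t.+2)%N.
  have cK : convex_set K by apply: shrink_convex; exact: (set_convex hX (i := i)).
  have clK : closed K by apply: shrink_closed => //; exact: (set_closed hX (i := i)).
  have K0 : K !=set0 by exists ((1 - 1 / t.+3%:R `^ th3) *: 0), 0.
  have KR : K `<=` eball (Rad i).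
    apply: shrink_bounded (@set_outer_ball _ _ _ _ _ _ hX i); rewrite ?(ltW x0) //.
    exact: (set_convex hX).
  apply: (@caratheodory_measurable _ _ (information u t.+2) _ setT 1
    (fun _ y => eproj K y j 0)) => //.
  - move=> _ y y' _ _; rewrite mul1r.
    have := eproj_nonexpansive y y' cK clK K0 KR; apply: le_trans.
    by have := enorm_coord (eproj K y - eproj K y') j; rewrite !mxE; apply: le_trans; exact: ler_norm.
  - apply: coord_measurableB; first exact: lift.
    apply: coord_measurableZ; first exact: measurable_cst.
    exact: direction_information.
have qS o : q o i t.+2 = pos_part
   ((1 - 2 / t.+2%:R `^ th2 * (1 / t.+2%:R `^ (1 - th2))) *: qtilde W (q o) i t.+2
    + (1 / t.+2%:R `^ (1 - th2)) *: g (x o) i t.+1 (x o i t.+1)).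
  by case: (halg o) => _ _ _ _ h; rewrite h.
move=> j; under eq_fun do rewrite qS pos_partE.
apply: measurable_maxr; first exact: measurable_cst.
apply: (coord_measurableD _ _ j).
  apply: coord_measurableZ; first exact: measurable_cst.
  apply: coord_measurable_sum => l; apply: coord_measurableZ; first exact: measurable_cst.
  by apply: lift; have [] := IH t.+1 (ltnSn _) isT l.
apply: coord_measurableZ; first exact: measurable_cst.
apply: (@constraint_measurable t.+1 isT _ _ (information u t.+2) id i (fun o => x o i t.+1)) => //.
- by move=> s /andP[s1 st]; apply: ad; rewrite s1 ltnW.
- exact: information_mono.
- by apply: played_information; [rewrite ltnSn | apply: IH; rewrite ?ltnSn].
- by move=> o; exact: xX.
Qed.


(** * One-point estimates and their averages *)

Lemma perturbation_measurable i t : (1 <= t)%N ->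
  measurable_fun setT (fun o => u o i t : borel_space (p i)).
Proof. by move=> t1 _ B mB; rewrite setTI; exact: mu. Qed.

(* Round 0 carries no perturbation; round 1 is used in its place. *)
Definition perturbation i t : {mfun Omega >-> Bor i} :=
  mfun_Sub (mem_set (@perturbation_measurable i t.-1.+1 isT)).

Let perturbationE i t o : (1 <= t)%N -> perturbation i t o = u o i t.
Proof. by case: t. Qed.

Definition lagrangian_bound i t : R := Ff i + m%:R * (Fg i * (Fgmax Fg / 2 * t%:R `^ th2)).

Lemma lagrangian_le o i t y : (1 <= t)%N -> X i y -> `|L o t y| <= lagrangian_bound i t.
Proof.
move=> t1 Xy; apply: le_trans (ler_normD _ _) _; apply: lerD; first exact: (loss_bound (hfg o)).
apply: le_trans (ler_norm_sum _ _ _) _.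
rewrite mulr_natl -[X in _ *+ X]card_ord -sumr_const; apply: ler_sum => j _.
have /andP[s0 sb] := qtil o i j t1.
by rewrite normrM (ger0_norm s0) ler_pM //; exact: (constraint_bound (hfg o)).
Qed.

(** The estimate that the perturbation [e] would have produced at round [t],
    written with the radial retraction so that it is bounded for every [e]. *)
Definition estimate i t (oe : Omega * 'cV[R]_(p i)) : 'cV[R]_(p i) :=
  ((p i)%:R / delta i t * L oe.1 t (z oe.1 i t + delta i t *: clip oe.2)) *: clip oe.2.

(** The average of the estimate over the perturbation of the round alone. *)
Definition mean_estimate o i t : 'cV[R]_(p i) :=
  \col_k \int[distribution P (perturbation i t)]_e estimate t (o, e) k 0.

Let estimateE o i t : (1 <= t)%N -> estimate t (o, u o i t) = a o i t.
Proof.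
move=> t1; rewrite /estimate /= clip_id ?u1 // aE // /delta.
by rewrite (x_step _ _ _ _ _ _ _ _ _ _ _ _ _ _ (halg o)).
Qed.

Lemma estimate_le i t (oe : Omega * 'cV[R]_(p i)) k : (1 <= t)%N ->
  `|@estimate i t oe k 0| <= `|(p i)%:R / delta i t| * lagrangian_bound i t.
Proof.
move=> t1; rewrite mxE 2!normrM -[leRHS]mulr1 ler_pM ?mulr_ge0 //.
  by rewrite ler_wpM2l // lagrangian_le //; apply: ballX => //; exact: clip_le1.
exact: le_trans (enorm_coord _ _) (clip_le1 _).
Qed.

Lemma estimate_bounded_measurable i t k : (1 <= t)%N ->
  bounded_measurable (fun oe : information u t * Bor i => estimate t oe k 0).
Proof.
move=> t1; split; last by eexists => oe; exact: estimate_le.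
have ad s : (1 <= s < t)%N -> adapted s by move=> /andP[s1 _]; exact: adaptedP.
have mcl : coord_measurable (fun oe : information u t * Bor i => clip oe.2).
  exact: (coord_measurable_comp measurable_snd (@clip_coord_measurable R (p i))).
have mz : coord_measurable (fun oe : information u t * Bor i => z oe.1 i t).
  by have [h _] := adaptedP t1 i; exact: (coord_measurable_comp measurable_fst h).
apply: (coord_measurableZ _ mcl k).
apply: measurable_funM; first exact: measurable_cst.
apply: (@lagrangian_measurable t t1 ad _ (information u t * Bor i)%type (fun oe => oe.1) i (fun oe => z oe.1 i t + delta i t *: clip oe.2)) => //.
- exact: measurable_fst.
- by apply: coord_measurableD => //; apply: coord_measurableZ => //; exact: measurable_cst.
- by move=> oe; apply: ballX => //; exact: clip_le1.
- exact: adaptedP.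
Qed.

Let estimate_section o i t k : (1 <= t)%N ->
  bounded_measurable (fun e : Bor i => estimate t (o, e) k 0).
Proof.
move=> t1; have [me [M hM]] := @estimate_bounded_measurable i t k t1.
split; last by exists M => e; exact: hM.
exact: (measurable_fun_pair2 (f := fun oe : information u t * Bor i => estimate t oe k 0)).
Qed.

Lemma information_perturbation_product i t (A : set (information u t)) B : (1 <= t)%N ->
  measurable A -> borel B ->
  P (A `&` perturbation i t @^-1` B) = (P A * P (perturbation i t @^-1` B))%E.
Proof. by case: t A => // t A _ mA bB; exact: (information_independent mu indep). Qed.

Let info_id t : measurable_fun setT (id : Omega -> information u t).
Proof. exact: (measurable_information mu). Qed.

(** Independence lets the perturbation of the round be integrated out first. *)
Lemma estimate_average i t k (H : information u t -> R) : (1 <= t)%N -> bounded_measurable H ->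
  bounded_measurable (fun o : information u t => H o * mean_estimate o i t k 0) /\
  \int[P]_o (H o * a o i t k 0) = \int[P]_o (H o * mean_estimate o i t k 0).
Proof.
move=> t1 bH.
pose idt : {mfun Omega >-> information u t} := mfun_Sub (mem_set (@info_id t)).
have bPhi : bounded_measurable (fun oe : information u t * Bor i =>
    H oe.1 * estimate t oe k 0).
  apply: bounded_measurableM; last exact: estimate_bounded_measurable.
  exact: (bounded_measurable_comp measurable_fst bH).
have ind A B : measurable A -> measurable B ->
    P (idt @^-1` A `&` perturbation i t @^-1` B)
    = (P (idt @^-1` A) * P (perturbation i t @^-1` B))%E.
  by move=> mA mB; exact: information_perturbation_product.
have avgE o : \int[distribution P (perturbation i t)]_e (H o * estimate t (o, e) k 0)
   = H o * mean_estimate o i t k 0.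
  by rewrite mxE RintegralZl //; apply: bounded_measurable_integrable; exact: estimate_section.
have [bavg eqavg] := independent_average ind bPhi.
split; first by under eq_fun do rewrite -avgE.
transitivity (\int[P]_o (H o * estimate t (o, perturbation i t o) k 0)).
  by apply: eq_Rintegral => o _; rewrite perturbationE // estimateE.
by rewrite eqavg; apply: eq_Rintegral => o _; rewrite -avgE.
Qed.

Lemma mean_estimate_bounded i t k : (1 <= t)%N ->
  bounded_measurable (fun o : information u t => mean_estimate o i t k 0).
Proof.
move=> t1; have [h _] := estimate_average k t1 (bounded_measurable_cst (information u t) 1).
by under eq_fun do rewrite -[mean_estimate _ _ _ _ _]mul1r.
Qed.

Lemma direction_bounded i t k : (1 <= t)%N ->
  bounded_measurable (fun o : information u t.+1 => a o i t k 0).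
Proof.
move=> t1; split.
  by apply: (direction_information (i := i) t1) => s /andP[s1 _]; exact: adaptedP.
by eexists => o; rewrite -estimateE //; exact: estimate_le.
Qed.

Lemma bounded_information s t (F : Omega -> R) : (s <= t)%N ->
  bounded_measurable (F : information u s -> R) -> bounded_measurable (F : information u t -> R).
Proof. by move=> st bF; exact: (bounded_measurable_comp (information_mono st) bF). Qed.

Lemma information_bounded t (F : Omega -> R) :
  bounded_measurable (F : information u t -> R) -> bounded_measurable F.
Proof. by move=> bF; exact: (bounded_measurable_comp (@info_id t) bF). Qed.

(** The estimates are centred around [mean_estimate], even when they are tested
    against a factor that depends on the past. *)
Lemma noise_centred i t k (H : information u t -> R) : (1 <= t)%N -> bounded_measurable H ->
  \int[P]_o (H o * (a o i t k 0 - mean_estimate o i t k 0)) = 0.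
Proof.
move=> t1 bH; have [bv eqv] := estimate_average k t1 bH.
under eq_Rintegral do rewrite mulrBr.
rewrite RintegralB //; first by rewrite eqv subrr.
- apply: bounded_measurable_integrable; apply: bounded_measurableM.
    exact: (@information_bounded t H).
  by apply: (@information_bounded t.+1 (fun o => a o i t k 0)); exact: direction_bounded.
- by apply: bounded_measurable_integrable; exact: (@information_bounded t (fun o => H o * mean_estimate o i t k 0)).
Qed.

(** [smoothed_slope] for the Lagrangian of the round, with the average taken
    coordinate by coordinate. *)
Lemma mean_estimate_ascent o i t y : (1 <= t)%N -> X i y ->
  L o t (z o i t) - L o t ((1 - 1 / t.+1%:R `^ th3) *: y)
    - lagrangian_slope W Gf Gg (q o) i t * (r i / t.+1%:R `^ th3)
  <= dot (mean_estimate o i t) (z o i t - (1 - 1 / t.+1%:R `^ th3) *: y).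
Proof.
move=> t1 Xy; have [r0 Rad0] := set_radii hX i.
have [_ _ Gf0 Gg0] := fun_consts (hfg o) i.
have dl0 : 0 < delta i t by rewrite divr_gt0 // powR_gt0 // ltr0n.
have Kz b : enorm b <= 1 -> X i (z o i t + delta i t *: b) by exact: ballX.
have Ky b : enorm b <= 1 -> X i ((1 - 1 / t.+1%:R `^ th3) *: y + delta i t *: b).
  exact: (perturbed_feasible r0 (set_convex hX (i := i)) (@set_inner_ball _ _ _ _ _ _ hX i) hth1 hth3 t1 Xy).
have S0 : 0 <= lagrangian_slope W Gf Gg (q o) i t.
  rewrite addr_ge0 ?(ltW Gf0) // mulr_ge0 ?(ltW Gg0) // sumr_ge0 // => j _.
  by have /andP[] := qtil o i j t1.
have unifU : uniform_on_sphere P (perturbation i t : Omega -> 'cV[R]_(p i)).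
  by exact: (unif i (t := t.-1.+1) isT).
have := smoothed_slope unifU (p_gt0 i) (set_convex hX (i := i))
  (lagrangian_convex hA hX (hfg o) hth1 hth2 hth3 (halg o) (@u1 o) (i := i) t1) S0
  (lagrangian_lipschitz hA hX (hfg o) hth1 hth2 hth3 (halg o) (@u1 o) (i := i) t1) dl0 Kz Ky.
move/le_trans; apply; rewrite le_eqVlt; apply/orP; left; apply/eqP.
set e0 := z o i t - _.
pose Est (e : Bor i) := estimate t (o, e).
have bk k : bounded_measurable (fun e : Bor i => Est e k 0 * e0 k 0).
  apply: bounded_measurableM; first exact: estimate_section.
  exact: bounded_measurable_cst.
have -> : dot (mean_estimate o i t) e0 = \int[distribution P (perturbation i t)]_e dot (Est e) e0.
  rewrite /dot (average_sum _ _ bk); apply: eq_bigr => k _.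
  rewrite mxE RintegralZr //; apply: bounded_measurable_integrable; exact: estimate_section.
pose h (e : Bor i) := L o t (z o i t + delta i t *: clip e) * dot (clip e) e0.
have dE e : dot (Est e) e0 = (p i)%:R / delta i t * h e by rewrite /Est /estimate dotZl /h mulrA.
have pd0 : (p i)%:R / delta i t != 0 :> R.
  by rewrite mulf_neq0 ?invr_eq0 ?(gt_eqF dl0) // pnatr_eq0 -lt0n p_gt0.
have bh : bounded_measurable h.
  have := bounded_measurableM (bounded_measurable_cst _ ((p i)%:R / delta i t)^-1)
    (bounded_measurable_sum (index_enum 'I_(p i)) (Q := xpredT) (fun k _ => bk k)).
  have hE e : ((p i)%:R / delta i t)^-1 * \sum_k Est e k 0 * e0 k 0 = h e.
    by rewrite -/(dot _ _) dE mulKf.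
  by under eq_fun do rewrite hE.
under [RHS]eq_Rintegral do rewrite dE.
by rewrite RintegralZl //; exact: bounded_measurable_integrable.
Qed.

(** * The noise *)

Variable T : nat.

Let test o i t : 'cV[R]_(p i) := @noise_direction R (p i) m (r i) (Fg i) th1 th3
  (z o i) (a o i) (mean_estimate o i) T t.

Definition noise_term o i t := dot (test o i t) (a o i t - mean_estimate o i t).

Lemma noise_direction_bounded i t k : (1 <= t)%N -> bounded_measurable
  (fun o : information u t => test o i t k 0).
Proof.
move=> t1.
have cst c := bounded_measurable_cst (information u t) (c : R).
have bv s : (1 <= s <= t)%N -> bounded_measurable (fun o : information u t => mean_estimate o i s k 0).
  by move=> /andP[s1 st]; apply: (@bounded_information s t) => //; exact: mean_estimate_bounded.
have ba s : (1 <= s < t)%N -> bounded_measurable (fun o : information u t => a o i s k 0).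
  by move=> /andP[s1 st]; apply: (@bounded_information s.+1 t) => //; exact: direction_bounded.
have bz : bounded_measurable (fun o : information u t => z o i t k 0).
  split; first by have [h _] := adaptedP t1 i.
  exists (Rad i) => o; apply: le_trans (enorm_coord _ _) _.
  have := @ballX o i t 0 t1; rewrite scaler0 addr0 enorm0 ler01 => /(_ isT).
  exact: (set_outer_ball hX).
have dirE o : test o i t k 0
  = @noise_weight R (p i) m (r i) (Fg i) th1 T *
     ((2 * (1 - 1 / t.+1%:R `^ th3)) *
        (\sum_(s <- index_iota 1 t | (1 <= s < t)%N)
           (1 - 1 / s.+1%:R `^ th3) * (a o i s k 0 - mean_estimate o i s k 0))
      - 2 * (1 - 1 / t.+1%:R `^ th3) ^+ 2 * mean_estimate o i t k 0) - z o i t k 0.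
  rewrite /test /noise_direction !mxE; congr (_ * (_ * _ - _) - _).
  rewrite /noise_sum summxE big_nat; apply: eq_bigr => s _; by rewrite !mxE.
under eq_fun do rewrite dirE.
apply: bounded_measurableB => //; apply: bounded_measurableM => //.
apply: bounded_measurableB; apply: bounded_measurableM => //; last by apply: bv; rewrite t1 leqnn.
apply: bounded_measurable_sum => s st; apply: bounded_measurableM => //.
by apply: bounded_measurableB; [exact: ba|apply: bv; case/andP: st => -> /ltnW].
Qed.

Let noise_coord_bounded i t k : (1 <= t)%N ->
  bounded_measurable (fun o => test o i t k 0 * (a o i t k 0 - mean_estimate o i t k 0)).
Proof.
move=> t1; apply: bounded_measurableM.
  exact: (@information_bounded t (fun o => test o i t k 0) (noise_direction_bounded k t1)).
apply: bounded_measurableB; first exact: (@information_bounded t.+1 (fun o => a o i t k 0) (direction_bounded k t1)).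
exact: (@information_bounded t (fun o => mean_estimate o i t k 0) (mean_estimate_bounded k t1)).
Qed.

Let noise_termE o i t :
  noise_term o i t = \sum_k test o i t k 0 * (a o i t k 0 - mean_estimate o i t k 0).
Proof. by apply: eq_bigr => k _; rewrite !mxE. Qed.

Lemma noise_term_bounded i t : (1 <= t)%N -> bounded_measurable (fun o => noise_term o i t).
Proof.
move=> t1; under eq_fun do rewrite noise_termE.
by apply: bounded_measurable_sum => k _; exact: noise_coord_bounded.
Qed.

Lemma noise_term_centred i t : (1 <= t)%N -> \int[P]_o noise_term o i t = 0.
Proof.
move=> t1; under eq_Rintegral do rewrite noise_termE.
rewrite average_sum; last by move=> k; exact: noise_coord_bounded.
rewrite big1 // => k _.
exact: (@noise_centred i t k (fun o : information u t => test o i t k 0) t1 (noise_direction_bounded k t1)).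
Qed.

Definition total_noise o := \sum_i \sum_(1 <= t < T.+1) noise_term o i t.

Lemma total_noise_bounded : bounded_measurable total_noise.
Proof.
apply: bounded_measurable_sum => i _; under eq_fun do rewrite big_nat.
by apply: bounded_measurable_sum => t /andP[t1 _]; exact: noise_term_bounded.
Qed.

Lemma total_noise_centred : \int[P]_o total_noise o = 0.
Proof.
have b i t : bounded_measurable (fun o => noise_term o i t.+1) by exact: noise_term_bounded.
have E1 o : total_noise o = \sum_i \sum_(0 <= t < T) noise_term o i t.+1.
  by apply: eq_bigr => i _; rewrite big_add1.
under eq_Rintegral do rewrite E1.
rewrite average_sum; last by move=> i; exact: bounded_measurable_sum.
rewrite big1 // => i _; rewrite average_sum // big1 // => t _.
exact: noise_term_centred.
Qed.

(** The noise drops out because it is centred, and [integral_le_dominated] applies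
    to an arbitrary [F]. *)
Lemma expectation_le (F : Omega -> R) c rho : (forall o, F o <= c + rho * total_noise o) ->
  ('E_P[F] <= c%:E)%E.
Proof.
move=> Fc; rewrite unlock.
have bc := bounded_measurable_cst Omega c.
have bZ := bounded_measurableM (bounded_measurable_cst Omega rho) total_noise_bounded.
have bb := bounded_measurableD bc bZ.
apply: (@le_trans _ _ (\int[P]_o (c + rho * total_noise o)%:E)%E).
  by apply: integral_le_dominated => o; rewrite lee_fin.
have -> : (\int[P]_o (c + rho * total_noise o)%:E)%E = (\int[P]_o (c + rho * total_noise o))%:E.
  rewrite /Rintegral fineK //.
  exact: (integrable_fin_num measurableT (bounded_measurable_integrable P bb)).
rewrite RintegralD //; [|exact: bounded_measurable_integrable..].
rewrite RintegralZl //; last exact/bounded_measurable_integrable/total_noise_bounded.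
rewrite total_noise_centred mulr0 addr0 Rintegral_cst //.
by rewrite [X in _ * fine X](@probability_setT _ _ _ P) mulr1.
Qed.

(** * The bounds in expectation *)

Hypothesis T1 : (1 <= T)%N.

Let CC1 := C1 m p r Rad Ff Fg Gf Gg w iota th1 th2 th3.

Let th2_01 : 0 < th2 <= 1 / 6.
Proof. by case/andP: hth1 => h1 h2; rewrite hth2; apply/andP; split; lra. Qed.

Lemma regret_plus_potential o y : static_feasible X (g (x o)) T y ->
  Reg (f (x o)) T (x o) (constant_play y) + dual_potential W (q o) th2 T
  <= CC1 * T%:R `^ th1 + total_noise o.
Proof.
exact: (pathwise_regret n_gt0 m_gt0 p_gt0 mixW hA hX (hfg o) hth1 hth2 hth3 (halg o)
  (@u1 o) T1 (fun i t y => @mean_estimate_ascent o i t y)).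
Qed.

Theorem regret_expectation (xopt : Omega -> @decision R n p) :
  (forall o, static_feasible X (g (x o)) T (xopt o)) ->
  ('E_P[fun o => Reg (f (x o)) T (x o) (constant_play (xopt o))]
   <= (CC1 * T%:R `^ th1)%:E)%E.
Proof.
move=> feas; apply: (@expectation_le _ _ 1) => o; rewrite mul1r.
apply: le_trans (regret_plus_potential (feas o)).
by rewrite lerDl dual_potential_ge0.
Qed.

Lemma regret_constant_ge0 : 0 <= CC1.
Proof.
case/andP: hth1 => h1 h2.
have Fm := @Fgmax_ge0 R n Fg.
rewrite /CC1 /C1 addr_ge0 //; last first.
  have [t20 _] := andP th2_01.
  rewrite divr_ge0 ?(ltW t20) // /C0 addr_ge0 //; last by rewrite mulr_ge0 ?exprn_ge0 ?mulr_ge0.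
  have D0 := disagreement_constant_ge0 n_gt0 hA.
  have : 0 <= 6 * m%:R * n%:R ^+ 2 * Fgmax Fg ^+ 2 by rewrite !mulr_ge0 ?sqr_ge0.
  by move=> c0; have := mulr_ge0 c0 D0; rewrite mulrA.
apply: sumr_ge0 => i _; have [r0 Rad0] := set_radii hX i.
have [Ff0 Fg0 Gf0 Gg0] := fun_consts (hfg point) i.
have K0 : 0 <= 2 * r i + Rad i by lra.
have e1 : 0 <= 1 - th3 + th2 by rewrite hth3 hth2; lra.
have e2 : 0 <= 1 - th3 by rewrite hth3; lra.
have e3 : 0 <= 1 - th1 + 2 * th3 by rewrite hth3; lra.
have sq (c : R) : 0 <= c ^+ 2 by rewrite sqr_ge0.
rewrite !addr_ge0 ?divr_ge0 //; try by rewrite !mulr_ge0 // ltW.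
Qed.

(** For every weight [rho] the violation is at most [rho A + B / rho] in
    expectation; the best weight turns this into [2 sqrt (A B)]. *)
Theorem violation_expectation :
  (forall o, static_feasible X (g (x o)) T !=set0) ->
  ('E_P[fun o => enorm (pos_part (\sum_(1 <= t < T.+1)
       total_constraint (g (x o)) t (at_round (x o) t)))]
   <= (Num.sqrt (C2 m p r Rad Ff Fg Gf Gg w iota th1 th2 th3) * T%:R `^ (7 / 4 - th1))%:E)%E.
Proof.
move=> feas; case/andP: hth1 => h1 h2.
have [t20 t26] := andP th2_01.
have T0 : 0 < T%:R :> R by rewrite ltr0n.
have S0 : 0 < \sum_i Ff i.
  rewrite (bigD1 (Ordinal n_gt0)) //=.
  have [Ff0 _ _ _] := fun_consts (hfg point) (Ordinal n_gt0).
  rewrite ltr_pwDl // sumr_ge0 // => i _; by have [/ltW] := fun_consts (hfg point) i.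
have C10 := regret_constant_ge0.
pose K := 2 * \sum_i Ff i + CC1.
pose A := K * T%:R.
pose B := n%:R / 2 * (1 + (1 - th2)^-1) * T%:R `^ (1 - th2).
have K0 : 0 < K by rewrite /K; lra.
have A0 : 0 < A by rewrite mulr_gt0.
have n0 : 0 < n%:R :> R by rewrite ltr0n.
have k0 : 0 < (1 - th2)^-1 by rewrite invr_gt0; lra.
have B0 : 0 < B.
  by rewrite !mulr_gt0 ?powR_gt0 // ?divr_gt0 // addr_gt0.
have bound rho o : 0 < rho ->
    enorm (pos_part (\sum_(1 <= t < T.+1) total_constraint (g (x o)) t (at_round (x o) t)))
    <= (rho * A + B / rho) + rho * total_noise o.
  move=> rho0; have [y fy] := feas o.
  have := play_violation hA hX (hfg o) hth1 hth2 hth3 (halg o) (@u1 o) T1 rho0.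
  move/le_trans; apply.
  have := regret_plus_potential fy.
  have := regret_ge hX (hfg o) hth1 hth3 (halg o) (@u1 o) T1 fy.
  have : CC1 * T%:R `^ th1 <= CC1 * T%:R.
    rewrite ler_wpM2l // -[leRHS](powRr1 (ltW T0)) ler_powR ?ler1n //; lra.
  move=> i1 i2 i3.
  have : rho * dual_potential W (q o) th2 T <= rho * (A + total_noise o).
    by rewrite ler_pM2l // /A /K; lra.
  have -> : B / rho = n%:R / (2 * rho) * (1 + (1 - th2)^-1) * T%:R `^ (1 - th2).
    rewrite /B; set c := (1 - th2)^-1; set e := T%:R `^ _.
    by field; rewrite gt_eqF.
  lra.
pose sa := Num.sqrt A; pose sb := Num.sqrt B.
have sa0 : 0 < sa by rewrite sqrtr_gt0.
have sb0 : 0 < sb by rewrite sqrtr_gt0.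
have saE : A = sa ^+ 2 by rewrite sqr_sqrtr // ltW.
have sbE : B = sb ^+ 2 by rewrite sqr_sqrtr // ltW.
have rho0 : 0 < sb / sa by rewrite divr_gt0.
have := @expectation_le _ _ _ (fun o => bound _ o rho0).
move/le_trans; apply; rewrite lee_fin.
have -> : sb / sa * A + B / (sb / sa) = 2 * (sa * sb).
  by rewrite saE sbE; field; rewrite !gt_eqF.
set M := \big[Num.max/0]_(i < n) (Ff i ^+ 2 / (Fg i ^+ 2 * (1 - th1 + 2 * th3))).
have M0 : 0 <= M by exact: bigmax_ge_id.
have C2E : C2 m p r Rad Ff Fg Gf Gg w iota th1 th2 th3 = 2 * n%:R * (1 + M + (1 - th2)^-1) * K.
  by [].
rewrite C2E; set c2 := 2 * _ * _ * K.
have c20 : 0 <= c2.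
  by rewrite mulr_ge0 ?(ltW K0) // mulr_ge0 ?mulr_ge0 ?(ltW n0) // !addr_ge0 // ltW.
rewrite -ler_sqr ?nnegrE; last 2 first.
- by rewrite !mulr_ge0 // ltW.
- by rewrite mulr_ge0 ?powR_ge0.
rewrite !exprMn -saE -sbE sqr_sqrtr //.
have -> : (T%:R `^ (7 / 4 - th1)) ^+ 2 = T%:R * T%:R `^ (1 - th2) :> R.
  rewrite -powR_mulrn ?powR_ge0 // -powRrM.
  have -> : (7 / 4 - th1) * 2 = 1 + (1 - th2) by rewrite hth2; field.
  by rewrite powRD ?(gt_eqF T0) ?implybT // powRr1 // ltW.
set e := T%:R `^ (1 - th2).
have -> : 2 ^+ 2 * (A * B) = 2 * n%:R * (1 + (1 - th2)^-1) * K * (T%:R * e).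
  by rewrite /A /B -/e; set c := (1 - th2)^-1; field.
have e0 : 0 <= T%:R * e by rewrite mulr_ge0 ?powR_ge0 // ltW.
apply: ler_wpM2r => //; apply: ler_wpM2r; first exact: ltW.
by apply: ler_wpM2l; [rewrite mulr_ge0 // ltW|lra].
Qed.

End RandomPlay.

Unset Implicit Arguments.

Theorem corollary1 (R : realType) (d : measure_display)
  (Omega : measurableType d) (P : probability Omega R)
  (n m : nat) (p : 'I_n -> nat)
  (n_gt0 : (0 < n)%N) (m_gt0 : (0 < m)%N) (p_gt0 : forall i, (0 < p i)%N)
  (E : nat -> rel 'I_n) (W : nat -> 'M[R]_n) (w : R) (iota : nat)
  (X : forall i : 'I_n, set 'cV[R]_(p i))
  (r Rad Ff Fg Gf Gg : 'I_n -> R)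
  (f : @play R n p -> @losses R n p)
  (g : @play R n p -> @constraints R n m p)
  (u z x : Omega -> @play R n p) (z1 : @decision R n p)
  (q : Omega -> 'I_n -> nat -> 'cV[R]_m)
  (theta1 theta2 theta3 : R)
  (mixW : mixing E W)
  (hA : assumption_network E W w iota)
  (hX : assumption_sets X r Rad)
  (adv : adversary X f g)
  (hfg : forall omega,
     assumption_functions X (f (x omega)) (g (x omega)) Ff Fg Gf Gg)
  (feas : forall omega T, (1 <= T)%N ->
     feasible X (g (x omega)) T !=set0 /\
     static_feasible X (g (x omega)) T !=set0)
  (unif : forall i t, (1 <= t)%N ->
     uniform_on_sphere P (fun omega => u omega i t))
  (indep : independent P u)
  (htheta1 : 3 / 4 < theta1 <= 5 / 6)
  (htheta2 : theta2 = 2 * theta1 - 3 / 2)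
  (htheta3 : theta3 = theta1 - 1 / 2)
  (hz1 : forall omega i, z omega i 1%N = z1 i)
  (halg : forall omega,
     algorithm1 p X W
       (fun i t => r i ^+ 2 /
          (4 * m%:R * (p i)%:R ^+ 2 * Fg i ^+ 2 * t%:R `^ theta1))
       (fun _ t => 2 / t%:R `^ theta2)
       (fun _ t => 1 / t%:R `^ (1 - theta2))
       (fun _ t => 1 / t.+1%:R `^ theta3)
       (fun i t => r i / t.+1%:R `^ theta3)
       (f (x omega)) (g (x omega)) (u omega) (z omega) (x omega) (q omega)) :
  forall T : nat, (1 <= T)%N ->
    (forall xopt : Omega -> @decision R n p,
       (forall omega,
          static_optimum X (f (x omega)) (g (x omega)) T (xopt omega)) ->
       ('E_P[fun omega =>
          Reg (f (x omega)) T (x omega) (constant_play (xopt omega))]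
        <= (C1 m p r Rad Ff Fg Gf Gg w iota theta1 theta2 theta3
            * T%:R `^ theta1)%:E)%E)
    /\
    ('E_P[fun omega =>
       enorm (pos_part (\sum_(1 <= t < T.+1)
         total_constraint (g (x omega)) t (at_round (x omega) t)))]
     <= (Num.sqrt (C2 m p r Rad Ff Fg Gf Gg w iota theta1 theta2 theta3)
         * T%:R `^ (7 / 4 - theta1))%:E)%E.
Proof.
move=> T T1; split=> [xopt opt|].
  apply: (regret_expectation n_gt0 m_gt0 p_gt0 mixW hA hX adv hfg unif indep
    htheta1 htheta2 htheta3 hz1 halg T1) => omega.
  by case: (opt omega).
apply: (violation_expectation n_gt0 m_gt0 p_gt0 mixW hA hX adv hfg unif indep
  htheta1 htheta2 htheta3 hz1 halg T1) => omega.
by case: (feas omega T T1).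
Qed.
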